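(* Let $P:\mathbb C\to\mathbb C$ be a monic polynomial of degree $d>1$, and for $k\ge1$ let $q_k=P^k$ denote the $k$th iterate of $P$. Let $K(P)$ be the filled-in Julia set of $P$, $\Omega(P)=\mathbb C\setminus K(P)$, and let $g_\Omega$ be the Green's function of $\Omega(P)$ with pole at infinity. Let $C\subset\Omega(P)$ be compact and such that $\partial C$ does not contain any critical points of $g_\Omega$. Let $s$ denote the number of critical points of $g_\Omega$ in $C$ counted with multiplicity. Then for any $m\in\{0,1,\ldots\}$ there exists $k_0$ such that for all $k\ge k_0$ the $m$th derivative $q_k^{(m)}$ has exactly $sm$ roots in $C$ counted with multiplicity.
   Context: The filled-in Julia set is $K(P)=\{z\in\mathbb C:(P^k(z))_k\text{ is a bounded sequence}\}$; it is compact, nonempty and $\Omega(P)$ is connected. The Green's function $g_\Omega$ with pole at infinity is given by $g_\Omega=p_\omega-I(\omega)$, where $\omega$ is the equilibrium probability measure of $K(P)$, $p_\omega(z)=\int\log|z-w|\,d\omega(w)$ and $I(\omega)=\iint\log|z-w|\,d\omega(w)\,d\omega(z)$; for monic $P$ one has $g_\Omega=p_\omega$ on $\Omega(P)$. Critical points of the harmonic function $g_\Omega$ are the zeros of the holomorphic function $g_\Omega'=2\frac{\partial g_\Omega}{\partial z}=\left(\frac{\partial}{\partial x}-i\frac{\partial}{\partial y}\right)g_\Omega$ on $\Omega(P)$, and the multiplicity of a critical point is the order of the zero. *)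

(* Defs.v *)
From HB Require Import structures.
From mathcomp Require Import all_boot all_order all_algebra.
From mathcomp Require Import all_classical all_reals all_analysis.
From mathcomp Require Import complex.

Set Implicit Arguments.
Unset Strict Implicit.
Unset Printing Implicit Defensive.

Import Order.TTheory GRing.Theory Num.Theory numFieldNormedType.Exports.

Local Open Scope classical_set_scope.
Local Open Scope ring_scope.

(* Bundling R[i] as a numClosedFieldType makes the topology and the normed
   module structure over itself available. *)
Definition cplx (R : realType) : numClosedFieldType := R[i].

Notation borel_cplx R := (g_sigma_algebraType (@open (cplx R))).

Section Dynamics.
Variable R : realType.
Implicit Types P : {poly cplx R}.

Definition poly_iter P (k : nat) : {poly cplx R} :=
  iter k (fun q => P \Po q) 'X.

Definition filled_julia P : set (cplx R) :=
  [set z | bounded_fun (fun k : nat => (poly_iter P k).[z])].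

Definition basin_infty P : set (cplx R) := ~` filled_julia P.

End Dynamics.

Section Potential.
Variable R : realType.
Implicit Types (K : set (cplx R)) (mu nu : probability (borel_cplx R) R).

(* The kernel takes the value -oo on the diagonal. *)
Definition log_dist (z w : cplx R) : \bar R := lne (Normc.normc (z - w))%:E.

Definition log_potential mu (z : cplx R) : \bar R :=
  (\int[mu]_w log_dist z w)%E.

Definition log_energy mu : \bar R := (\int[mu]_z log_potential mu z)%E.

(* With the sign convention of log_dist, energy is to be maximized. *)
Definition equilibrium_measure K mu : Prop :=
  mu K = 1%E /\
  forall nu, nu K = 1%E -> (log_energy nu <= log_energy mu)%E.

(* Green's function with pole at infinity of the complement of the set whose
   equilibrium measure is mu; only its values on that complement matter. *)
Definition green_function mu (z : cplx R) : R :=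
  fine (log_potential mu z - log_energy mu)%E.

End Potential.

Section CriticalPoints.
Variable R : realType.
Implicit Types (g : cplx R -> R) (f : cplx R -> cplx R) (U A : set (cplx R)).

Definition partial_x g (z : cplx R) : R :=
  derive1 (fun t : R => g (z + (t +i* 0)%C)) 0.

Definition partial_y g (z : cplx R) : R :=
  derive1 (fun t : R => g (z + (0 +i* t)%C)) 0.

(* 2 dg/dz = (d/dx - i d/dy) g *)
Definition complex_gradient g (z : cplx R) : cplx R :=
  (partial_x g z -i* partial_y g z)%C.

Definition critical_points U g : set (cplx R) :=
  [set z | U z /\ complex_gradient g z = 0].

(* h is holomorphic near z0: derivability is over cplx R. *)
Definition zero_order f (z0 : cplx R) (n : nat) : Prop :=
  exists h : cplx R -> cplx R,
    [/\ \forall z \near z0, derivable h z 1,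
        h z0 != 0
      & \forall z \near z0, f z = (z - z0) ^+ n * h z].

Definition nb_critical_points U g A (s : nat) : Prop :=
  finite_set (A `&` critical_points U g) /\
  exists ord : cplx R -> nat,
    (forall z, (A `&` critical_points U g) z ->
       zero_order (complex_gradient g) z (ord z)) /\
    \sum_(z \in A `&` critical_points U g) ord z = s.

(* The zero polynomial has no root count. *)
Definition nb_roots (q : {poly cplx R}) A (n : nat) : Prop :=
  q != 0 /\ \sum_(z \in A `&` [set z | root q z]) mup z q = n.

Definition boundary A : set (cplx R) := closure A `\` interior A.

End CriticalPoints.

(* Main.v *)
Require Import Defs.
From HB Require Import structures.
From mathcomp Require Import all_boot all_order all_algebra.
From mathcomp Require Import all_classical all_reals all_analysis.
From mathcomp Require Import complex.
From mathcomp Require Import measurable_realfun.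
From mathcomp Require Import ring lra.

Set Implicit Arguments.
Unset Strict Implicit.
Unset Printing Implicit Defensive.

Import Order.TTheory GRing.Theory Num.Theory numFieldNormedType.Exports.

Local Open Scope classical_set_scope.
Local Open Scope ring_scope.

(** Write [q_k] for [poly_iter P k]. If [r] is an escape radius then the orbits
    of all points near [C] are, from a common time [n] on, outside the disc of
    radius [c = r + 1]. The theorem holds because, in [C], the critical points
    of the Green's function are the zeros of the derivative of [q_n], with the
    same multiplicities, while for large [k] the [m]-th derivative of [q_k] has
    [m] zeros near each such zero and no other zero in [C]. Both facts are read
    off the fibres [fib k], the lists of the [d ^ k] roots of [q_k - c]
    ([fibre_exists]), which lie in the disc of radius [c] and away from [C].

    Roots of derivatives. For [m > 0] the [m]-th derivatives of [q_k] and of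
    [q = q_k - c] agree. The quotient of [q^(m)] by [q] is the sum of the
    products of the [1 / (z - a)] over the [m]-tuples of distinct roots, and the
    [m]-th power of the logarithmic derivative of [q] is the same sum over all
    [m]-tuples; since only a proportion of order [d ^ - k] of the tuples has a
    repetition, the two are close ([derivn_logder_le]), provided that the
    logarithmic derivative has the order [d ^ k]. By the chain rule
    ([logder_chain]) it is the derivative of [q_n] at [z] times the logarithmic
    derivative of [q_(k-n) - c] at [q_n z]; and as [q_n z] is outside the disc
    of the fibre, the terms of the latter lie in a half plane and do not cancel
    ([Re_inv_ge]). So the order is [d ^ k] off the zeros of the derivative of
    [q_n], and Rouche's theorem around these zeros counts the roots
    ([derivative_root_count]). Rouche's theorem itself follows from Jensen's
    formula on two concentric circles ([rouche_annulus]).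

    Green's function. The uniform probability measures on the fibres have a weak
    limit [nu] along an ultrafilter ([weak_limit]). Its logarithmic potential is
    0 on the filled Julia set and, on the basin, the limit of the means of the
    logarithms of [N (z - a)] over [a] in [fib k] ([balanced_measure], after
    Brolin). To see that the equilibrium measure has the same potential, one
    writes twice the logarithm of [N (z - w)] as a sum of functions of one
    variable plus [ln (1 - sker z w)], where [1 - sker z w] is the squared half
    chordal distance on the sphere. The kernel [sker] is positive semidefinite
    of finite rank and the series of [- ln (1 - s)] has nonnegative
    coefficients, so [- ln (1 - sker)] is an increasing limit of such kernels;
    hence the energy is strictly concave, in a form that only involves sums of
    squares of differences of moments ([equilibrium_potential]).

    Critical points. Differentiation of the potential of [nu] on the basin gives
    the limit of the normalized logarithmic derivatives
    ([gradient_fibre_potential]). By the chain rule again this is the derivative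
    of [q_n] at [z] times a differentiable function of [q_n z] without zeros
    ([mean_logder_factor], [outer_factor_neq0]). Therefore the critical points
    in [C] and their orders are those of the zeros of the derivative of [q_n];
    those on the boundary of [C] are excluded by hypothesis, and the others have
    a small disc in [C]. *)

(** * Modulus of complex numbers *)

Section Modulus.
Variable R : realType.
Local Notation C := (cplx R).
Local Notation N := (@Normc.normc R).
Implicit Types z w : C.

Lemma modE z : `|z| = (N z)%:C%C :> C. Proof. by []. Qed.
Lemma mod_ge0 z : 0 <= N z.
Proof. by case: z => a b; exact: sqrtr_ge0. Qed.
Lemma mod0 : N (0 : C) = 0. Proof. exact: Normc.normc0. Qed.
Lemma mod1 : N (1 : C) = 1. Proof. exact: Normc.normc1. Qed.
Lemma mod_eq0 z : (N z == 0) = (z == 0).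
Proof.
by apply/eqP/eqP => [|->]; [exact: Normc.eq0_normc | exact: mod0].
Qed.
Lemma mod_gt0 z : (0 < N z) = (z != 0).
Proof. by rewrite lt_def mod_ge0 andbT mod_eq0. Qed.
Lemma modM z w : N (z * w) = N z * N w. Proof. exact: Normc.normcM. Qed.
Lemma modV z : N z^-1 = (N z)^-1. Proof. exact: Normc.normcV. Qed.
Lemma mod_div z w : N (z / w) = N z / N w. Proof. by rewrite modM modV. Qed.
Lemma modN z : N (- z) = N z. Proof. exact: normcN. Qed.
Lemma modD z w : N (z + w) <= N z + N w. Proof. exact: le_normcD. Qed.
Lemma modB z w : N (z - w) <= N z + N w.
Proof. by rewrite -(modN w); exact: modD. Qed.
Lemma modC z w : N (z - w) = N (w - z). Proof. by rewrite -modN opprB. Qed.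
Lemma mod_tri z w : N z - N w <= N (z - w).
Proof. by rewrite lerBlDr -{1}(subrK w z); exact: modD. Qed.
Lemma mod_triD z w : N z - N w <= N (z + w).
Proof. by rewrite -(modN w) -{2}(opprK w); exact: mod_tri. Qed.
Lemma mod_dist z w : `|N z - N w| <= N (z - w).
Proof. by rewrite ler_norml mod_tri andbT lerNl opprB modC mod_tri. Qed.
Lemma modX z n : N (z ^+ n) = N z ^+ n.
Proof. by elim: n => [|n IH]; rewrite ?expr0 ?mod1// !exprS modM IH. Qed.
Lemma mod_real (x : R) : N (x%:C%C : C) = `|x|.
Proof. by rewrite /Normc.normc /= expr0n addr0 sqrtr_sqr. Qed.
Lemma mod_nat n : N (n%:R : C) = n%:R.
Proof. by rewrite -(rmorph_nat (real_complex R)) mod_real normr_nat. Qed.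
Lemma mod_prod (I : Type) (s : seq I) (P : pred I) (f : I -> C) :
  N (\prod_(i <- s | P i) f i) = \prod_(i <- s | P i) N (f i).
Proof. by apply: (big_morph N modM mod1). Qed.
Lemma mod_sum (I : Type) (s : seq I) (P : pred I) (f : I -> C) :
  N (\sum_(i <- s | P i) f i) <= \sum_(i <- s | P i) N (f i).
Proof.
apply: (big_ind2 (fun x y => N x <= y)) => //; first by rewrite mod0.
by move=> x1 x2 y1 y2 h1 h2; apply: (le_trans (modD _ _)); rewrite lerD.
Qed.
Lemma modsq z : N z ^+ 2 = complex.Re z ^+ 2 + complex.Im z ^+ 2.
Proof. by case: z => a b; rewrite sqr_sqrtr// addr_ge0// sqr_ge0. Qed.
Lemma Re_le_mod z : `|complex.Re z| <= N z.
Proof.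
rewrite -(ler_pXn2r (n:=2)) ?nnegrE ?mod_ge0//.
by rewrite modsq real_normK ?num_real// lerDl sqr_ge0.
Qed.
Lemma Im_le_mod z : `|complex.Im z| <= N z.
Proof.
rewrite -(ler_pXn2r (n:=2)) ?nnegrE ?mod_ge0//.
by rewrite modsq real_normK ?num_real// lerDr sqr_ge0.
Qed.
Lemma mod_le_ReIm z : N z <= `|complex.Re z| + `|complex.Im z|.
Proof.
rewrite -(ler_pXn2r (n:=2)) ?nnegrE ?mod_ge0 ?addr_ge0//.
rewrite modsq -(real_normK (num_real (complex.Re z))).
rewrite -(real_normK (num_real (complex.Im z))) sqrrD.
by rewrite addrAC lerDl mulrn_wge0// mulr_ge0.
Qed.

Lemma nbhs_mod z (A : set C) :
  nbhs z A <-> exists2 e : R, 0 < e & forall w, N (w - z) < e -> A w.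
Proof.
split.
  move=> /nbhs_ballP [e /= e0 He]; exists (complex.Re e).
    by move: e0; rewrite ltcE => /andP[_].
  move=> w hw; apply: He; rewrite /ball /= distrC modE ltcE /=.
  by rewrite hw andbT; move: e0; rewrite ltcE => /andP[/eqP ->].
move=> [e e0 He]; apply/nbhs_ballP; exists (e%:C%C); first by rewrite /= ltcR.
by move=> w; rewrite /ball /= distrC modE ltcR => /He.
Qed.

End Modulus.

(** * Higher derivatives and logarithmic derivatives *)

Section LogDerivative.
Variable R : realType.
Local Notation C := (cplx R).
Local Notation N := (@Normc.normc R).

Definition rootpoly (s : seq C) : {poly C} := \prod_(a <- s) ('X - a%:P).

Definition logder (s : seq C) (z : C) : C := \sum_(a <- s) (z - a)^-1.

Lemma rootpoly_cons a s : rootpoly (a :: s) = ('X - a%:P) * rootpoly s.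
Proof. by rewrite /rootpoly big_cons. Qed.

Lemma horner_rootpoly s z : (rootpoly s).[z] = \prod_(a <- s) (z - a).
Proof.
by rewrite /rootpoly horner_prod; apply: eq_bigr => a _; rewrite hornerXsubC.
Qed.

Lemma rootpoly_neq0 s z : z \notin s -> (rootpoly s).[z] != 0.
Proof. by rewrite -root_prod_XsubC. Qed.

Lemma derivn_XsubCM (a : C) (q : {poly C}) m :
  (('X - a%:P) * q)^`(m.+1) = ('X - a%:P) * q^`(m.+1) + q^`(m) *+ m.+1.
Proof.
elim: m => [|m IH].
  by rewrite !derivn1 derivn0 derivM derivXsubC mul1r addrC mulr1n.
rewrite derivnS IH derivD derivMn derivM derivXsubC mul1r -!derivnS.
by rewrite [q^`(m.+1) + _]addrC -addrA -mulrS.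
Qed.

Lemma ffact_succ (D m : nat) :
  (D.+1 ^_ m.+1 = D ^_ m.+1 + m.+1 * D ^_ m)%N.
Proof.
rewrite ffactSS ffactnSr; case: (leqP m D) => h.
  by rewrite (mulnC (D ^_ m)) -mulnDl addnS subnK.
by rewrite ffact_small// !muln0.
Qed.

(** The expression has nonnegative coefficients in [x] and [p]: it is the sum
    of the binomial terms of degree at least 2 in [x]. *)
Lemma binomial_tail_le (x p : C) (e f : R) (m : nat) :
  N x <= e -> N p <= f ->
  N ((x + p) ^+ m.+1 - p ^+ m.+1 - (x * p ^+ m) *+ m.+1)
    <= (e + f) ^+ m.+1 - f ^+ m.+1 - (e * f ^+ m) *+ m.+1.
Proof.
move=> xe pf; have e0 := le_trans (mod_ge0 x) xe.
have f0 := le_trans (mod_ge0 p) pf.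
elim: m => [|m IH].
  rewrite !expr1 !expr0 !mulr1 !mulr1n.
  by rewrite addrK subrr mod0 addrK subrr.
have rec (T : comRingType) (a b : T) :
    (a + b) ^+ m.+2 - b ^+ m.+2 - (a * b ^+ m.+1) *+ m.+2 =
    (a + b) * ((a + b) ^+ m.+1 - b ^+ m.+1 - (a * b ^+ m) *+ m.+1)
    + (a ^+ 2 * b ^+ m) *+ m.+1.
  rewrite -(mulr_natr (a * _)) -(mulr_natr (a * b ^+ m)) -(mulr_natr (a ^+ 2 * _)).
  rewrite (exprS _ m.+1) (exprS b m.+1) (exprS b m) -[m.+2%:R]natr1.
  by move: (_ ^+ m.+1) (b ^+ m) (m.+1%:R) => A B n; ring.
rewrite !rec; apply: (le_trans (modD _ _)); apply: lerD.
  rewrite modM ler_pM ?mod_ge0//; apply: (le_trans (modD _ _)).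
  exact: lerD.
rewrite -mulr_natr modM mod_nat mulr_natr lerMn2r /= modM !modX.
by rewrite ler_pM ?exprn_ge0 ?mod_ge0// lerXn2r ?nnegrE ?mod_ge0//.
Qed.

Lemma derivn_rootpoly_cons a s z m : z != a -> z \notin s ->
  (rootpoly (a :: s))^`(m.+1).[z] / (rootpoly (a :: s)).[z] =
  (rootpoly s)^`(m.+1).[z] / (rootpoly s).[z]
  + (z - a)^-1 * ((rootpoly s)^`(m).[z] / (rootpoly s).[z]) *+ m.+1.
Proof.
move=> za zs; have q0 := rootpoly_neq0 zs; have za0 : z - a != 0 by rewrite subr_eq0.
rewrite rootpoly_cons derivn_XsubCM !(hornerXsubC, hornerD, hornerM, hornerMn).
rewrite mulrDl mulrnAl; congr (_ + _ *+ _).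
  by rewrite invfM mulrACA divff ?mul1r.
by rewrite invfM mulrCA.
Qed.

(** The quotient [q^(m) / q] sums the products of reciprocals over the
    [m]-tuples of distinct roots, the power of the logarithmic derivative over
    all [m]-tuples; the difference counts the tuples with a repetition. *)
Lemma derivn_logder_le (s : seq C) (z : C) (y : R) (m : nat) :
  z \notin s -> (forall a, a \in s -> N (z - a)^-1 <= y) -> 0 <= y ->
  N (logder s z ^+ m - (rootpoly s)^`(m).[z] / (rootpoly s).[z])
    <= ((size s ^ m)%:R - (size s ^_ m)%:R) * y ^+ m.
Proof.
move=> + + y0; elim: s m => [|a s IH] m.
  move=> _ _; rewrite /logder /rootpoly !big_nil; case: m => [|m].
    by rewrite expr0 derivn0 hornerC divr1 subrr mod0 mulr_ge0 ?exprn_ge0// subrr.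
  rewrite expr0n derivnC /= horner0 mul0r subrr mod0 exp0n// subrr.
  by rewrite mul0r.
rewrite inE negb_or => /andP[za zs] hy.
have hs b : b \in s -> N (z - b)^-1 <= y by move=> bs; rewrite hy// inE bs orbT.
have ha : N (z - a)^-1 <= y by rewrite hy// inE eqxx.
case: m => [|m].
  rewrite !expr0 derivn0 divff; first by rewrite !subrr mod0 mul0r.
  by rewrite rootpoly_neq0// inE negb_or za.
rewrite derivn_rootpoly_cons//.
have -> : logder (a :: s) z = (z - a)^-1 + logder s z.
  by rewrite /logder big_cons.
have hp : N (logder s z) <= (size s)%:R * y.
  apply: (le_trans (mod_sum _ _ _)).
  apply: (@le_trans _ _ (\sum_(b <- s) y)).
    by rewrite [leLHS]big_seq [leRHS]big_seq; apply: ler_sum => b /hs.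
  by rewrite big_const_seq count_predT iter_addr addr0 mulr_natl.
set x := (z - a)^-1; set p := logder s z.
set u := fun i => (rootpoly s)^`(i).[z] / (rootpoly s).[z].
rewrite -/(u m.+1) -/(u m).
have -> : (x + p) ^+ m.+1 - (u m.+1 + x * u m *+ m.+1) =
   (p ^+ m.+1 - u m.+1) + x * (p ^+ m - u m) *+ m.+1 +
   ((x + p) ^+ m.+1 - p ^+ m.+1 - (x * p ^+ m) *+ m.+1).
  rewrite -(mulr_natr (x * u m)) -(mulr_natr (x * (_ - _))) -(mulr_natr (x * p ^+ m)).
  by move: (_ ^+ m.+1) (p ^+ m.+1) (p ^+ m) (m.+1%:R) => A B D n; ring.
have h1 := IH m.+1 zs hs; have h2 := IH m zs hs.
have h3 := binomial_tail_le m ha hp.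
apply: (le_trans (modD _ _)).
apply: (le_trans (lerD (modD _ _) h3)).
apply: (le_trans (lerD (lerD h1 (lexx _)) (lexx _))).
have h4 : N (x * (p ^+ m - u m) *+ m.+1) <=
   y * (((size s ^ m)%:R - (size s ^_ m)%:R) * y ^+ m) * m.+1%:R.
  by rewrite -[X in N X]mulr_natr !modM mod_nat ler_wpM2r// ler_pM ?mod_ge0.
apply: (le_trans (lerD (lerD (lexx _) h4) (lexx _))).
rewrite [size (a :: s)]/= ffact_succ natrD natrM !natrX.
rewrite -[(size s).+1%:R]nat1r.
have -> : (y * ((size s)%:R * y) ^+ m) *+ m.+1 =
   (y * ((size s)%:R * y) ^+ m) * m.+1%:R by rewrite mulr_natr.
have -> : y + (size s)%:R * y = (1 + (size s)%:R) * y by ring.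
rewrite !exprMn !(exprS y m) (exprS (size s)%:R m).
rewrite le_eqVlt; apply/orP; left; apply/eqP.
move: ((1 + _) ^+ m.+1) ((size s)%:R ^+ m) (y ^+ m) (m.+1%:R) => A B D n.
by move: ((size s ^_ m)%:R) ((size s ^_ m.+1)%:R) ((size s)%:R) => F G E; ring.
Qed.

(** With [m = 1] no tuple has a repetition, so the bound of
    [derivn_logder_le] is 0. *)
Lemma logderE s z : z \notin s ->
  logder s z = (rootpoly s)^`().[z] / (rootpoly s).[z].
Proof.
move=> zs; have := @derivn_logder_le s z (\sum_(a <- s) N (z - a)^-1) 1 zs.
rewrite ffactn1 expn1 subrr mul0r expr1 derivn1 => h; apply/eqP.
rewrite -subr_eq0 -mod_eq0 eq_le mod_ge0 andbT; apply: h; last first.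
  by apply: sumr_ge0 => a _; exact: mod_ge0.
move=> a ha; rewrite (big_rem a ha) /= lerDl.
by apply: sumr_ge0 => b _; exact: mod_ge0.
Qed.

End LogDerivative.

(** * Counting roots *)

Section RootCount.
Variable R : realType.
Local Notation C := (cplx R).
Implicit Types (s : seq C) (A : set C).

Definition count_in A s : nat := count (fun z => z \in A) s.

Lemma closed_factor (q : {poly C}) : q != 0 ->
  exists s, q = lead_coef q *: rootpoly s.
Proof. by move=> _; have [s qE] := closed_field_poly_normal q; exists s. Qed.

Lemma count_mem_sum s (P : pred C) :
  (\sum_(z <- [seq z <- undup s | P z]) count_mem z s)%N = count P s.
Proof.
under eq_bigr do rewrite -sum1_count big_mkcond /=.
rewrite exchange_big /= -sum1_count [RHS]big_mkcond /=.
apply: eq_big_seq => x xs; case: ifPn => Px.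
  have hx : x \in [seq z <- undup s | P z] by rewrite mem_filter mem_undup Px.
  rewrite (bigD1_seq x hx) ?filter_uniq ?undup_uniq//=.
  rewrite eqxx big1 ?addn0// => z zx.
  by rewrite eq_sym (negbTE zx).
rewrite big_seq big1// => z; rewrite mem_filter => /andP[Pz _].
by case: eqP => // xz; rewrite xz Pz in Px.
Qed.

Lemma nb_roots_count (q : {poly C}) (k : C) s A n : k != 0 ->
  q = k *: rootpoly s -> n = count_in A s -> nb_roots q A n.
Proof.
move=> k0 qE ->; have s0 : rootpoly s != 0.
  by rewrite monic_neq0// monic_prod_XsubC.
have q0 : q != 0 by rewrite qE scaler_eq0 negb_or k0.
split=> //; have rE z : root q z = (z \in s).
  by rewrite qE rootZ// root_prod_XsubC.
have mE z : mup z q = count_mem z s.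
  rewrite qE -mul_polyC mupMr ?mu_prod_XsubC//.
  by rewrite rootC.
have -> : A `&` [set z | root q z] =
    [set` [seq z <- undup s | z \in A]].
  apply/seteqP; split => z /=.
    by rewrite mem_filter mem_undup rE => -[/mem_set -> ->].
  by rewrite mem_filter mem_undup rE => /andP[/set_mem ? ?].
rewrite -fsbig_seq ?filter_uniq ?undup_uniq//.
under eq_bigr do rewrite mE.
exact: count_mem_sum.
Qed.

Lemma finite_roots_in (q : {poly C}) A : q != 0 ->
  finite_set (A `&` [set z | root q z]).
Proof.
move=> q0; have [s qE] := closed_factor q0.
apply: (@sub_finite_set _ _ [set` s]); last exact: finite_seq.
move=> z /= [_]; rewrite qE rootZ ?lead_coef_eq0//.
by rewrite root_prod_XsubC.
Qed.

(** Used with small discs around the zeros of one polynomial to localize the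
    zeros of another one. *)
Lemma count_cluster s A (bs : seq C) (B : C -> set C) :
  uniq bs ->
  (forall a b b', a \in s -> b \in bs -> b' \in bs ->
     a \in B b -> a \in B b' -> b = b') ->
  (forall a, a \in s -> a \in A <-> exists2 b, b \in bs & a \in B b) ->
  count_in A s = (\sum_(b <- bs) count_in (B b) s)%N.
Proof.
move=> ubs disj cov; rewrite /count_in.
under [RHS]eq_bigr do rewrite -sum1_count big_mkcond /=.
rewrite exchange_big /= -sum1_count [LHS]big_mkcond /=.
apply: eq_big_seq => a hs; case: ifPn => aA.
  have [b bb aB] := (cov a hs).1 aA.
  rewrite (bigD1_seq b)//= aB big_seq_cond big1 ?addn0// => b' /andP[b'b nb].
  by case: ifPn => // aB'; rewrite (disj a b b') ?eqxx// in nb.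
rewrite big_seq big1// => b bb; case: ifPn => // aB.
by rewrite ((cov a hs).2 _) in aA => //; exists b.
Qed.

Lemma count_in_cat A s1 s2 :
  count_in A (s1 ++ s2) = (count_in A s1 + count_in A s2)%N.
Proof. exact: count_cat. Qed.

Lemma rootpoly_cat s1 s2 :
  rootpoly (s1 ++ s2) = rootpoly s1 * rootpoly s2.
Proof. by rewrite /rootpoly big_cat. Qed.

Lemma rootpolyX s n : rootpoly s ^+ n = rootpoly (flatten (nseq n s)).
Proof.
elim: n => [|n IH]; first by rewrite expr0 /rootpoly big_nil.
by rewrite exprS IH /= rootpoly_cat.
Qed.

Lemma count_in_flatten A s n :
  count_in A (flatten (nseq n s)) = (n * count_in A s)%N.
Proof. by elim: n => //= n IH; rewrite count_in_cat IH mulSn. Qed.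

Lemma count_in0 A s : (forall a, a \in s -> ~ A a) -> count_in A s = 0%N.
Proof.
move=> h; apply/eqP; rewrite -leqn0 leqNgt -has_count; apply/hasP => -[a sa].
by move=> /set_mem; exact: h.
Qed.

End RootCount.

(** * Escape of orbits *)

Section Iteration.
Variable R : realType.
Local Notation C := (cplx R).
Local Notation N := (@Normc.normc R).
Implicit Types (P p q : {poly C}) (z w : C).

Lemma poly_bounded p (B : R) : exists2 M, 0 <= M &
  forall z, N z <= B -> N p.[z] <= M.
Proof.
elim/poly_ind: p => [|p c [M M0 IH]].
  by exists 0 => // z _; rewrite horner0 mod0.
exists (M * `|B| + N c); first by rewrite addr_ge0 ?mulr_ge0 ?mod_ge0.
move=> z zB; rewrite !hornerE; apply: (le_trans (modD _ _)).
rewrite lerD2r modM ler_pM ?mod_ge0 ?IH//.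
by apply: (le_trans zB); rewrite ler_norm.
Qed.

Lemma poly_lipschitz p (B : R) : exists2 L, 0 <= L &
  forall z w, N z <= B -> N w <= B -> N (p.[z] - p.[w]) <= L * N (z - w).
Proof.
elim/poly_ind: p => [|p c [L L0 IH]].
  by exists 0 => // z w _ _; rewrite !horner0 subrr mod0 mul0r.
have [M M0 hM] := poly_bounded p B.
exists (L * `|B| + M); first by rewrite addr_ge0 ?mulr_ge0.
move=> z w zB wB; rewrite !hornerE opprD addrACA subrr addr0.
have -> : p.[z] * z - p.[w] * w = (p.[z] - p.[w]) * z + p.[w] * (z - w).
  by ring.
apply: (le_trans (modD _ _)); rewrite !modM mulrDl; apply: lerD; last first.
  by rewrite ler_wpM2r ?mod_ge0 ?hM.
rewrite mulrAC ler_pM ?mod_ge0 ?IH//.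
by apply: (le_trans zB); rewrite ler_norm.
Qed.

Lemma poly_iterS P k z : (poly_iter P k.+1).[z] = P.[(poly_iter P k).[z]].
Proof. by rewrite /poly_iter /= horner_comp. Qed.

Lemma poly_iter0 P : poly_iter P 0 = 'X. Proof. by []. Qed.

Lemma poly_iterD P j k : poly_iter P (j + k) = poly_iter P j \Po poly_iter P k.
Proof.
elim: j => [|j IH]; first by rewrite poly_iter0 comp_polyX.
by rewrite addSn /poly_iter !iterS -/(poly_iter P _) -/(poly_iter P j) IH
  comp_polyA.
Qed.

Lemma poly_iterD_horner P j k z :
  (poly_iter P (j + k)).[z] = (poly_iter P j).[(poly_iter P k).[z]].
Proof. by rewrite poly_iterD horner_comp. Qed.

Lemma size_poly_iter P d k : P \is monic -> size P = d.+1 ->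
  (0 < d)%N -> poly_iter P k \is monic /\ size (poly_iter P k) = (d ^ k).+1.
Proof.
move=> Pm sP d0; elim: k => [|k [IHm IHs]].
  by rewrite poly_iter0 monicX size_polyX expn0.
rewrite /poly_iter iterS -/(poly_iter P k).
have dk0 : (0 < d ^ k)%N by rewrite expn_gt0 d0.
have cm : P \Po poly_iter P k \is monic.
  apply/monicP; rewrite lead_coef_comp ?IHs ?ltnS//.
  by rewrite (monicP Pm) (monicP IHm) expr1n mulr1.
split=> //; rewrite -(prednK (_ : (0 < size (P \Po poly_iter P k))%N)).
  by rewrite size_comp_poly IHs sP /= expnS.
by rewrite lt0n size_poly_eq0 monic_neq0.
Qed.

Lemma monic_lower_le P d z : P \is monic -> size P = d.+1 ->
  1 <= N z ->
  N (P.[z] - z ^+ d) <= (\sum_(i < d) N P`_i) * N z ^+ d.-1.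
Proof.
move=> Pm sP z1; rewrite horner_coef sP big_ord_recr /=.
have -> : P`_d = 1 by have /monicP := Pm; rewrite /lead_coef sP.
rewrite mul1r addrK; apply: (le_trans (mod_sum _ _ _)).
rewrite mulr_suml; apply: ler_sum => i _.
rewrite modM modX ler_wpM2l ?mod_ge0// ler_weXn2l//.
by case: d {sP} i => [[]//|d] i /=; rewrite -ltnS.
Qed.

(** Doubling, rather than mere growth, gives the divergence of the orbits at
    once; the leading monomial provides it at large moduli. *)
Definition escape_radius P (r : R) : Prop :=
  1 <= r /\ forall z, r < N z -> 2 * N z <= N P.[z].

Lemma escape_radius_exists P d : P \is monic -> size P = d.+1 -> (1 < d)%N ->
  exists r, escape_radius P r.
Proof.
move=> Pm sP d1; set A := \sum_(i < d) N P`_i.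
have A0 : 0 <= A by apply: sumr_ge0 => i _; exact: mod_ge0.
exists (A + 2); split; first lra.
move=> z hz; have z1 : 1 <= N z by lra.
have := monic_lower_le Pm sP z1; rewrite -/A => h.
have h2 : N z ^+ d <= N P.[z] + A * N z ^+ d.-1.
  rewrite -modX -lerBlDl; apply: le_trans h.
  by rewrite [in leRHS]modC; exact: mod_tri.
clearbody A; case: d sP d1 {h} h2 => [|[|d]]//= _ _ h2.
have zd : 1 <= N z ^+ d by rewrite exprn_ege1.
rewrite exprS in h2.
have zd1 : N z <= N z ^+ d.+1 by rewrite exprS ler_peMr// mod_ge0.
by nra.
Qed.

(** The factor [A] can be carried along the induction because
    [A * A <= A ^+ d]. *)
Lemma poly_growth P d : P \is monic -> size P = d.+1 -> (1 < d)%N ->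
  exists2 A, 1 <= A & forall B z k, 1 <= B -> N z <= B ->
    N (poly_iter P k).[z] <= (A * B) ^+ (d ^ k).
Proof.
move=> Pm sP d1; pose A := 1 + \sum_(i < d) N P`_i.
have A1 : 1 <= A by rewrite lerDl; apply: sumr_ge0 => i _; exact: mod_ge0.
have A0 : 0 < A by lra.
exists A => // B z k B1 zB; have B0 : 0 <= B by lra.
have AB1 : 1 <= A * B by rewrite mulr_ege1.
have step w b : 1 <= b -> N w <= b -> N P.[w] <= A * b ^+ d.
  move=> b1 wb; rewrite horner_coef sP big_ord_recr /=.
  have -> : P`_d = 1 by have /monicP := Pm; rewrite /lead_coef sP.
  rewrite mul1r; apply: (le_trans (modD _ _)); rewrite modX mulrDl mul1r addrC.
  apply: lerD; first by rewrite lerXn2r ?nnegrE ?mod_ge0//; lra.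
  apply: (le_trans (mod_sum _ _ _)); rewrite mulr_suml; apply: ler_sum => i _.
  rewrite modM modX ler_wpM2l ?mod_ge0//.
  apply: (@le_trans _ _ (b ^+ i)); first by rewrite lerXn2r ?nnegrE ?mod_ge0//; lra.
  by rewrite ler_weXn2l// ltnW.
suff : A * N (poly_iter P k).[z] <= (A * B) ^+ (d ^ k).
  by apply: le_trans; rewrite ler_peMl ?mod_ge0.
elim: k => [|k IH].
  by rewrite poly_iter0 hornerX expn0 expr1 ler_wpM2l// ltW.
rewrite poly_iterS; set b := (A * B) ^+ (d ^ k) / A.
have b1 : 1 <= b.
  rewrite /b ler_pdivlMr// mul1r; apply: (@le_trans _ _ (A * B)).
    by rewrite ler_peMr// ltW.
  by rewrite ler_eXnr// expn_gt0 (ltnW d1).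
have wb : N (poly_iter P k).[z] <= b by rewrite /b ler_pdivlMr// mulrC.
apply: (@le_trans _ _ (A * (A * b ^+ d))); first by rewrite ler_wpM2l ?step// ltW.
rewrite /b expr_div_n -exprM -expnSr !mulrA.
rewrite [A * A * _]mulrC -mulrA ler_piMr ?exprn_ge0//; first by lra.
by rewrite ler_pdivrMr ?exprn_gt0// mul1r -expr2 ler_weXn2l.
Qed.

Lemma escape_iter P r z k : escape_radius P r -> r < N z ->
  2 ^+ k * N z <= N (poly_iter P k).[z].
Proof.
move=> [r1 hr] rz; elim: k => [|k IH].
  by rewrite expr0 mul1r poly_iter0 hornerX.
rewrite poly_iterS exprS -mulrA; apply: (@le_trans _ _ (2 * N (poly_iter P k).[z])).
  by rewrite ler_wpM2l.
apply: hr; apply: (lt_le_trans rz); apply: le_trans IH.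
by rewrite ler_peMl ?mod_ge0// exprn_ege1// ler1n.
Qed.

Lemma escape_ge P r z k : escape_radius P r -> r < N z ->
  N z <= N (poly_iter P k).[z].
Proof.
move=> er rz; apply: le_trans (escape_iter k er rz).
by rewrite ler_peMl ?mod_ge0// exprn_ege1// ler1n.
Qed.

Lemma bounded_seqE (f : nat -> C) :
  bounded_fun f <-> exists M : R, forall k, N (f k) <= M.
Proof.
split.
  move=> [M [Mr hM]]; have /complex_realP [m mE] := Mr.
  exists (m + 1) => k; have := hM (m + 1)%:C%C.
  rewrite mE ltcR ltrDl ltr01 => /(_ isT k I) /=.
  by rewrite modE lecR.
move=> [M hM]; exists M%:C%C; split; first by apply/complex_realP; exists M.
move=> x; rewrite ltcE /= => /andP[/eqP x0 xM] k _ /=.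
by rewrite modE lecE /= x0 eqxx (le_trans (hM k))// ltW.
Qed.

Lemma pow2_unbounded (M : R) : exists k, M < 2 ^+ k.
Proof.
have [k hk] : exists k : nat, M < k%:R.
  exists (Num.truncn `|M|).+1; apply: (le_lt_trans (ler_norm M)).
  by rewrite truncnS_gt.
exists k; apply: (lt_le_trans hk); rewrite -natrX ler_nat.
by apply: ltnW; exact: ltn_expl.
Qed.

Lemma basin_inftyP P r z : escape_radius P r ->
  basin_infty P z <-> exists k, r < N (poly_iter P k).[z].
Proof.
move=> er; have r1 := er.1; split.
  move=> nz; apply: contrapT => h; apply: nz; rewrite /filled_julia /=.
  apply/bounded_seqE; exists r => k; rewrite leNgt; apply/negP => hk.
  by apply: h; exists k.
move=> [j hj]; rewrite /basin_infty /filled_julia /=.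
move=> /bounded_seqE [M hM]; have [k hk] := pow2_unbounded M.
have := hM (k + j)%N; rewrite poly_iterD_horner.
move=> /(le_trans (escape_iter k er hj)) h.
have : 2 ^+ k <= M.
  by apply: le_trans h; rewrite ler_peMr ?exprn_ge0//; lra.
by rewrite leNgt hk.
Qed.

Lemma filled_juliaP P r z : escape_radius P r ->
  filled_julia P z <-> forall k, N (poly_iter P k).[z] <= r.
Proof.
move=> er; split.
  move=> Kz k; rewrite leNgt; apply/negP => hk.
  by have /(basin_inftyP _ er) : exists k, r < N (poly_iter P k).[z] by exists k.
move=> h; apply: contrapT => nz.
have /(basin_inftyP _ er) [k] : basin_infty P z by [].
by rewrite ltNge h.
Qed.

Lemma basin_local P r z (T : R) : escape_radius P r -> basin_infty P z ->
  exists2 e, 0 < e & exists k0, forall k w, (k0 <= k)%N -> N (w - z) < e ->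
    T < N (poly_iter P k).[w].
Proof.
move=> er /(basin_inftyP _ er) [j hj]; have r1 := er.1.
set q := poly_iter P j in hj *.
have [L L0 hL] := poly_lipschitz q (N z + 1).
pose e := Num.min 1 ((N q.[z] - r) / (L + 1)).
have L1 : 0 < L + 1 by rewrite ltr_wpDl.
have e0 : 0 < e by rewrite /e lt_min ltr01 divr_gt0// subr_gt0.
exists e => //; have [m hm] := pow2_unbounded `|T|.
exists (m + j)%N => k w km hw.
have wq : r < N q.[w].
  have hw1 : N w <= N z + 1.
    rewrite -{1}(subrK z w); apply: (le_trans (modD _ _)).
    by rewrite addrC lerD2l; apply: ltW; apply: (lt_le_trans hw); rewrite ge_min lexx.
  have zz : N z <= N z + 1 by rewrite lerDl.
  have h1 := hL z w zz hw1.
  have h2 : N (w - z) * (L + 1) < N q.[z] - r.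
    by rewrite -ltr_pdivlMr//; apply: (lt_le_trans hw); rewrite ge_min lexx orbT.
  have h3 := mod_tri q.[z] q.[w]; have h4 := mod_ge0 (w - z).
  by rewrite modC in h4; rewrite (modC w z) in h2; nra.
have -> : k = ((k - j) + j)%N.
  by rewrite subnK// (leq_trans _ km)// leq_addl.
rewrite poly_iterD_horner -/q.
apply: (lt_le_trans _ (escape_iter _ er wq)).
apply: (le_lt_trans (ler_norm T)); apply: (lt_le_trans hm).
have : 2 ^+ m <= 2 ^+ (k - j) :> R.
  by rewrite ler_eXn2l ?ltr1n// leq_subRL ?(leq_trans _ km)// ?leq_addl// addnC.
move/le_trans; apply; rewrite ler_peMr ?exprn_ge0//.
by apply: ltW; apply: le_lt_trans wq.
Qed.

(** Near each point escape is uniform by [basin_local]; compactness makes the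
    neighbourhoods and the time common. *)
Lemma basin_compact P r (K : set C) (T : R) : escape_radius P r ->
  compact K -> K `<=` basin_infty P ->
  exists2 e, 0 < e & exists k0, forall k z w, (k0 <= k)%N -> K z ->
    N (w - z) < e -> T < N (poly_iter P k).[w].
Proof.
move=> er /compact_near_coveringP cK KO.
pose Q (n : nat) (z : C) := forall k w, (n <= k)%N -> N (w - z) < n.+1%:R^-1 ->
    T < N (poly_iter P k).[w].
have := cK nat \oo Q _; case.
  move=> z Kz; have [e e0 [k0 h]] := basin_local T er (KO _ Kz).
  have e20 : 0 < e / 2 by lra.
  exists ([set w | N (w - z) < e / 2],
          [set n | (k0 <= n)%N /\ n.+1%:R^-1 < e / 2 :> R]).
    split => /=; first by apply/nbhs_mod; exists (e/2).
    have hn := near_infty_natSinv_lt (PosNum e20).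
    by near=> n; split; [near: n; exact: nbhs_infty_ge | near: n].
  move=> [w n] /= [hw [kn ne]] k v nk hv; apply: (h k).
    exact: leq_trans nk.
  rewrite -(subrK w v) -addrA; apply: (le_lt_trans (modD _ _)).
  by rewrite (splitr e) ltrD// (lt_trans hv ne).
move=> n0 _ hn; exists n0.+1%:R^-1; first by rewrite invr_gt0.
exists n0 => k z w nk Kz hw; apply: (hn n0 (leqnn n0) z Kz k w) => //.
Unshelve. all: end_near. Qed.

End Iteration.

(** * Jensen's formula and Rouche's theorem *)

Section Jensen.
Variable R : realType.
Local Notation C := (cplx R).
Local Notation N := (@Normc.normc R).
Implicit Types (s t : seq C) (z a u : C) (r : R).

Lemma unity_roots n : (0 < n)%N -> exists us : seq C,
  [/\ size us = n, forall u, u \in us -> N u = 1 &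
      forall a (r : C), \prod_(u <- us) (a - r * u) = a ^+ n - r ^+ n].
Proof.
move=> n0; have [us usE] := closed_field_poly_normal ('X^n - 1 : {poly C}).
have lc : lead_coef ('X^n - 1 : {poly C}) = 1 by rewrite lead_coefXnsubC.
rewrite lc scale1r in usE.
have sz : size us = n.
  have : size ('X^n - 1 : {poly C}) = n.+1 by rewrite size_XnsubC.
  by rewrite {1}usE size_prod_XsubC => -[].
have ev x : \prod_(u <- us) (x - u) = x ^+ n - 1.
  by rewrite -horner_rootpoly /rootpoly -usE !hornerE.
exists us; split=> // [u uu|a r].
  have : u ^+ n - 1 = 0.
    by rewrite -ev (big_rem u uu) /= subrr mul0r.
  move/eqP; rewrite subr_eq0 => /eqP un; apply/eqP.
  by rewrite -(@pexpr_eq1 _ _ n)// ?mod_ge0// -modX un mod1.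
have [->|r0] := eqVneq r 0.
  under eq_bigr do rewrite mul0r subr0.
  by rewrite big_const_seq count_predT sz iter_mulr_1 expr0n eqn0Ngt n0 subr0.
transitivity (\prod_(u <- us) (r * (a / r - u))).
  by apply: eq_bigr => u _; rewrite mulrBr mulrCA divff// mulr1.
rewrite big_split /= ev big_const_seq count_predT sz iter_mulr_1.
by rewrite mulrBr mulr1 -exprMn mulrCA divff// mulr1.
Qed.

(** By Jensen's formula this is the geometric mean of the modulus of
    [rootpoly s] on the circle of centre [z] and radius [r]. *)
Definition mahler s z r : R := \prod_(a <- s) Num.max r (N (a - z)).

Lemma mahler_gt0 s z r : 0 < r -> 0 < mahler s z r.
Proof.
by move=> r0; apply: prodr_gt0 => a _; rewrite lt_max r0.
Qed.

Lemma mahler_ge0 s z r : 0 < r -> 0 <= mahler s z r.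
Proof. by move=> r0; rewrite ltW// mahler_gt0. Qed.

Lemma expr_le_half (x : R) : 0 <= x -> x < 1 ->
  exists n0, forall n, (n0 <= n)%N -> x ^+ n <= 1 / 2.
Proof.
move=> x0 x1; have h : (fun n => x ^+ n) @ \oo --> (0 : R).
  by apply: cvg_expr; rewrite ger0_norm.
have := cvgr_le 0 h (1/2); rewrite divr_gt0// => /(_ _ isT) [n0 _ hn].
by exists n0 => n nn; exact: hn.
Qed.

(** Jensen's formula with the [n]-th roots of unity in place of an integral:
    the product of the moduli of the polynomial at these [n] points of the
    circle is explicit, and it is [mahler s z r ^+ n] up to a factor that does
    not depend on [n]. Each root off the circle dominates, or is dominated by,
    the radius as soon as [n] is large. *)
Lemma circle_prod_bounds s z r : 0 < r ->
  (forall a, a \in s -> N (a - z) != r) ->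
  exists n0, forall n, (n0 <= n)%N ->
   (1 / 2) ^+ size s * mahler s z r ^+ n
     <= \prod_(a <- s) N ((a - z) ^+ n - r%:C%C ^+ n) /\
   \prod_(a <- s) N ((a - z) ^+ n - r%:C%C ^+ n)
     <= 2 ^+ size s * mahler s z r ^+ n.
Proof.
move=> r0; elim: s => [|a s IH] hs.
  exists 0%N => n _; rewrite /mahler !big_nil !expr0 expr1n; lra.
have [n1 hn1] := IH (fun b bs => hs b (mem_behead (s:=a :: s) bs)).
have har := hs a (mem_head _ _).
suff [n2 hn2] : exists n0, forall n, (n0 <= n)%N ->
  (1 / 2) * Num.max r (N (a - z)) ^+ n <= N ((a - z) ^+ n - r%:C%C ^+ n) /\
  N ((a - z) ^+ n - r%:C%C ^+ n) <= 2 * Num.max r (N (a - z)) ^+ n.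
  exists (maxn n1 n2) => n; rewrite geq_max => /andP[nn1 nn2].
  have [h1 h2] := hn1 _ nn1; have [h3 h4] := hn2 _ nn2.
  rewrite /mahler !big_cons -/(mahler s z r) [(_ * mahler _ _ _) ^+ n]exprMn /=.
  rewrite !(exprS _ (size s)).
  have M0 : 0 <= mahler s z r ^+ n by rewrite exprn_ge0// mahler_ge0.
  have m0 : 0 <= Num.max r (N (a - z)) ^+ n.
    by rewrite exprn_ge0// le_max (ltW r0).
  have P0 : 0 <= \prod_(b <- s) N ((b - z) ^+ n - r%:C%C ^+ n).
    by apply: prodr_ge0 => b _; exact: mod_ge0.
  have e0 : 0 <= (1 / 2) ^+ size s :> R by rewrite exprn_ge0// divr_ge0.
  split; rewrite mulrACA; apply: ler_pM => //;
    by rewrite ?mulr_ge0 ?mod_ge0 ?invr_ge0 ?ler0n.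
set b := a - z; have b0 := mod_ge0 b.
have r1 : N (r%:C%C : C) = r by rewrite mod_real gtr0_norm.
have [rb|br] := ltP r (N b).
  have B0 : 0 < N b by exact: lt_trans rb.
  have [||n0 hn0] := @expr_le_half (r / N b); first by rewrite divr_ge0 // ltW.
    by rewrite ltr_pdivrMr// mul1r.
  exists n0 => n /hn0; rewrite expr_div_n ler_pdivrMr ?exprn_gt0// => h.
  split.
    apply: le_trans (mod_tri _ _); rewrite !modX r1; lra.
  apply: le_trans (modB _ _) _; rewrite !modX r1.
  have := exprn_ge0 n b0; lra.
have bltr : N b < r by rewrite lt_def br andbT eq_sym har.
have [||n0 hn0] := @expr_le_half (N b / r); first by rewrite divr_ge0 // ltW.
  by rewrite ltr_pdivrMr// mul1r.
exists n0 => n /hn0; rewrite expr_div_n ler_pdivrMr ?exprn_gt0// => h.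
split.
  rewrite modC; apply: le_trans (mod_tri _ _); rewrite !modX r1; lra.
apply: le_trans (modB _ _) _; rewrite !modX r1.
have := exprn_ge0 n (ltW r0); lra.
Qed.

(** Constants disappear in [n]-th roots. *)
Lemma geometric_le (x y K : R) n0 : 0 <= x -> 0 <= y -> 0 < K ->
  (forall n, (n0 <= n)%N -> x ^+ n <= K * y ^+ n) -> x <= y.
Proof.
move=> x0 y0 K0 h; rewrite leNgt; apply/negP => yx.
have x1 : 0 < x by exact: le_lt_trans yx.
have c : (fun n => (y / x) ^+ n) @ \oo --> (0 : R).
  by apply: cvg_expr; rewrite ger0_norm ?divr_ge0// ltr_pdivrMr ?mul1r.
have := cvgr_lt 0 c K^-1; rewrite invr_gt0 K0 => /(_ _ isT) [n1 _ hn].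
have hb := hn (maxn n0 n1) (leq_maxr _ _); have ha := h _ (leq_maxl n0 n1).
rewrite /= expr_div_n ltr_pdivrMr ?exprn_gt0// ltr_pdivlMl// in hb.
by have := le_lt_trans ha hb; rewrite ltxx.
Qed.

Lemma circle_prodE s z r us n : size us = n ->
  (forall a (r : C), \prod_(u <- us) (a - r * u) = a ^+ n - r ^+ n) ->
  \prod_(u <- us) N (rootpoly s).[z + r%:C%C * u] =
  \prod_(a <- s) N ((a - z) ^+ n - r%:C%C ^+ n).
Proof.
move=> sz ev; under eq_bigr do rewrite horner_rootpoly mod_prod.
rewrite exchange_big /=; apply: eq_bigr => a _; rewrite -ev mod_prod.
by apply: eq_bigr => u _; rewrite modC; congr N; ring.
Qed.

(** A pointwise inequality on the circle passes to the products over the roots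
    of unity, hence to the geometric means. *)
Lemma mahler_le_cmp s t (k l : C) z r (B : R) : 0 < r -> 0 <= B ->
  (forall a, a \in s -> N (a - z) != r) ->
  (forall a, a \in t -> N (a - z) != r) ->
  (forall u, N u = 1 -> N (k *: rootpoly s).[z + r%:C%C * u]
      <= B * N (l *: rootpoly t).[z + r%:C%C * u]) ->
  N k * mahler s z r <= B * (N l * mahler t z r).
Proof.
move=> r0 B0 hs ht h.
have [n1 hn1] := circle_prod_bounds r0 hs.
have [n2 hn2] := circle_prod_bounds r0 ht.
pose K : R := 2 ^+ size s * 2 ^+ size t.
have K0 : 0 < K by rewrite mulr_gt0// exprn_gt0.
apply: (@geometric_le _ _ K (maxn 1 (maxn n1 n2))) => //.
- by rewrite mulr_ge0 ?mod_ge0 ?mahler_ge0.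
- by rewrite !mulr_ge0 ?mod_ge0 ?mahler_ge0.
move=> n; rewrite !geq_max => /and3P[n0 nn1 nn2].
have [us [sz hu ev]] := unity_roots n0.
have [h1 _] := hn1 n nn1; have [_ h2] := hn2 n nn2.
rewrite -(circle_prodE s z r sz ev) in h1.
rewrite -(circle_prodE t z r sz ev) in h2.
have h3 : N k ^+ n * \prod_(u <- us) N (rootpoly s).[z + r%:C%C * u] <=
   (B * N l) ^+ n * \prod_(u <- us) N (rootpoly t).[z + r%:C%C * u].
  have cst (x : R) : x ^+ n = \prod_(u <- us) x.
    by rewrite big_const_seq count_predT sz iter_mulr_1.
  rewrite !cst -!big_split /= [leLHS]big_seq [leRHS]big_seq.
  apply: ler_prod => u /hu u1; rewrite mulr_ge0 ?mod_ge0//= -modM -mulrA -modM.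
  by have := h u u1; rewrite !hornerZ.
have E : N k ^+ n * ((1 / 2) ^+ size s * mahler s z r ^+ n) <=
  (B * N l) ^+ n * (2 ^+ size t * mahler t z r ^+ n).
  apply: (le_trans (ler_wpM2l (exprn_ge0 n (mod_ge0 k)) h1)).
  apply: (le_trans h3); apply: ler_wpM2l h2.
  by rewrite exprn_ge0// mulr_ge0// mod_ge0.
have h2s : (1 / 2) ^+ size s = (2 ^+ size s)^-1 :> R.
  by rewrite div1r exprVn.
rewrite h2s !exprMn in E; rewrite !exprMn; have p0 : 0 < 2 ^+ size s :> R by rewrite exprn_gt0.
have := ler_wpM2l (ltW p0) E; rewrite [leLHS]mulrCA mulVKf ?gt_eqF// => E2.
by apply: (le_trans E2); rewrite /K le_eqVlt; apply/orP; left; apply/eqP; ring.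
Qed.

Lemma mahler_le_sup s z r (B : R) : 0 < r -> 0 <= B ->
  (forall a, a \in s -> N (a - z) != r) ->
  (forall w, N (w - z) = r -> N (rootpoly s).[w] <= B) ->
  mahler s z r <= B.
Proof.
move=> r0 B0 hs h.
have := @mahler_le_cmp s [::] 1 1 z r B r0 B0 hs (fun a => _).
rewrite mod1 !mul1r /(mahler [::]) big_nil mulr1; apply=> // u u1.
rewrite !scale1r {2}/rootpoly big_nil hornerC mod1 mulr1; apply: h.
by rewrite addrAC subrr add0r modM u1 mulr1 mod_real gtr0_norm.
Qed.

(** A root inside contributes the radius, a root beyond the annulus a factor in
    which the radius does not occur. *)
Lemma mahler_double s z r : 0 < r ->
  (forall a, a \in s -> ~ (r <= N (a - z) <= 2 * r)) ->
  mahler s z (2 * r) =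
  2 ^+ count_in [set w | N (w - z) < r] s * mahler s z r.
Proof.
move=> r0; elim: s => [|a s IH] hs.
  by rewrite /mahler !big_nil mulr1 expr0.
rewrite /mahler !big_cons -/(mahler s z _) -/(mahler s z r) IH; last first.
  by move=> b bs; apply: hs; rewrite inE bs orbT.
rewrite /count_in /= exprD -/(count_in _ s).
have := hs a (mem_head _ _).
have [/set_mem /= h|h] := boolP (a \in [set w | N (w - z) < r]).
  move=> _; rewrite expr1 !max_l//; [by ring|exact: ltW|].
  by apply: ltW; apply: (lt_trans h); lra.
have {}h : r <= N (a - z) by rewrite leNgt; apply: contraNN h => ?; exact: mem_set.
move=> /negP; rewrite h /= -ltNge => h2.
by rewrite expr0 !max_r ?(ltW h2)//; ring.
Qed.

(** Rouche's theorem on an annulus: Jensen's formula on the two boundary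
    circles compares the growth of the two geometric means, and their growth
    factors are powers of 2 whose exponents are the numbers of roots inside. *)
Lemma rouche_annulus s t (k l : C) z r : 0 < r -> k != 0 -> l != 0 ->
  (forall w, r <= N (w - z) <= 2 * r -> (rootpoly t).[w] != 0 /\
     N ((k *: rootpoly s).[w] - (l *: rootpoly t).[w])
       <= N (l *: rootpoly t).[w] / 4) ->
  count_in [set w | N (w - z) < r] s = count_in [set w | N (w - z) < r] t.
Proof.
move=> r0 k0 l0 h.
have ht a : a \in t -> ~ (r <= N (a - z) <= 2 * r).
  move=> at_ /h [/negP + _]; apply; rewrite horner_rootpoly.
  by rewrite (big_rem a at_) /= subrr mul0r.
have hs a : a \in s -> ~ (r <= N (a - z) <= 2 * r).
  move=> as_ /h [t0 +]; rewrite !hornerZ (horner_rootpoly s) (big_rem a as_) /=.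
  rewrite subrr mul0r mulr0 sub0r modN modM.
  have : 0 < N l * N (rootpoly t).[a] by rewrite mulr_gt0 ?mod_gt0.
  move=> *; lra.
have r20 : 0 < 2 * r by lra.
have bnd w : r <= N (w - z) <= 2 * r ->
   N (k *: rootpoly s).[w] <= 5 / 4 * N (l *: rootpoly t).[w] /\
   N (l *: rootpoly t).[w] <= 4 / 3 * N (k *: rootpoly s).[w].
  move=> /h [_ h1].
  have h2 := mod_tri (k *: rootpoly s).[w] (l *: rootpoly t).[w].
  have := mod_tri (l *: rootpoly t).[w] (k *: rootpoly s).[w].
  rewrite modC; split; lra.
have circ rho u : 0 < rho -> N u = 1 -> N (z + rho%:C%C * u - z) = rho.
  move=> rho0 u1; rewrite addrAC subrr add0r modM u1 mulr1 mod_real.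
  by rewrite gtr0_norm.
have ne (v : seq C) rho : r <= rho <= 2 * r ->
    (forall a, a \in v -> ~ (r <= N (a - z) <= 2 * r)) ->
    forall a, a \in v -> N (a - z) != rho.
  by move=> hr hv a /hv; apply: contra_notN => /eqP ->.
have cmp rho : r <= rho <= 2 * r ->
   N k * mahler s z rho <= 5 / 4 * (N l * mahler t z rho) /\
   N l * mahler t z rho <= 4 / 3 * (N k * mahler s z rho).
  move=> hr; have rho0 : 0 < rho by case/andP: hr => ? _; lra.
  split; apply: mahler_le_cmp => //; try exact: ne; try lra.
    by move=> u u1; apply: (bnd _ _).1; rewrite circ.
  by move=> u u1; apply: (bnd _ _).2; rewrite circ.
have [|c1 c2] := cmp r; first by rewrite lexx/=; lra.
have [|c3 c4] := cmp (2 * r); first by rewrite lexx andbT; lra.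
rewrite !mahler_double// in c3 c4.
set m := count_in _ s in c3 c4 *; set n := count_in _ t in c3 c4 *.
set A := N k * mahler s z r in c1 c2; set B := N l * mahler t z r in c1 c2.
rewrite mulrCA -/A [X in 5 / 4 * X]mulrCA -/B in c3.
rewrite mulrCA -/B [X in 4 / 3 * X]mulrCA -/A in c4.
have A0 : 0 < A by rewrite mulr_gt0 ?mod_gt0 ?mahler_gt0.
have B0 : 0 < B by rewrite mulr_gt0 ?mod_gt0 ?mahler_gt0.
have pw j : 0 < 2 ^+ j :> R by rewrite exprn_gt0.
(* two powers of 2 within the ratio 5/4 * 4/3 = 5/3 < 2 are equal *)
have key i j : 2 ^+ i <= 5 / 3 * 2 ^+ j :> R -> (i <= j)%N.
  move=> hij; rewrite leqNgt; apply/negP => ji.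
  have : 2 ^+ j.+1 <= 2 ^+ i :> R by rewrite ler_eXn2l ?ltr1n.
  by rewrite exprS => ?; have := pw j; lra.
apply/eqP; rewrite eqn_leq; apply/andP; split; apply: key.
  have h5 := ler_wpM2l (ltW (pw n)) c2.
  by rewrite -(ler_pM2r A0); move: (2 ^+ m) (2 ^+ n) c3 h5 => x y c3 h5; lra.
have h5 := ler_wpM2l (ltW (pw m)) c1.
by rewrite -(ler_pM2r B0); move: (2 ^+ m) (2 ^+ n) c4 h5 => x y c4 h5; lra.
Qed.

End Jensen.

(** * Fibres over a point outside the escape disc *)

Section DerivativeRoots.
Variable R : realType.
Local Notation C := (cplx R).
Local Notation N := (@Normc.normc R).
Implicit Types (P p q : {poly C}) (z w a b : C) (s t : seq C).

(** At most [m ^ 2 * D ^ (m - 1)] of the [D ^ m] tuples have a repetition; the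
    factor [D] avoids the predecessor. *)
Lemma ffact_lower (D m : nat) :
  (D ^ m.+1 <= D * D ^_ m + m ^ 2 * D ^ m)%N.
Proof.
elim: m => [|m IH]; first by rewrite ffactn0 expn1 muln1 leq_addr.
have h1 : (D ^_ m <= D ^ m)%N.
  elim: m {IH} => // m IH; by rewrite ffactnSr expnSr leq_mul// leq_subr.
have h2 : (D * D ^_ m <= D ^_ m.+1 + m * D ^_ m)%N.
  by rewrite ffactnSr (mulnC (D ^_ m)) -mulnDl leq_mul2r addnC -leq_subLR leqnn orbT.
rewrite (expnS D m.+1); apply: (leq_trans (leq_mul (leqnn D) IH)).
rewrite mulnDr; apply: (@leq_trans (D * (D ^_ m.+1 + m * D ^ m) + D * (m ^ 2 * D ^ m))).
  rewrite leq_add2r leq_mul2l; apply/orP; right; apply: (leq_trans h2).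
  by rewrite leq_add2l leq_mul2l h1 orbT.
rewrite mulnDr -addnA leq_add2l mulnCA [X in (_ + X <= _)%N]mulnCA -!expnS.
rewrite -mulnDl leq_mul2r; apply/orP; right.
by rewrite -!mulnn -mulSn leq_mul2l leqnSn orbT.
Qed.

(** The bound [r' <= r] in the hypothesis is what lets finitely many radii be
    replaced with their minimum. *)
Lemma uniform_radius (T : eqType) (t : seq T) (Q : T -> R -> Prop) :
  (forall b : T, b \in t ->
     exists2 r, 0 < r & forall r', 0 < r' -> r' <= r -> Q b r') ->
  exists2 r, 0 < r & forall b : T, b \in t -> Q b r.
Proof.
move=> h; suff [r r0 hr] : exists2 r, 0 < r & forall b : T, b \in t ->
    forall r', 0 < r' -> r' <= r -> Q b r'.
  by exists r => // b bt; exact: hr.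
elim: t h => [_|b t IH h]; first by exists 1.
have [r1 r10 h1] := IH (fun (b' : T) b't => h b' (mem_behead (s := b :: t) b't)).
have [r2 r20 h2] := h b (mem_head _ _).
exists (Num.min r1 r2); first by rewrite lt_min r10.
move=> b'; rewrite inE => /orP[/eqP ->|b't] r' r'0;
  rewrite le_min => /andP[? ?]; [exact: h2|exact: h1].
Qed.

(** The map [u |-> 1 / (1 - u)] sends the unit disc to the half plane of real
    parts at least 1/2. So the terms of a logarithmic derivative cannot cancel
    outside a disc that contains the roots. *)
Lemma Re_inv_ge w a : N a <= N w -> w != a -> 1 / 2 <= complex.Re (w / (w - a)).
Proof.
move=> aw wa; have : N a ^+ 2 <= N w ^+ 2 by rewrite ler_pXn2r ?nnegrE ?mod_ge0.
have : 0 < N (w - a) ^+ 2 by rewrite exprn_gt0// mod_gt0 subr_eq0.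
rewrite !modsq; case: w a {aw wa} => [x y] [u v] /= h1 h2.
set D := (x - u) ^+ 2 + (y - v) ^+ 2 in h1 *.
have -> : x * ((x - u) / D) - y * - ((y - v) / D) =
  (x * (x - u) + y * (y - v)) / D by rewrite mulrN opprK [in RHS]mulrDl !mulrA.
by rewrite ler_pdivlMr// /D; nra.
Qed.

Lemma Re_sum (I : Type) (s : seq I) (f : I -> C) :
  complex.Re (\sum_(i <- s) f i) = \sum_(i <- s) complex.Re (f i).
Proof. by apply: (big_morph (@complex.Re R)) => // -[? ?] [? ?]. Qed.

Lemma logder_Re_ge s w c : (forall a, a \in s -> N a <= c) -> c < N w ->
  (size s)%:R / 2 <= complex.Re (w * logder s w).
Proof.
move=> hs cw; rewrite /logder mulr_sumr Re_sum.
apply: (@le_trans _ _ (\sum_(a <- s) 1 / 2)).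
  rewrite big_const_seq count_predT iter_addr addr0 -[X in _ <= X]mulr_natl.
  by rewrite div1r.
rewrite [leLHS]big_seq [leRHS]big_seq; apply: ler_sum => a /hs ac.
apply: Re_inv_ge; first by apply: (le_trans ac); exact: ltW.
by apply/eqP => wa; move: ac; rewrite -wa leNgt cw.
Qed.

Lemma logder_mod_ge s w c : (forall a, a \in s -> N a <= c) -> c < N w ->
  (size s)%:R / 2 <= N w * N (logder s w).
Proof.
move=> hs cw; rewrite -modM; apply: (le_trans (logder_Re_ge hs cw)).
by apply: (le_trans (ler_norm _)); exact: Re_le_mod.
Qed.

(** An orbit that leaves the disc of radius [c] never comes back to it, so it
    cannot reach [c] later: this bounds the points of the fibre. *)
Lemma fibre_exists P d r (c : R) k : P \is monic -> size P = d.+1 ->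
  (1 < d)%N -> escape_radius P r -> r < c ->
  exists s, [/\ poly_iter P k - (c%:C%C)%:P = rootpoly s,
    size s = (d ^ k)%N & forall a, a \in s ->
      (poly_iter P k).[a] = c%:C%C /\ N a <= c].
Proof.
move=> Pm sP d1 er rc; have r1 := er.1; have d0 : (0 < d)%N by exact: ltnW.
have [qm qs] := size_poly_iter k Pm sP d0.
have dk : (0 < d ^ k)%N by rewrite expn_gt0 d0.
have sF : size (poly_iter P k - (c%:C%C)%:P) = (d ^ k).+1.
  rewrite size_polyDl ?qs// size_polyN; apply: leq_ltn_trans (size_polyC_leq1 _) _.
  by rewrite ltnS.
have Fm : poly_iter P k - (c%:C%C)%:P \is monic.
  apply/monicP; rewrite lead_coefDl ?(monicP qm)// size_polyN qs.
  by apply: leq_ltn_trans (size_polyC_leq1 _) _; rewrite ltnS.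
have [s sE] := closed_field_poly_normal (poly_iter P k - (c%:C%C)%:P).
rewrite (monicP Fm) scale1r in sE.
exists s; split=> //.
  by move: sF; rewrite sE size_prod_XsubC => -[].
move=> a as_; have : root (poly_iter P k - (c%:C%C)%:P) a.
  by rewrite sE root_prod_XsubC.
rewrite /root !hornerE subr_eq0 => /eqP qa; split=> //.
rewrite leNgt; apply/negP => ca.
have := @escape_ge R P r a k er (lt_trans rc ca).
by rewrite qa mod_real gtr0_norm ?leNgt ?ca//; lra.
Qed.

Lemma derivn_neq0 q m : (m < size q)%N -> q^`(m) != 0.
Proof.
move=> sq; have q0 : q != 0 by rewrite -size_poly_gt0 (leq_ltn_trans _ sq).
apply/eqP => /(congr1 (fun p : {poly C} => p`_((size q).-1 - m))).
rewrite coef0 coef_derivn; have mle : (m <= (size q).-1)%N.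
  by rewrite -ltnS prednK// (leq_ltn_trans _ sq).
rewrite subnKC// => /eqP; rewrite mulrn_eq0 -/(lead_coef q) lead_coef_eq0.
by rewrite (negbTE q0) orbF -leqn0 leqNgt ffact_gt0 mle.
Qed.

Lemma deriv_neq0 q : (1 < size q)%N -> q^`() != 0.
Proof. by move=> sq; rewrite -derivn1 derivn_neq0. Qed.

Lemma compact_mod_bounded (A : set C) : compact A ->
  exists B, forall z, A z -> N z <= B.
Proof.
move=> /compact_near_coveringP cA.
have := cA nat \oo (fun n z => N z < n%:R) _; case.
  move=> z _; have [n hn] : exists n : nat, N z + 1 < n%:R.
    exists (Num.truncn `|N z + 1|).+1; apply: (le_lt_trans (ler_norm _)).
    by rewrite truncnS_gt.
  exists ([set w | N (w - z) < 1], [set m | (n <= m)%N]).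
    split => /=; first by apply/nbhs_mod; exists 1.
    by near=> m; near: m; exact: nbhs_infty_ge.
  move=> [w m] /= [wz nm]; rewrite -(subrK z w).
  apply: (le_lt_trans (modD _ _)); apply: (@lt_le_trans _ _ n%:R).
    by rewrite addrC (lt_trans _ hn)// ltrD2l.
  by rewrite ler_nat.
move=> n _ hn; exists n%:R => z Az; exact: ltW (hn n (leqnn n) z Az).
Unshelve. all: end_near. Qed.

Lemma nat_unbounded (d : nat) (M : R) : (1 < d)%N ->
  exists k0, forall k, (k0 <= k)%N -> M <= (d ^ k)%:R.
Proof.
move=> d1; have [k0 hk0] := pow2_unbounded M.
exists k0 => k kk; apply: (le_trans (ltW hk0)).
rewrite -natrX ler_nat; apply: (@leq_trans (2 ^ k)).
  by rewrite leq_pexp2l.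
by case: k kk => [|k] _; rewrite ?expn0 ?leq_exp2r.
Qed.

End DerivativeRoots.

(** * Roots of the derivatives of iterates *)

Section DerivativeCount.
Variable R : realType.
Local Notation C := (cplx R).
Local Notation N := (@Normc.normc R).
Implicit Types (P p q : {poly C}) (z w a b : C) (s t : seq C) (A : set C).

Lemma deriv_poly_iterD P j k :
  (poly_iter P (j + k))^`() = ((poly_iter P j)^`() \Po poly_iter P k) *
    (poly_iter P k)^`().
Proof. by rewrite poly_iterD deriv_comp. Qed.

Lemma derivn_subC p (c : C) m : (p - c%:P)^`(m.+1) = p^`(m.+1).
Proof. by rewrite derivnB derivnC /= subr0. Qed.

Lemma logder_chain P j k (c : C) s s' z :
  poly_iter P (j + k) - c%:P = rootpoly s -> poly_iter P j - c%:P = rootpoly s' ->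
  z \notin s -> (poly_iter P k).[z] \notin s' ->
  logder s z = (poly_iter P k)^`().[z] * logder s' (poly_iter P k).[z].
Proof.
move=> sE s'E zs zs'; rewrite !logderE// -sE -s'E -!derivn1 !derivn_subC !derivn1.
rewrite deriv_poly_iterD hornerM horner_comp.
rewrite ![(_ - _%:P).[_]]hornerD !hornerN !hornerC poly_iterD_horner.
by rewrite mulrAC mulrC.
Qed.

Lemma ffact_lower_real (D m : nat) :
  D%:R * ((D ^ m)%:R - (D ^_ m)%:R) <= (m ^ 2)%:R * D%:R ^+ m :> R.
Proof.
have := ffact_lower D m; rewrite -(ler_nat R) natrD !natrM !natrX exprS.
by move=> h; rewrite mulrBr; lra.
Qed.

(** The tuples with a repetition are negligible among all tuples of roots. So,
    where the logarithmic derivative of [q] has the order of its number of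
    terms, the product of [q^(m+1)] and the [m]-th power of [q] is a small
    perturbation of the power [m+1] of the derivative of [q]. *)
Lemma derivn_dominated s z (y kappa : R) m :
  z \notin s -> (forall a, a \in s -> N (z - a)^-1 <= y) -> 0 <= y ->
  0 < kappa -> kappa * (size s)%:R <= N (logder s z) ->
  4 * (m.+1 ^ 2)%:R * y ^+ m.+1 <= kappa ^+ m.+1 * (size s)%:R ->
  (0 < size s)%N ->
  N ((rootpoly s)^`(m.+1).[z] * (rootpoly s).[z] ^+ m
      - (rootpoly s)^`().[z] ^+ m.+1)
    <= N ((rootpoly s)^`().[z] ^+ m.+1) / 4.
Proof.
move=> zs hy y0 k0 hL hm s0; set F := (rootpoly s).[z].
have F0 : F != 0 by exact: rootpoly_neq0.
set u := (rootpoly s)^`(m.+1).[z]; set M := m.+1.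
have dE : (rootpoly s)^`().[z] = logder s z * F by rewrite logderE// divfK.
have -> : u * F ^+ m - (rootpoly s)^`().[z] ^+ M =
   - ((logder s z ^+ M - u / F) * F ^+ M).
  rewrite dE exprMn mulrBl opprB; congr (_ - _).
  by rewrite /M exprS mulrA divfK.
rewrite modN modM dE exprMn modM mulrAC ler_wpM2r ?mod_ge0//.
apply: (le_trans (derivn_logder_le M zs hy y0)).
set D := (size s)%:R : R; have D0 : 0 < D by rewrite ltr0n.
rewrite -(ler_pM2l D0).
have h1 : D * ((size s ^ M)%:R - (size s ^_ M)%:R) <= (M ^ 2)%:R * D ^+ M.
  exact: ffact_lower_real.
have h2 : kappa ^+ M * D ^+ M <= N (logder s z ^+ M).
  by rewrite modX -exprMn lerXn2r ?nnegrE ?mod_ge0// mulr_ge0// ltW.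
have yM : 0 <= y ^+ M by exact: exprn_ge0.
have DM : 0 <= D ^+ M by rewrite exprn_ge0// ltW.
have h3 := ler_wpM2r yM h1; have h4 := ler_wpM2r DM hm.
have h5 := ler_wpM2l (ltW D0) h2.
rewrite mulrA; move: h3 h4 h5; rewrite -/D -/M.
move: (_ - _) (D ^+ M) (y ^+ M) (kappa ^+ M) (_ ^ 2)%:R (N _) => X E Y K S T.
move=> h3 h4 h5; lra.
Qed.

(** The radius [r + 1] is the modulus of the point whose fibres are used: the
    neighbourhood contains no point of a fibre of index at least [n]. *)
Definition escapes_from P (r : R) A (n : nat) (e : R) : Prop :=
  0 < e /\ forall k z w, (n <= k)%N -> A z -> N (w - z) < e ->
    r + 1 < N (poly_iter P k).[w].

Lemma good_radius A t : closed A -> (forall b, b \in t -> A b -> nbhs b A) ->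
  exists2 r, 0 < r & forall b, b \in t ->
  [/\ A b -> forall w, N (w - b) <= 2 * r -> A w,
      ~ A b -> forall w, A w -> r <= N (w - b) &
      forall b', b' \in t -> b' != b -> 3 * r <= N (b' - b)].
Proof.
move=> cA hA.
pose Q b r := [/\ A b -> forall w, N (w - b) <= 2 * r -> A w,
      ~ A b -> forall w, A w -> r <= N (w - b) &
      forall b', b' \in t -> b' != b -> 3 * r <= N (b' - b)].
apply: (@uniform_radius _ _ t Q) => b bt.
have [r1 r10 h1] : exists2 r, 0 < r & forall b', b' \in t -> b' != b ->
    3 * r <= N (b' - b).
  apply: uniform_radius => b' b't.
  have [->|nb] := eqVneq b' b; first by exists 1.
  exists (N (b' - b) / 3); first by rewrite divr_gt0// mod_gt0 subr_eq0.
  by move=> r' _ hr' _; lra.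
have [Ab|nAb] := pselect (A b).
  have /nbhs_mod [e e0 he] := hA b bt Ab.
  exists (Num.min r1 (e / 3)); first by rewrite lt_min r10 divr_gt0.
  move=> r' r'0; rewrite le_min => /andP[rr1 re]; split=> //.
    by move=> _ w hw; apply: he; lra.
  by move=> b' b't nb; have := h1 b' b't nb; lra.
have /nbhs_mod [e e0 he] : nbhs b (~` A).
  by apply: open_nbhs_nbhs; split=> //; exact: closed_openC.
exists (Num.min r1 e); first by rewrite lt_min r10.
move=> r' r'0; rewrite le_min => /andP[rr1 re]; split=> //.
  move=> _ w Aw; rewrite leNgt; apply/negP => hw.
  by apply: (he w _ Aw); exact: lt_le_trans re.
by move=> b' b't nb; have := h1 b' b't nb; lra.
Qed.

Lemma rootpoly_ge t z (rho : R) : 0 <= rho ->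
  (forall b, b \in t -> rho <= N (z - b)) ->
  rho ^+ size t <= N (rootpoly t).[z].
Proof.
move=> rho0; elim: t => [|b t IH] h.
  by rewrite /rootpoly big_nil hornerC mod1 expr0.
rewrite rootpoly_cons hornerM hornerXsubC modM /= exprS.
apply: ler_pM => //; first by rewrite exprn_ge0.
  by rewrite h// mem_head.
by apply: IH => b' b't; rewrite h// inE b't orbT.
Qed.

Section Count.
Variables (P : {poly C}) (d : nat) (r : R) (A : set C) (n : nat) (e : R).
Hypotheses (Pm : P \is monic) (sP : size P = d.+1) (d1 : (1 < d)%N).
Hypotheses (er : escape_radius P r) (cA : compact A).
Hypothesis hA : escapes_from P r A n e.
Variables (t : seq C) (l : C).
Hypotheses (l0 : l != 0) (tE : (poly_iter P n)^`() = l *: rootpoly t).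

Let c : R := r + 1.
Let rc : r < c. Proof. by rewrite ltrDl. Qed.
Let c0 : 0 < c. Proof. by have := er.1; rewrite /c; lra. Qed.

Let fibre_far k s z a : (n <= k)%N -> A z ->
  (forall a, a \in s -> (poly_iter P k).[a] = c%:C%C /\ N a <= c) ->
  a \in s -> e <= N (z - a).
Proof.
move=> nk Az hs as_; rewrite leNgt; apply/negP => hz.
have := hA.2 k z a nk Az; rewrite modC => /(_ hz).
by rewrite (hs a as_).1 mod_real gtr0_norm// ltxx.
Qed.

Let fibre_logder k s z (rho W : R) : (n <= k)%N -> A z ->
  poly_iter P k - (c%:C%C)%:P = rootpoly s -> size s = (d ^ k)%N ->
  (forall a, a \in s -> (poly_iter P k).[a] = c%:C%C /\ N a <= c) ->
  0 < rho -> (forall b, b \in t -> rho <= N (z - b)) ->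
  N (poly_iter P n).[z] <= W -> 0 < W ->
  N l * rho ^+ size t / (2 * W * (d ^ n)%:R) * (size s)%:R
    <= N (logder s z).
Proof.
move=> nk Az sE sz hs rho0 hrho hW W0.
have [s' [s'E s'z hs']] := fibre_exists (k - n) Pm sP d1 er rc.
have wc : c < N (poly_iter P n).[z].
  by apply: hA.2 Az _ => //; rewrite subrr mod0 hA.1.
have zs : z \notin s.
  apply/negP => zs; have := fibre_far nk Az hs zs.
  by rewrite subrr mod0 leNgt hA.1.
have ws' : (poly_iter P n).[z] \notin s'.
  by apply/negP => /hs' [_]; rewrite leNgt wc.
rewrite -(subnK nk) in sE; rewrite (logder_chain sE s'E zs ws') modM.
have h1 := logder_mod_ge (fun a as_ => (hs' a as_).2) wc.
have h2 : N l * rho ^+ size t <= N (poly_iter P n)^`().[z].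
  rewrite tE hornerZ modM ler_wpM2l ?mod_ge0//.
  by apply: rootpoly_ge => //; exact: ltW.
have sz2 : (size s)%:R = (d ^ n)%:R * (size s')%:R :> R.
  by rewrite sz s'z -natrM -expnD subnKC.
have dn0 : 0 < (d ^ n)%:R :> R by rewrite ltr0n expn_gt0 (ltnW d1).
have h3 : (size s')%:R / (2 * W) <= N (logder s' (poly_iter P n).[z]).
  rewrite ler_pdivrMr ?mulr_gt0//.
  have := ler_wpM2r (mod_ge0 (logder s' (poly_iter P n).[z])) hW; lra.
rewrite sz2.
have -> : N l * rho ^+ size t / (2 * W * (d ^ n)%:R) *
    ((d ^ n)%:R * (size s')%:R) =
    (N l * rho ^+ size t) * ((size s')%:R / (2 * W)).
  by field; rewrite !gt_eqF.
apply: ler_pM => //; first by rewrite mulr_ge0 ?mod_ge0// exprn_ge0// ltW.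
by rewrite divr_ge0// mulr_ge0// ltW.
Qed.

(** On [A], away from the zeros of the derivative of [poly_iter P n], the
    logarithmic derivative of [q = poly_iter P k - c] has order [d ^ k]: by the
    chain rule it is that derivative times a logarithmic derivative taken
    outside the disc of the fibre. So [derivn_dominated] applies there, which
    excludes the zeros of the derivatives of [q], and on annuli around each
    zero [b] it gives the hypothesis of [rouche_annulus] for the product of
    [q^(m+1)] with a power of [q] and for a power of the derivative of [q].
    Near [b] the only zeros of the latter are those of the derivative of
    [poly_iter P n], and [q] has none. *)
Lemma derivative_root_count m :
  (forall b, b \in t -> A b -> nbhs b A) ->
  exists k0, forall k, (k0 <= k)%N ->
    nb_roots (derivn m (poly_iter P k)) A (count_in A t * m)%N.
Proof.
move=> hint.
have d0 : (0 < d)%N by exact: ltnW.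
have iterm k := size_poly_iter k Pm sP d0.
case: m => [|m].
  exists n => k nk; rewrite muln0 derivn0.
  have [qm qs] := iterm k; have q0 := monic_neq0 qm.
  have [s sE] := closed_factor q0.
  rewrite (monicP qm) in sE.
  apply: (nb_roots_count (oner_neq0 _) sE).
  rewrite count_in0// => a as_ Aa.
  have := hA.2 k a a nk Aa; rewrite subrr mod0 => /(_ hA.1).
  have -> : (poly_iter P k).[a] = 0.
    by rewrite sE scale1r; apply/rootP; rewrite root_prod_XsubC.
  by rewrite mod0 ltNge ltW.
have clA : closed A by apply: compact_closed => //; exact: norm_hausdorff.
have [rho rho0 hrho] := good_radius clA hint.
have [B hB] := compact_mod_bounded cA.
have [W0 W00 hW0] := poly_bounded (poly_iter P n) B.
pose W := W0 + 1; have Wgt : 0 < W by rewrite /W; lra.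
pose kappa := N l * rho ^+ size t / (2 * W * (d ^ n)%:R).
have kappa0 : 0 < kappa.
  by rewrite divr_gt0 ?mulr_gt0 ?exprn_gt0 ?mod_gt0// ltr0n expn_gt0 d0.
pose y := e^-1; have y0 : 0 <= y by rewrite invr_ge0 ltW// hA.1.
have [k1 hk1] := nat_unbounded
  (4 * (m.+1 ^ 2)%:R * y ^+ m.+1 / kappa ^+ m.+1) d1.
have [k2 hk2] := nat_unbounded (m.+2%:R : R) d1.
exists (maxn n (maxn k1 k2)) => k; rewrite !geq_max => /and3P[nk kk1 kk2].
have [s [sE sz hs]] := fibre_exists k Pm sP d1 er rc.
have [qm qs] := iterm k.
have dE i : (poly_iter P k)^`(i.+1) = (rootpoly s)^`(i.+1).
  by rewrite -sE derivn_subC.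
have d'E : (poly_iter P k)^`() = (rootpoly s)^`() by rewrite -!derivn1 dE.
have s0 : (0 < size s)%N by rewrite sz expn_gt0 d0.
have Eest z : A z -> (forall b, b \in t -> rho <= N (z - b)) ->
    (rootpoly s)^`().[z] != 0 /\
    N ((rootpoly s)^`(m.+1).[z] * (rootpoly s).[z] ^+ m
      - (rootpoly s)^`().[z] ^+ m.+1)
    <= N ((rootpoly s)^`().[z] ^+ m.+1) / 4.
  move=> Az hz.
  have hL : kappa * (size s)%:R <= N (logder s z).
    apply: (fibre_logder nk Az sE sz hs rho0 hz) => //.
    by apply: (le_trans (hW0 z (hB z Az))); rewrite lerDl.
  have zs : z \notin s.
    apply/negP => zs; have := fibre_far nk Az hs zs.
    by rewrite subrr mod0 leNgt hA.1.
  split; last first.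
    apply: (@derivn_dominated _ _ y kappa) => //.
      move=> a as_; rewrite modV lef_pV2 ?posrE//; first exact: fibre_far hs as_.
        by apply: (lt_le_trans hA.1); exact: fibre_far hs as_.
      exact: hA.1.
    have := hk1 k kk1; rewrite -sz ler_pdivrMr ?exprn_gt0// => h.
    by apply: (le_trans h); rewrite mulrC.
  have : 0 < N (logder s z).
    by apply: lt_le_trans hL; rewrite mulr_gt0// ltr0n.
  by rewrite mod_gt0 logderE// mulf_eq0 negb_or => /andP[].
have Q0 : (poly_iter P k)^`(m.+1) != 0.
  apply: derivn_neq0; rewrite qs ltnS -(ler_nat R).
  by apply: le_trans (hk2 k kk2); rewrite ler_nat.
have [v vE] := closed_factor Q0.
have lv0 : lead_coef (poly_iter P k)^`(m.+1) != 0 by rewrite lead_coef_eq0.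
apply: (nb_roots_count lv0 vE).
(* the derivative of the outer iterate has no zero over A *)
pose g := (poly_iter P (k - n))^`() \Po poly_iter P n.
have gE : (poly_iter P k)^`() = g * (poly_iter P n)^`().
  by rewrite -{1}(subnK nk) deriv_poly_iterD.
have gA z : A z -> g.[z] != 0.
  move=> Az; have [s' [s'E s'z hs']] := fibre_exists (k - n) Pm sP d1 er rc.
  have wc : c < N (poly_iter P n).[z].
    by apply: hA.2 Az _ => //; rewrite subrr mod0 hA.1.
  have ws' : (poly_iter P n).[z] \notin s'.
    by apply/negP => /hs' [_]; rewrite leNgt wc.
  have := logder_mod_ge (fun a as_ => (hs' a as_).2) wc.
  rewrite logderE// -s'E -!derivn1 derivn_subC derivn1 -/(g.[z]).
  apply: contraTneq; rewrite /g horner_comp => ->; rewrite mul0r mod0 mulr0 -ltNge.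
  by rewrite divr_gt0// ltr0n s'z expn_gt0 d0.
have g0 : g != 0.
  apply/eqP => g0; have : (poly_iter P k)^`() != 0.
    by apply: deriv_neq0; rewrite qs ltnS expn_gt0 d0.
  by rewrite gE g0 mul0r eqxx.
have [x xE] := closed_factor g0.
have lx0 : lead_coef g != 0 by rewrite lead_coef_eq0.
have xA a : a \in x -> ~ A a.
  move=> ax /gA; rewrite xE hornerZ horner_rootpoly (big_rem a ax) /=.
  by rewrite subrr mul0r mulr0 eqxx.
have sA a : a \in s -> ~ A a.
  move=> as_ Aa; have := fibre_far nk Aa hs as_.
  by rewrite subrr mod0 leNgt hA.1.
pose ball b := [set w | N (w - b) < rho].
pose bs := [seq b <- undup t | b \in A].
have bsP b : b \in bs -> b \in t /\ A b.
  by rewrite mem_filter mem_undup => /andP[/set_mem].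
have far b z : b \in bs -> rho <= N (z - b) <= 2 * rho ->
    A z /\ forall b', b' \in t -> rho <= N (z - b').
  move=> /bsP [bt Ab] /andP[h1 h2]; have [hin _ hsep] := hrho b bt.
  split; first exact: hin.
  move=> b' b't; have [->//|nb] := eqVneq b' b.
  have := hsep b' b't nb; have := mod_tri (b' - b) (z - b).
  by rewrite (modC z b') opprB addrA subrK; lra.
have ballA b z : b \in bs -> ball b z -> A z.
  move=> /bsP [bt Ab] hz; have [hin _ _] := hrho b bt.
  by apply: hin => //; move: hz; rewrite /ball /= => hz; lra.
have disj b b' z : b \in bs -> b' \in bs -> ball b z -> ball b' z -> b = b'.
  move=> /bsP [bt Ab] /bsP [b't Ab'] hz hz'; apply/eqP; apply/negPn/negP => nb.
  have [_ _ hsep] := hrho b' b't; have := hsep b bt nb.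
  have := modD (b - z) (z - b'); rewrite addrA subrK (modC b z).
  by move: hz hz'; rewrite /ball /= => ? ?; lra.
have near_root z : A z -> (exists2 b, b \in bs & ball b z) \/
    (forall b, b \in t -> rho <= N (z - b)).
  move=> Az; have [h|h] := pselect (exists2 b, b \in bs & ball b z); [by left|].
  right=> b bt; rewrite leNgt; apply/negP => hz; apply: h; exists b => //.
  rewrite mem_filter mem_undup bt andbT; apply: mem_set; apply: contrapT => nAb.
  by have [_ hout _] := hrho b bt; have := hout nAb z Az; rewrite leNgt hz.
have ubs : uniq bs by rewrite filter_uniq// undup_uniq.
have vz a : a \in v -> (rootpoly s)^`(m.+1).[a] = 0.
  move=> av; rewrite -dE vE hornerZ horner_rootpoly (big_rem a av) /=.
  by rewrite subrr mul0r mulr0.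
have cv : count_in A v = (\sum_(b <- bs) count_in (ball b) v)%N.
  apply: count_cluster => // [a b b' av hb hb' /set_mem h1 /set_mem h2|a av].
    exact: disj hb hb' h1 h2.
  split; last by move=> [b hb /set_mem h]; apply: mem_set; exact: ballA h.
  move=> /set_mem Aa; case: (near_root a Aa) => [[b hb h]|h].
    by exists b => //; exact: mem_set.
  have [h1 h2] := Eest a Aa h; move: h2; rewrite (vz a av) mul0r sub0r modN.
  have : 0 < N ((rootpoly s)^`().[a] ^+ m.+1).
    by rewrite mod_gt0 expf_neq0.
  by move=> ? ?; exfalso; lra.
have ct : count_in A t = (\sum_(b <- bs) count_in (ball b) t)%N.
  apply: count_cluster => // [a b b' _ hb hb' /set_mem h1 /set_mem h2|a at_].
    exact: disj hb hb' h1 h2.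
  split; last by move=> [b hb /set_mem h]; apply: mem_set; exact: ballA h.
  move=> Aa; exists a; last by apply: mem_set; rewrite /ball /= subrr mod0.
  by rewrite mem_filter mem_undup at_ Aa.
rewrite ct cv big_distrl /=; apply: eq_big_seq => b hb.
(* the lists of roots of the two sides of [derivn_dominated] *)
pose s1 := v ++ flatten (nseq m s); pose s2 := flatten (nseq m.+1 (x ++ t)).
have F1 : rootpoly s1 = rootpoly v * rootpoly s ^+ m.
  by rewrite rootpoly_cat rootpolyX.
have F2 : (lead_coef g * l) ^+ m.+1 *: rootpoly s2 = (rootpoly s)^`() ^+ m.+1.
  rewrite -d'E gE tE {2}xE -scalerAl -scalerAr scalerA [in RHS]exprZn.
  by rewrite -rootpoly_cat rootpolyX.
have lr0 : (lead_coef g * l) ^+ m.+1 != 0 by rewrite expf_neq0// mulf_neq0.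
have rou := @rouche_annulus R s1 s2 _ _ b rho rho0 lv0 lr0.
have cb0 u : (forall a, a \in u -> ~ A a) -> count_in (ball b) u = 0%N.
  by move=> hu; apply: count_in0 => a /hu na /ballA h; apply: na; exact: h.
have : count_in (ball b) s1 = count_in (ball b) s2.
  apply: rou => w hw; have [Aw hfar] := far b w hb hw.
  have [h1 h2] := Eest w Aw hfar.
  have e2 : ((lead_coef g * l) ^+ m.+1 *: rootpoly s2).[w] =
     (rootpoly s)^`().[w] ^+ m.+1 by rewrite F2 horner_exp.
  split.
    apply/eqP => h0; move: e2; rewrite hornerZ h0 mulr0 => /esym/eqP.
    by rewrite expf_eq0/= (negbTE h1).
  rewrite e2 F1 scalerAl -vE dE hornerM horner_exp; exact: h2.
rewrite /s1 /s2 count_in_cat !count_in_flatten count_in_cat.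
by rewrite (cb0 s sA) (cb0 x xA) muln0 addn0 add0n mulnC => ->.
Qed.

End Count.

End DerivativeCount.

(** * Limits along an ultrafilter and means over lists *)

Section GeneralizedLimit.
Variable R : realType.
Implicit Types (u v : nat -> R).

(** Every bounded sequence converges along a free ultrafilter, additively: no
    convergence of means over fibres has to be established. *)
Definition ultra_infty : set_system nat :=
  sval (cid (ultraFilterLemma eventually_filter)).

#[local] Instance ultra_infty_ultra : UltraFilter ultra_infty.
Proof. by rewrite /ultra_infty; case: cid => U [/=]. Qed.

Lemma ultra_infty_sub : \oo `<=` ultra_infty.
Proof. by rewrite /ultra_infty; case: cid => U [/=]. Qed.

Definition ev_bounded u : Prop :=
  exists B k0, forall k, (k0 <= k)%N -> `|u k| <= B.

Definition glim u : R := lim (u @ ultra_infty).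

Lemma glim_cvg u : ev_bounded u -> u @ ultra_infty --> glim u.
Proof.
move=> [B [k0 hB]].
have UI : UltraFilter (u @ ultra_infty).
  split; first exact: fmap_proper_filter.
  move=> G GF uG; apply/seteqP; split=> // A GA; rewrite /fmap /=.
  have [//|] := in_ultra_setVsetC (u @^-1` A) ultra_infty_ultra.
  move=> h; have GnA : G (~` A) by apply: uG.
  have : G (A `&` ~` A) by exact: filterI.
  by rewrite setICr => /filter_ex [].
have cpt : compact (`[- B, B]%classic : set R) by exact: segment_compact.
move: cpt; rewrite compact_ultra => /(_ (u @ ultra_infty) UI) [].
  apply: ultra_infty_sub; exists k0 => // k /= kk.
  by rewrite in_itv /= -ler_norml hB.
by move=> x [_ hx]; apply: cvgP; exact: hx.
Qed.

Lemma glim_unique u x : u @ ultra_infty --> x -> glim u = x.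
Proof. by move=> h; apply: cvg_lim. Qed.

Lemma ev_bounded_cst (c : R) : ev_bounded (fun=> c).
Proof. by exists `|c|, 0%N. Qed.

Lemma ev_boundedD u v : ev_bounded u -> ev_bounded v -> ev_bounded (u \+ v).
Proof.
move=> [B [k hB]] [B' [k' hB']]; exists (B + B'), (maxn k k') => n.
rewrite geq_max => /andP[kn k'n]; apply: (le_trans (ler_normD _ _)).
by rewrite lerD ?hB ?hB'.
Qed.

Lemma ev_boundedZ (c : R) u : ev_bounded u -> ev_bounded (fun k => c * u k).
Proof.
move=> [B [k hB]]; exists (`|c| * B), k => n kn; rewrite normrM.
by rewrite ler_wpM2l// hB.
Qed.

Lemma glim_cst (c : R) : glim (fun=> c) = c.
Proof. by apply: glim_unique; exact: cvg_cst. Qed.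

Lemma glimD u v : ev_bounded u -> ev_bounded v ->
  glim (u \+ v) = glim u + glim v.
Proof.
by move=> bu bv; apply: glim_unique; apply: cvgD; exact: glim_cvg.
Qed.

Lemma glimZ (c : R) u : ev_bounded u -> glim (fun k => c * u k) = c * glim u.
Proof.
by move=> bu; apply: glim_unique; apply: cvgMr; exact: glim_cvg.
Qed.

Lemma glim_le u v k0 : ev_bounded u -> ev_bounded v ->
  (forall k, (k0 <= k)%N -> u k <= v k) -> glim u <= glim v.
Proof.
move=> bu bv h; apply: (ler_cvg_to (glim_cvg bu) (glim_cvg bv)).
by apply: ultra_infty_sub; exists k0.
Qed.

Lemma glim_eq u v k0 : ev_bounded u ->
  (forall k, (k0 <= k)%N -> u k = v k) -> glim u = glim v.
Proof.
move=> bu h; have bv : ev_bounded v.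
  have [B [k1 hB]] := bu; exists B, (maxn k0 k1) => k.
  by rewrite geq_max => /andP[k0k k1k]; rewrite -h ?hB.
by apply/eqP; rewrite eq_le !(@glim_le _ _ k0)// => k /h ->.
Qed.

Lemma glim_dist_le u v (e : R) k0 : ev_bounded u -> ev_bounded v ->
  (forall k, (k0 <= k)%N -> `|u k - v k| <= e) -> `|glim u - glim v| <= e.
Proof.
move=> bu bv h; have bve := ev_boundedD bv (ev_bounded_cst e).
have bue := ev_boundedD bu (ev_bounded_cst e).
have ge x : ev_bounded x -> glim (x \+ fun=> e) = glim x + e.
  by move=> bx; rewrite glimD ?glim_cst//; exact: ev_bounded_cst.
have h1 : glim u <= glim v + e.
  rewrite -ge//; apply: (glim_le (k0 := k0)) => // k /h /=.
  by rewrite ler_norml => /andP[_]; rewrite lerBlDl addrC.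
have h2 : glim v <= glim u + e.
  rewrite -ge//; apply: (glim_le (k0 := k0)) => // k /h /=.
  by rewrite ler_norml => /andP[]; lra.
by rewrite ler_norml; apply/andP; split; lra.
Qed.

Lemma ev_bounded_sum (I : Type) (r : seq I) (F : I -> nat -> R) :
  (forall i, ev_bounded (F i)) -> ev_bounded (fun k => \sum_(i <- r) F i k).
Proof.
move=> h; elim: r => [|i r IH].
  by under eq_fun do rewrite big_nil; exact: ev_bounded_cst.
by under eq_fun do rewrite big_cons; exact: ev_boundedD.
Qed.

Lemma glim_sum (I : Type) (r : seq I) (F : I -> nat -> R) :
  (forall i, ev_bounded (F i)) ->
  glim (fun k => \sum_(i <- r) F i k) = \sum_(i <- r) glim (F i).
Proof.
move=> h; elim: r => [|i r IH].
  by under eq_fun do rewrite big_nil; rewrite big_nil glim_cst.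
under eq_fun do rewrite big_cons; rewrite big_cons -IH.
by apply: glimD => //; exact: ev_bounded_sum.
Qed.

Lemma glim_ge0 u k0 : ev_bounded u -> (forall k, (k0 <= k)%N -> 0 <= u k) ->
  0 <= glim u.
Proof.
by move=> bu h; rewrite -(glim_cst 0); apply: glim_le h => //;
  exact: ev_bounded_cst.
Qed.

Definition avg (T : Type) (s : seq T) (f : T -> R) : R :=
  (\sum_(a <- s) f a) / (size s)%:R.

Lemma avgD (T : Type) (s : seq T) (f g : T -> R) :
  avg s (fun a => f a + g a) = avg s f + avg s g.
Proof. by rewrite /avg big_split mulrDl. Qed.

Lemma avgZ (T : Type) (s : seq T) (c : R) (f : T -> R) :
  avg s (fun a => c * f a) = c * avg s f.
Proof. by rewrite /avg -mulr_sumr mulrA. Qed.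

Lemma avg_cst (T : Type) (s : seq T) (c : R) : (0 < size s)%N ->
  avg s (fun=> c) = c.
Proof.
move=> s0; rewrite /avg big_const_seq count_predT iter_addr addr0.
by rewrite -(mulr_natr c) mulfK// pnatr_eq0 -lt0n.
Qed.

Lemma avg_le (T : eqType) (s : seq T) (f g : T -> R) :
  (forall a, a \in s -> f a <= g a) -> avg s f <= avg s g.
Proof.
move=> h; rewrite ler_wpM2r ?invr_ge0// [leLHS]big_seq [leRHS]big_seq.
exact: ler_sum.
Qed.

Lemma avg_eq (T : eqType) (s : seq T) (f g : T -> R) :
  (forall a, a \in s -> f a = g a) -> avg s f = avg s g.
Proof. by move=> h; apply/eqP; rewrite eq_le !avg_le// => a /h ->. Qed.

Lemma avg_norm_le (T : eqType) (s : seq T) (f : T -> R) (B : R) :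
  0 <= B -> (forall a, a \in s -> `|f a| <= B) -> `|avg s f| <= B.
Proof.
move=> B0 h; have [s0|s0] := posnP (size s).
  by rewrite /avg s0 invr0 mulr0 normr0.
have h1 : avg s f <= avg s (fun=> B).
  by apply: avg_le => a /h; apply: le_trans; rewrite ler_norm.
have h2 : avg s (fun=> - B) <= avg s f.
  by apply: avg_le => a /h; rewrite ler_norml => /andP[].
by rewrite !avg_cst// in h1 h2; rewrite ler_norml h1 h2.
Qed.

Lemma ev_bounded_avg (T : eqType) (s : nat -> seq T) (f : T -> R) (B : R) k0 :
  0 <= B -> (forall k a, (k0 <= k)%N -> a \in s k -> `|f a| <= B) ->
  ev_bounded (fun k => avg (s k) f).
Proof.
by move=> B0 h; exists B, k0 => k kk; apply: avg_norm_le => // a; exact: h.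
Qed.

End GeneralizedLimit.

(** * Locally Lipschitz functions *)

Section LocallyLipschitz.
Variable R : realType.
Local Notation C := (cplx R).
Local Notation N := (@Normc.normc R).
Implicit Types (f g : C -> R) (z w : C).

(** Lipschitz on every ball: the regularity shared by all the test functions
    below, giving at once measurability, local boundedness and a rate for the
    dyadic approximation of integrals. *)
Definition lipb f : Prop := forall B : R, exists2 L, 0 <= L &
  forall z w, N z <= B -> N w <= B -> `|f z - f w| <= L * N (z - w).

Lemma lipb_bounded f (B : R) : lipb f -> exists2 M, 0 <= M &
  forall z, N z <= B -> `|f z| <= M.
Proof.
move=> hf; have [L L0 hL] := hf `|B|.
exists (`|f 0| + L * `|B|); first by rewrite addr_ge0 ?mulr_ge0.
move=> z zB; have zB' : N z <= `|B| by apply: (le_trans zB); rewrite ler_norm.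
have := hL z 0 zB'; rewrite mod0 normr_ge0 subr0 => /(_ isT) h.
rewrite -(subrK (f 0) (f z)) addrC; apply: (le_trans (ler_normD _ _)).
by rewrite lerD2l; apply: (le_trans h); rewrite ler_wpM2l.
Qed.

Lemma lipb_cst (c : R) : lipb (fun=> c).
Proof. by move=> B; exists 0 => // z w _ _; rewrite subrr normr0 mul0r. Qed.

Lemma lipbD f g : lipb f -> lipb g -> lipb (fun z => f z + g z).
Proof.
move=> hf hg B; have [L L0 h] := hf B; have [L' L'0 h'] := hg B.
exists (L + L'); first exact: addr_ge0.
move=> z w zB wB; rewrite opprD addrACA mulrDl.
by apply: (le_trans (ler_normD _ _)); rewrite lerD ?h ?h'.
Qed.

Lemma lipbM f g : lipb f -> lipb g -> lipb (fun z => f z * g z).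
Proof.
move=> hf hg B; have [L L0 h] := hf B; have [L' L'0 h'] := hg B.
have [M M0 hM] := lipb_bounded B hf; have [M' M'0 hM'] := lipb_bounded B hg.
exists (L * M' + M * L'); first by rewrite addr_ge0// mulr_ge0.
move=> z w zB wB.
have -> : f z * g z - f w * g w = (f z - f w) * g z + f w * (g z - g w).
  by ring.
apply: (le_trans (ler_normD _ _)); rewrite !normrM mulrDl; apply: lerD.
  by rewrite mulrAC ler_pM ?h ?hM'.
by rewrite -mulrA ler_pM ?h' ?hM.
Qed.

Lemma lipbZ (c : R) f : lipb f -> lipb (fun z => c * f z).
Proof. by move=> hf; apply: lipbM => //; exact: lipb_cst. Qed.

Lemma lipbX f n : lipb f -> lipb (fun z => f z ^+ n).
Proof.
move=> hf; elim: n => [|n IH].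
  by under eq_fun do rewrite expr0; exact: lipb_cst.
by under eq_fun do rewrite exprS; exact: lipbM.
Qed.

Lemma lipb_comp (phi : R -> R) (K : R) (D : set R) f : lipb f -> 0 <= K ->
  (forall z, D (f z)) ->
  (forall x y, D x -> D y -> `|phi x - phi y| <= K * `|x - y|) ->
  lipb (fun z => phi (f z)).
Proof.
move=> hf K0 fD hphi B; have [L L0 h] := hf B.
exists (K * L); first exact: mulr_ge0.
move=> z w zB wB; apply: (le_trans (hphi _ _ (fD z) (fD w))).
by rewrite -mulrA ler_wpM2l// h.
Qed.

Lemma lipbV f : lipb f -> (forall z, 1 <= f z) -> lipb (fun z => (f z)^-1).
Proof.
move=> hf f1; apply: (@lipb_comp _ 1 [set x | 1 <= x]) => // x y /= x1 y1.
have x0 : 0 < x by lra.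
have y0 : 0 < y by lra.
have -> : x^-1 - y^-1 = (y - x) / (x * y) by field; rewrite !gt_eqF.
rewrite normrM distrC mul1r ler_piMr// normrV ?unitfE ?gt_eqF ?mulr_gt0//.
by rewrite gtr0_norm ?mulr_gt0// invf_le1 ?mulr_gt0// mulr_ege1.
Qed.

Lemma lipb_ln f : lipb f -> (forall z, 1 <= f z) -> lipb (fun z => ln (f z)).
Proof.
move=> hf f1; apply: (@lipb_comp _ 1 [set x | 1 <= x]) => // x y /= x1 y1.
have key (a b : R) : 1 <= a -> 1 <= b -> ln a - ln b <= `|a - b|.
  move=> a1 b1; have a0 : 0 < a by lra.
  have b0 : 0 < b by lra.
  rewrite -ln_div ?posrE//.
  have -> : a / b = 1 + (a - b) / b by field; rewrite gt_eqF.
  apply: (@le_trans _ _ ((a - b) / b)).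
    apply: le_ln1Dx; rewrite ltr_pdivlMr//; lra.
  apply: (le_trans (ler_norm _)); rewrite normrM ler_piMr// normrV ?unitfE ?gt_eqF//.
  by rewrite gtr0_norm// invf_le1.
rewrite mul1r ler_norml lerNl opprB key//= distrC key//.
Qed.

Lemma lipb_mod : lipb (fun z => N z).
Proof. by move=> B; exists 1 => // z w _ _; rewrite mul1r mod_dist. Qed.

Lemma lipb_modpoly (p : {poly C}) : lipb (fun z => N p.[z]).
Proof.
move=> B; have [L L0 h] := poly_lipschitz p B; exists L => // z w zB wB.
by apply: (le_trans (mod_dist _ _)); exact: h.
Qed.

Lemma lipb_Re : lipb (fun z => complex.Re z).
Proof.
move=> B; exists 1 => // z w _ _; rewrite mul1r.
by apply: le_trans (Re_le_mod (z - w)); case: z w => [? ?] [? ?].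
Qed.

Lemma lipb_Im : lipb (fun z => complex.Im z).
Proof.
move=> B; exists 1 => // z w _ _; rewrite mul1r.
by apply: le_trans (Im_le_mod (z - w)); case: z w => [? ?] [? ?].
Qed.

Lemma lipb_continuous f : lipb f -> continuous (f : C -> R).
Proof.
move=> hf z; apply/(@cvgrPdist_lt R R C (nbhs z) (nbhs_filter z) f (f z)) => e e0.
have [L L0 hL] := hf (N z + 1); have L1 : 0 < L + 1 by lra.
apply/nbhs_mod; exists (Num.min 1 (e / (L + 1))).
  by rewrite lt_min ltr01 divr_gt0.
move=> w; rewrite lt_min => /andP[w1 we].
have wB : N w <= N z + 1.
  rewrite -{1}(subrK z w); apply: (le_trans (modD _ _)).
  by rewrite addrC lerD2l ltW.
have zB : N z <= N z + 1 by rewrite lerDl.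
apply: (le_lt_trans (hL z w zB wB)); rewrite ltr_pdivlMr// in we.
rewrite modC; apply: le_lt_trans we; rewrite mulrC ler_wpM2l ?mod_ge0//; lra.
Qed.

Lemma open_borel (A : set C) : open A -> measurable (A : set (borel_cplx R)).
Proof. by move=> oA; exact: sub_sigma_algebra. Qed.

Lemma continuous_borel f : continuous f ->
  measurable_fun [set: borel_cplx R] (f : borel_cplx R -> R).
Proof.
move=> /continuousP cf; apply: (measurability _ (RGenOpens.measurableE R)).
move=> _ [_ [a [b ->] <-]]; rewrite setTI; apply: open_borel.
by apply: cf; exact: interval_open.
Qed.

Lemma lipb_measurable f : lipb f ->
  measurable_fun [set: borel_cplx R] (f : borel_cplx R -> R).
Proof. by move=> hf; apply: continuous_borel; exact: lipb_continuous. Qed.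

End LocallyLipschitz.

(** * Dyadic rectangles *)

Section DyadicCoding.
Variable R : realType.
Local Notation C := (cplx R).
Local Notation N := (@Normc.normc R).
Implicit Types (z w a p : C) (v : seq bool).

Lemma nested_intervals (c h : nat -> R) :
  (forall n, `|c n.+1 - c n| <= h n - h n.+1) -> (forall n, 0 <= h n) ->
  exists x, forall n, `|x - c n| <= h n.
Proof.
move=> hc h0.
have lo n k : c n - h n <= c (n + k)%N - h (n + k)%N.
  elim: k => [|k IH]; first by rewrite addn0.
  apply: (le_trans IH); rewrite addnS.
  by have := hc (n + k)%N; rewrite ler_norml => /andP[? _]; lra.
have hi n k : c (n + k)%N + h (n + k)%N <= c n + h n.
  elim: k => [|k IH]; first by rewrite addn0.
  apply: le_trans IH; rewrite addnS.
  by have := hc (n + k)%N; rewrite ler_norml => /andP[_ ?]; lra.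
have lohi n m : c n - h n <= c m + h m.
  have h1 := lo n m; have h2 := hi m n; have h3 := h0 (n + m)%N.
  by rewrite addnC in h2; lra.
pose S := [set x | exists n, x = c n - h n].
have S0 : S !=set0 by exists (c 0%N - h 0%N), 0%N.
have hS : has_ubound S.
  by exists (c 0%N + h 0%N) => _ [n ->]; exact: lohi.
exists (sup S) => n; rewrite ler_norml.
have h1 : c n - h n <= sup S by apply: ub_le_sup => //; exists n.
have h2 : sup S <= c n + h n by apply: ge_sup => // _ [m ->]; exact: lohi.
by apply/andP; split; lra.
Qed.

(** Words code the dyadic rectangles of the square of half-side [B]: the
    letters, latest first, halve the real and the imaginary range in turn. *)
Section Code.
Variable B : R.
Hypothesis B0 : 0 < B.

Definition half_re (n : nat) : R := B / 2 ^+ uphalf n.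
Definition half_im (n : nat) : R := B / 2 ^+ n./2.
Definition sgb (b : bool) : R := if b then 1 else - 1.

Fixpoint centre_re v : R := if v is b :: v' then
  if odd (size v') then centre_re v'
  else centre_re v' + sgb b * half_re (size v').+1 else 0.
Fixpoint centre_im v : R := if v is b :: v' then
  if odd (size v') then centre_im v' + sgb b * half_im (size v').+1
  else centre_im v' else 0.
Definition centre v : C := (centre_re v +i* centre_im v)%C.

Definition next_bit a v : bool :=
  if odd (size v) then centre_im v <= complex.Im a
  else centre_re v <= complex.Re a.

Fixpoint code a (n : nat) : seq bool :=
  if n is n'.+1 then next_bit a (code a n') :: code a n' else [::].

Definition inside a v : Prop :=
  `|complex.Re a - centre_re v| <= half_re (size v) /\
  `|complex.Im a - centre_im v| <= half_im (size v).

Lemma half_re_ge0 n : 0 <= half_re n.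
Proof. by rewrite divr_ge0 ?exprn_ge0 ?(ltW B0). Qed.
Lemma half_im_ge0 n : 0 <= half_im n.
Proof. by rewrite divr_ge0 ?exprn_ge0 ?(ltW B0). Qed.

Lemma half_reS n :
  half_re n = (if odd n then half_re n.+1 else 2 * half_re n.+1).
Proof.
rewrite /half_re uphalf_half /=; case: (odd n) => //=.
by rewrite add0n exprS; field; rewrite expf_neq0.
Qed.
Lemma half_imS n :
  half_im n = (if odd n then 2 * half_im n.+1 else half_im n.+1).
Proof.
rewrite /half_im /= uphalf_half; case: (odd n) => //=.
by rewrite exprS; field; rewrite expf_neq0.
Qed.

Lemma size_code a n : size (code a n) = n.
Proof. by elim: n => //= n ->. Qed.

Lemma code_inside a n : N a <= B -> inside a (code a n).
Proof.
move=> aB; elim: n => [|n [IH1 IH2]].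
  rewrite /inside /= !subr0 /half_re /half_im /= !expr0 !divr1.
  by split; apply: le_trans aB; [exact: Re_le_mod|exact: Im_le_mod].
rewrite /inside /= /next_bit; move: IH1 IH2; rewrite size_code.
rewrite (half_reS n) (half_imS n).
move: (half_re_ge0 n.+1) (half_im_ge0 n.+1).
move: (half_re _) (half_im _) (centre_re _) (centre_im _) => x y u v x0 y0.
rewrite !ler_norml /sgb; case: (odd n) => /andP[h1 h2] /andP[h3 h4].
  by case: (leP v) => ?; split; apply/andP; split=> //; lra.
by case: (leP u) => ?; split; apply/andP; split=> //; lra.
Qed.

(** The rectangles along an infinite branch of the binary tree are nested. *)
Lemma branch_inside (w : nat -> seq bool) : w 0%N = [::] ->
  (forall n, exists b, w n.+1 = b :: w n) ->
  exists p, forall n, inside p (w n).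
Proof.
move=> w0 wS; have sw n : size (w n) = n.
  by elim: n => [|n IH]; rewrite ?w0//; have [b ->] := wS n; rewrite /= IH.
have sg b (x : R) : 0 <= x -> `|sgb b * x| = x.
  by move=> x0; rewrite normrM /sgb; case: b => /=;
     rewrite ?normrN normr1 mul1r ger0_norm.
have [x hx] : exists x, forall n, `|x - centre_re (w n)| <= half_re n.
  apply: nested_intervals => n; last exact: half_re_ge0.
  have [b ->] := wS n; rewrite /= sw (half_reS n); case: (odd n).
    by rewrite !subrr normr0.
  by rewrite addrC addKr sg ?half_re_ge0//; lra.
have [y hy] : exists y, forall n, `|y - centre_im (w n)| <= half_im n.
  apply: nested_intervals => n; last exact: half_im_ge0.
  have [b ->] := wS n; rewrite /= sw (half_imS n); case: (odd n).
    by rewrite addrC addKr sg ?half_im_ge0//; lra.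
  by rewrite !subrr normr0.
by exists (x +i* y)%C => n; split; rewrite sw.
Qed.

Definition mesh (n : nat) : R := half_re n + half_im n.

Lemma inside_centre a v : inside a v -> N (a - centre v) <= mesh (size v).
Proof.
move=> [h1 h2]; apply: (le_trans (mod_le_ReIm _)).
by case: a h1 h2 => x y /= h1 h2; exact: lerD.
Qed.

Lemma mesh_le n : mesh n <= 2 * B.
Proof.
have h (k : nat) : B / 2 ^+ k <= B.
  by rewrite ler_pdivrMr ?exprn_gt0// ler_peMr ?(ltW B0)// exprn_ege1// ler1n.
by have := h (uphalf n); have := h n./2; rewrite /mesh /half_re /half_im; lra.
Qed.

Lemma mesh_ge0 n : 0 <= mesh n.
Proof. by rewrite addr_ge0 ?half_re_ge0 ?half_im_ge0. Qed.

Lemma mesh_small (e : R) : 0 < e -> exists n, mesh n < e.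
Proof.
move=> e0; have [k hk] := pow2_unbounded (2 * B / e).
exists (k.*2); rewrite /mesh /half_re /half_im uphalf_double doubleK.
have p0 : 0 < 2 ^+ k :> R by rewrite exprn_gt0.
have -> : B / 2 ^+ k + B / 2 ^+ k = 2 * B / 2 ^+ k by ring.
by rewrite ltr_pdivrMr// [ltRHS]mulrC -ltr_pdivrMr.
Qed.

Lemma inside_nil_bound a : inside a [::] -> N a <= 2 * B.
Proof.
move=> /inside_centre; rewrite /centre /= => h; apply: le_trans (mesh_le 0).
by move: h; case: a => x y; rewrite /= !subr0.
Qed.

Lemma inside_bound a v : N a <= 2 * B -> inside a v -> N (centre v) <= 4 * B.
Proof.
move=> aB /inside_centre h; have := mod_triD (centre v) a.
have h2 := mesh_le (size v).
have := mod_tri (centre v) a; rewrite modC; lra.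
Qed.

End Code.
End DyadicCoding.

(** * Weak limits of uniform measures on finite lists *)

Section WeakLimit.
Variable R : realType.
Local Notation C := (cplx R).
Local Notation N := (@Normc.normc R).
Implicit Types (z w a p : C) (v : seq bool).

Variables (B : R) (s : nat -> seq C).
Hypothesis B0 : 0 < B.
Hypothesis s0 : forall k, (0 < size (s k))%N.
Hypothesis sB : forall k a, a \in s k -> N a <= B.

Definition freq k v : R :=
  avg (s k) (fun a => (code B a (size v) == v)%:R).
Definition mass v : R := glim (fun k => freq k v).

(** The unit interval is cut into consecutive intervals of lengths [mass v],
    in the order of the binary tree of words; [left_end v] is where the
    interval of [v] starts and [branch t n] is the word of length [n] whose
    interval holds [t]. *)
Fixpoint left_end v : R := if v is b :: v' then
  if b then left_end v' + mass (false :: v') else left_end v' else 0.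
Fixpoint branch (t : R) (n : nat) : seq bool := if n is n'.+1 then
  (left_end (branch t n') + mass (false :: branch t n') <= t) :: branch t n'
  else [::].

Lemma freq_bounded v : ev_bounded (fun k => freq k v).
Proof.
apply: (@ev_bounded_avg _ _ _ _ 1 0) => // k a _ _.
by case: (_ == _); rewrite ?normr1 ?normr0.
Qed.

Lemma mass_ge0 v : 0 <= mass v.
Proof.
apply: (@glim_ge0 _ _ 0); first exact: freq_bounded.
move=> k _; rewrite -(@avg_cst _ _ (s k) 0)//.
by apply: avg_le => a _; rewrite ler0n.
Qed.

Lemma mass_nil : mass [::] = 1.
Proof.
rewrite -[RHS](glim_cst (1 : R)); congr glim; apply/funext => k.
rewrite /freq /= -[RHS](@avg_cst _ _ (s k) 1)//.
Qed.

Lemma mass_split v : mass v = mass (false :: v) + mass (true :: v).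
Proof.
rewrite -glimD; try exact: freq_bounded.
congr glim; apply/funext => k; rewrite /= /freq -avgD; apply: avg_eq => a _ /=.
by rewrite !eqseq_cons; case: next_bit; rewrite /= ?addr0 ?add0r.
Qed.

Lemma left_end_ge0 v : 0 <= left_end v.
Proof. by elim: v => //= -[] v IH//; rewrite addr_ge0// mass_ge0. Qed.

Lemma right_end_le1 v : left_end v + mass v <= 1.
Proof.
elim: v => [|b v IH]; first by rewrite /= mass_nil add0r.
apply: le_trans IH; rewrite (mass_split v); have := mass_ge0 (true :: v).
by case: b => /=; lra.
Qed.

Lemma size_branch t n : size (branch t n) = n.
Proof. by elim: n => //= n ->. Qed.

Lemma branchP t v : 0 <= t < 1 ->
  (branch t (size v) == v) = (left_end v <= t < left_end v + mass v).
Proof.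
move=> t01; elim: v => [|b v IH]; first by rewrite /= mass_nil add0r t01 eqxx.
rewrite /= eqseq_cons.
have h0 := mass_ge0 (false :: v); have h1 := mass_ge0 (true :: v).
have h := mass_split v.
case: (eqVneq (branch t (size v)) v) IH => [->|_] IH; last first.
  rewrite andbF; apply/esym/negbTE; move/esym/negbT: IH; apply: contraNN.
  by case: b => /= /andP[? ?]; apply/andP; split; lra.
rewrite andbT; case/esym/andP: IH => h2 h3.
have [h4|h4] := leP (left_end v + mass (false :: v)) t; case: b => /=.
- by apply/esym/andP; split; lra.
- by apply/esym/negbTE; rewrite negb_and -!ltNge -!leNgt; apply/orP; right; lra.
- by apply/esym/negbTE; rewrite negb_and -!ltNge -!leNgt; apply/orP; left; lra.
- by apply/esym/andP; split; lra.
Qed.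

Local Notation P01 := (uniform_prob (@ltr01 R)).

Let cell v : set R := [set t | branch t (size v) = v].

Let unit_itv : set R := `[0, 1[%classic.

Let P01_itv (x y : R) : 0 <= x -> x <= y -> y <= 1 ->
  P01 `[x, y[%classic = (y - x)%:E.
Proof.
move=> x0 xy y1; rewrite /uniform_prob.
rewrite (eq_integral (fun=> 1%:E)); last first.
  move=> t /set_mem /=; rewrite in_itv /= => /andP[xt ty].
  rewrite /uniform_pdf subr0 invr1 ifT//; apply/andP; split; lra.
rewrite integral_cst//= mul1e lebesgue_measure_itv /= lte_fin.
by case: ltgtP xy => // -> _; rewrite subrr.
Qed.

Let measurable_cell v : measurable (cell v : set (measurableTypeR R)).
Proof.
elim: v => [|b v IH]; first by rewrite (_ : cell _ = setT)//; apply/seteqP.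
rewrite (_ : cell (b :: v) = cell v `&`
   [set t | (left_end v + mass (false :: v) <= t) = b]).
  apply: measurableI => //; case: b.
    rewrite (_ : [set _ | _] = `[left_end v + mass (false :: v), +oo[%classic)//.
    by apply/seteqP; split=> t /=; rewrite in_itv /= andbT.
  rewrite (_ : [set _ | _] = `]-oo, left_end v + mass (false :: v)[%classic)//.
  by apply/seteqP; split=> t /=; rewrite in_itv /= leNgt; [move/negbFE|move=> ->].
apply/seteqP; split=> t; rewrite /cell /=.
  by move=> [h1 h2]; split=> //; rewrite -h1 h2.
by move=> [-> ->].
Qed.

Let measurable_unit_itv : measurable (unit_itv : set (measurableTypeR R)).
Proof. exact: measurable_itv. Qed.

Let P01_cell v : P01 (cell v) = (mass v)%:E.
Proof.
have PT : P01 (~` unit_itv) = 0%E.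
  have e : P01 unit_itv = 1%E by rewrite /unit_itv P01_itv// subr0.
  have := @probability_setC _ _ _ P01 unit_itv measurable_unit_itv.
  by rewrite [X in (_ - X)%E](_ : _ = 1%E)// => ->; rewrite subee.
transitivity (P01 (cell v `&` unit_itv)).
  have mI : measurable (cell v `&` unit_itv : set (measurableTypeR R)).
    exact: measurableI.
  have mD : measurable (cell v `\` unit_itv : set (measurableTypeR R)).
    exact: measurableD.
  have dis : (cell v `&` unit_itv) `&` (cell v `\` unit_itv) = set0.
    by apply/seteqP; split=> // t [[_ h] [_ h']].
  rewrite -{1}(setUIDK (cell v) unit_itv) measureU//.
    rewrite [X in (_ + X)%E](_ : _ = 0%E) ?adde0//.
    apply/eqP; rewrite eq_le measure_ge0 andbT -PT; apply: le_measure;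
      rewrite ?inE//.
    exact: measurableC.
rewrite (_ : _ `&` _ = `[left_end v, left_end v + mass v[%classic).
  rewrite P01_itv ?left_end_ge0 ?right_end_le1//; first by rewrite addrC addKr.
  by rewrite lerDl mass_ge0.
have h0 := left_end_ge0 v; have h1 := right_end_le1 v.
apply/seteqP; split=> t; rewrite /cell /unit_itv /= !in_itv /=.
  by move=> [h2 h3]; rewrite -branchP// h2.
move=> h2; have t01 : 0 <= t < 1.
  by case/andP: h2 => *; apply/andP; split; lra.
by split=> //; apply/eqP; rewrite branchP.
Qed.

Let point_exists t : exists p, forall n, inside B p (branch t n).
Proof. by apply: branch_inside => // n; eexists. Qed.

Let point t : C := projT1 (cid (point_exists t)).

Let point_inside t n : inside B (point t) (branch t n).
Proof. by rewrite /point; case: cid. Qed.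

Let point_near t n : N (point t - centre B (branch t n)) <= mesh B n.
Proof.
by have := inside_centre (point_inside t n); rewrite size_branch.
Qed.

Let measurable_branch n (Q : seq bool -> Prop) :
  measurable ([set t | Q (branch t n)] : set (measurableTypeR R)).
Proof.
rewrite (_ : [set t | _] = \bigcup_(v in [set v | size v = n /\ Q v]) cell v).
  apply: fin_bigcup_measurable; last by move=> v _; exact: measurable_cell.
  apply: (@sub_finite_set _ _ [set tval v | v in [set: n.-tuple bool]]).
    by move=> v [/eqP sv _]; exists (Tuple sv).
  by apply: finite_image; exact: finite_finset.
apply/seteqP; split=> t /=.
  by move=> Qt; exists (branch t n); rewrite /= /cell /= ?size_branch.
by move=> [v [<- Qv]]; rewrite /cell /= => ->.
Qed.

Let measurable_point :
  measurable_fun [set: measurableTypeR R] (point : _ -> borel_cplx R).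
Proof.
apply: (@measurability _ _ _ (borel_cplx R) _ _ (@open C)) => //.
move=> _ [U oU <-]; rewrite setTI.
rewrite (_ : point @^-1` U = \bigcup_n [set t | (fun v => forall w,
    N (w - centre B v) <= mesh B n -> U w) (branch t n)]).
  apply: (@bigcup_measurable _ (measurableTypeR R)) => n _.
  exact: (measurable_branch n
    (fun v => forall w, N (w - centre B v) <= mesh B n -> U w)).
apply/seteqP; split=> t /=.
  move=> Ut.
  have /nbhs_mod [e e0 he] : nbhs (point t) U by exact: open_nbhs_nbhs.
  have e20 : 0 < e / 2 by lra.
  have [n hn] := mesh_small B e20.
  exists n => //= w hw; apply: he.
  have := modB (w - centre B (branch t n)) (point t - centre B (branch t n)).
  by rewrite opprB addrA subrK; have := point_near t n; lra.
by move=> [n _]; apply; exact: point_near.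
Qed.

Let bounded_integrable (g : R -> R) (M : R) :
  measurable_fun [set: measurableTypeR R] (g : measurableTypeR R -> R) ->
  (forall t, `|g t| <= M) -> P01.-integrable setT (EFin \o g).
Proof.
move=> mg hM; apply: measurable_bounded_integrable => //.
  by apply: (le_lt_trans (probability_le1 P01 measurableT)); rewrite ltry.
exists M; split; first exact: num_real.
by move=> x Mx t _ /=; apply: (le_trans (hM t)); exact: ltW.
Qed.

Let integral_branch n (h : seq bool -> R) :
  (\int[P01]_t h (branch t n) = \sum_(v : n.-tuple bool) h v * mass v)%R.
Proof.
rewrite /Rintegral.
under eq_integral => t _.
  rewrite (_ : (h (branch t n))%:E =
      (\sum_(v : n.-tuple bool) (h v * \1_(cell v) t)%:E)%E); last first.
    have sz : size (branch t n) == n by rewrite size_branch.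
    rewrite (bigD1 (Tuple sz)) //= big1 ?adde0; last first.
      move=> v /eqP nv; rewrite indicE memNset ?mulr0//.
      rewrite /cell /= size_tuple => e; apply: nv; apply: val_inj.
      by rewrite /= e.
    by rewrite indicE mem_set ?mulr1//= /cell /= size_branch.
  over.
have mI v : measurable_fun [set: measurableTypeR R]
    ((fun t => h v * \1_(cell v) t) : measurableTypeR R -> R).
  by apply: measurable_funM => //; exact: measurable_indic.
have iI v : P01.-integrable setT (EFin \o (fun t => h v * \1_(cell v) t)).
  apply: (@bounded_integrable _ `|h v|) => // t.
  rewrite normrM ler_piMr// indicE; case: (_ \in _); rewrite ?normr1 ?normr0//.
rewrite integral_sum//; last by move=> v; exact: iI.
rewrite (eq_bigr (fun v : n.-tuple bool => (h v * mass v)%:E)) ?sumEFin//.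
move=> v _; under eq_integral do rewrite EFinM.
rewrite integralZl//; last first.
  apply: (@bounded_integrable _ 1); first exact: measurable_indic.
  by move=> t; rewrite indicE; case: (_ \in _); rewrite ?normr1 ?normr0.
by rewrite integral_indic// setIT EFinM; congr (_ * _)%E; exact: P01_cell.
Qed.

Let avg_code k n (h : seq bool -> R) :
  avg (s k) (fun a => h (code B a n)) = \sum_(v : n.-tuple bool) h v * freq k v.
Proof.
under [RHS]eq_bigr do rewrite -avgZ.
rewrite /avg -mulr_suml exchange_big /=; congr (_ / _).
apply: eq_bigr => a _; have sz : size (code B a n) == n by rewrite size_code.
rewrite (bigD1 (Tuple sz)) //= big1 ?addr0; last first.
  move=> v /eqP nv; rewrite size_tuple; case: eqP => [e|]; rewrite ?mulr0//.
  by case: nv; apply: val_inj; rewrite /= e.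
by rewrite size_code eqxx mulr1.
Qed.

Let glim_code n (h : seq bool -> R) :
  glim (fun k => avg (s k) (fun a => h (code B a n))) =
  (\int[P01]_t h (branch t n))%R.
Proof.
rewrite integral_branch.
rewrite (_ : (fun k => _) =
    (fun k => \sum_(v : n.-tuple bool) h v * freq k v)); last first.
  by apply/funext => k; exact: avg_code.
rewrite glim_sum => [|v]; last by apply: ev_boundedZ; exact: freq_bounded.
by apply: eq_bigr => v _; rewrite glimZ//; exact: freq_bounded.
Qed.

Let point_bound t : N (point t) <= 2 * B.
Proof. exact: (inside_nil_bound B0 (point_inside t 0)). Qed.

Let dist_middle (u v w x L e : R) : `|v - w| <= L * x -> `|u - w| <= L * x ->
  0 <= x -> 0 <= L -> x * (2 * L + 1) < e -> `|u - v| <= e.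
Proof.
by rewrite !ler_norml => /andP[? ?] /andP[? ?] *; apply/andP; split; nra.
Qed.

(** The point whose dyadic code is [branch t] depends measurably on [t], and the
    image of Lebesgue measure under this map gives to every dyadic rectangle
    the limit of its frequencies. A locally Lipschitz function is constant up
    to the mesh on each rectangle, so its integral is the limit of its
    means. *)
Lemma weak_limit : exists nu : probability (borel_cplx R) R,
  nu [set z | N z <= 2 * B] = 1%E /\
  forall f : C -> R, lipb f ->
    (\int[nu]_z (f z)%:E)%E = (glim (fun k => avg (s k) f))%:E.
Proof.
pose X : {mfun measurableTypeR R >-> borel_cplx R} :=
  mfun_Sub (mem_set measurable_point).
exists (distribution P01 X); split.
  rewrite /distribution /pushforward /=.
  rewrite (_ : _ @^-1` _ = setT) ?probability_setT//.
  by apply/seteqP; split=> // t _ /=; exact: point_bound.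
move=> f hf; have mf := lipb_measurable hf.
have [M M0 hM] := lipb_bounded (4 * B) hf.
have [L L0 hL] := hf (4 * B).
have pB t : N (point t) <= 4 * B.
  by apply: (le_trans (point_bound t)); rewrite ler_pM2r// ler_nat.
have cB t n : N (centre B (branch t n)) <= 4 * B.
  exact: (inside_bound B0 (point_bound t) (point_inside t n)).
have mfp : measurable_fun [set: measurableTypeR R]
    ((fun t => f (point t)) : measurableTypeR R -> R).
  exact: (measurableT_comp mf measurable_point).
have ifp : P01.-integrable setT (EFin \o (fun t => f (point t))).
  by apply: (@bounded_integrable _ M) => // t; exact: hM.
rewrite integral_distribution//; last first.
  exact/measurable_EFinP.
rewrite (_ : (\int[P01]_x _)%E = (\int[P01]_t f (point t))%R%:E); last first.
  by rewrite /Rintegral fineK//; exact: integrable_fin_num.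
congr EFin; apply/eqP; rewrite -subr_eq0 -normr_le0; apply/ler_addgt0Pl => e e0.
have e1 : 0 < e / (2 * L + 1) by rewrite divr_gt0//; lra.
have [n hn] := mesh_small B e1; rewrite ltr_pdivlMr in hn; last lra.
pose h v := f (centre B v).
have bavg (g : C -> R) M' : 0 <= M' -> (forall k a, a \in s k -> `|g a| <= M') ->
    ev_bounded (fun k => avg (s k) g).
  by move=> M'0 hg; apply: (@ev_bounded_avg _ _ _ _ M' 0) => // k a _; exact: hg.
(* replacing points with centres costs at most [L] times the mesh *)
have h1 : `|glim (fun k => avg (s k) f) -
    glim (fun k => avg (s k) (fun a => h (code B a n)))| <= L * mesh B n.
  have aB k a : a \in s k -> N a <= 4 * B.
    by move=> /sB ha; apply: (le_trans ha); rewrite ler_peMl ?(ltW B0)// ler1n.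
  have caB k a : a \in s k -> N (centre B (code B a n)) <= 4 * B.
    move=> ak; have aB1 := sB ak.
    have aB2 : N a <= 2 * B by apply: (le_trans aB1); rewrite ler_peMl ?(ltW B0)// ler1n.
    have ins := code_inside B0 n aB1. exact: (inside_bound B0 aB2 ins).
  apply: (@glim_dist_le _ _ _ _ 0).
  - by apply: (bavg _ M) => // k a ak; apply: hM; exact: aB ak.
  - by apply: (bavg _ M) => // k a ak; apply: hM; exact: caB ak.
  move=> k _; rewrite -mulN1r -avgZ -avgD; apply: avg_norm_le.
    by rewrite mulr_ge0// mesh_ge0.
  move=> a ak; rewrite mulN1r; apply: (le_trans (hL _ _ (aB _ _ ak) (caB _ _ ak))).
  rewrite ler_wpM2l//; rewrite -{2}(size_code B a n); apply: inside_centre.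
  by apply: code_inside => //; exact: sB ak.
have mh : measurable_fun [set: measurableTypeR R]
    ((fun t => h (branch t n)) : measurableTypeR R -> R).
  move=> _ Y mY; rewrite setTI.
  exact: (measurable_branch n (fun v => Y (h v))).
have ih : P01.-integrable setT (EFin \o (fun t => h (branch t n))).
  by apply: (@bounded_integrable _ M) => // t; apply: hM.
have h2 : `|(\int[P01]_t f (point t))%R - (\int[P01]_t h (branch t n))%R|
    <= L * mesh B n.
  rewrite -RintegralB//.
  apply: (le_trans (le_normr_Rintegral _ _)) => //.
    exact: (integrableB _ ifp ih).
  apply: (@le_trans _ _ (\int[P01]_t (L * mesh B n))%R); last first.
    rewrite Rintegral_cst// [X in fine X](_ : _ = 1%E) ?mulr1//.
    exact: (probability_setT P01).
  apply: le_Rintegral => //.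
  - apply: (@bounded_integrable _ (M + M)).
      apply: measurableT_comp => //; exact: measurable_funB.
    move=> t; rewrite normr_id; apply: (le_trans (ler_normB _ _)).
    by apply: lerD; apply: hM.
  - exact: (@bounded_integrable _ `|L * mesh B n|).
  move=> t _; apply: (le_trans (hL _ _ (pB t) (cB t n))).
  by rewrite ler_wpM2l// point_near.
rewrite glim_code in h1; rewrite addr0.
exact: dist_middle h1 h2 (mesh_ge0 B0 n) L0 hn.
Qed.

End WeakLimit.

(** * The logarithmic series *)

Section LogSeries.
Variable R : realType.
Implicit Types (x y t : R).

Definition logpoly (n : nat) : {poly R} :=
  \sum_(j < n) (j.+1%:R^-1) *: 'X^(j.+1).

Lemma logpolyS n y : (logpoly n.+1).[y] = (logpoly n).[y] + y ^+ n.+1 / n.+1%:R.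
Proof.
by rewrite /logpoly big_ord_recr /= hornerD hornerZ hornerXn mulrC.
Qed.

Lemma logpoly0 y : (logpoly 0).[y] = 0.
Proof. by rewrite /logpoly big_ord0 horner0. Qed.

Lemma logpoly_at0 n : (logpoly n).[0] = 0.
Proof.
by elim: n => [|n IH]; rewrite ?logpoly0// logpolyS IH expr0n mul0r addr0.
Qed.

Lemma logpoly_ge0 n y : 0 <= y -> 0 <= (logpoly n).[y].
Proof.
move=> y0; elim: n => [|n IH]; rewrite ?logpoly0// logpolyS.
by rewrite addr_ge0// divr_ge0// exprn_ge0.
Qed.

Lemma logpoly_nd m n y : 0 <= y -> (m <= n)%N ->
  (logpoly m).[y] <= (logpoly n).[y].
Proof.
move=> y0 /subnK <-; elim: (n - m)%N => [|k IH]; first by rewrite add0n.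
rewrite addSn; apply: (le_trans IH); rewrite logpolyS lerDl.
by rewrite divr_ge0// exprn_ge0.
Qed.

Lemma logpoly_mono n x y : 0 <= x -> x <= y ->
  (logpoly n).[x] <= (logpoly n).[y].
Proof.
move=> x0 xy; elim: n => [|n IH]; first by rewrite !logpoly0.
rewrite !logpolyS lerD// ler_wpM2r ?invr_ge0// lerXn2r ?nnegrE//.
exact: le_trans xy.
Qed.

Lemma deriv_logpoly n t : (1 - t) * (logpoly n)^`().[t] = 1 - t ^+ n.
Proof.
have -> : (logpoly n)^`().[t] = \sum_(j < n) t ^+ j.
  rewrite /logpoly raddf_sum horner_sum; apply: eq_bigr => j _.
  rewrite /= derivZ derivXn /= hornerZ hornerMn hornerXn.
  by rewrite -(mulr_natl (t ^+ j)) mulKf// pnatr_eq0.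
by rewrite -[LHS]opprK -mulNr opprB -subrX1 opprB.
Qed.

(** The remainder vanishes at 0 and its derivative is [t ^+ n / (1 - t)], so
    the mean value theorem bounds it on both sides. *)
Lemma log_series_bounds n y : 0 <= y -> y < 1 ->
  (logpoly n).[y] <= - ln (1 - y) /\
  - ln (1 - y) - (logpoly n).[y] <= y ^+ n / (1 - y).
Proof.
move=> y0 y1; pose f t := - ln (1 - t) - (logpoly n).[t].
pose df t := (1 - t)^-1 - (logpoly n)^`().[t].
have dfE t : t < 1 -> df t = t ^+ n / (1 - t).
  move=> t1; have t10 : 1 - t != 0 by rewrite subr_eq0 gt_eqF.
  have h := deriv_logpoly n t; apply: (mulfI t10).
  by rewrite /df mulrBr h divff// mulrCA divff//; ring.
have fd t : t < 1 -> is_derive t 1 f (df t).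
  move=> t1; have h1 : is_derive t 1 (fun t => 1 - t) (-1 : R).
    have h : is_derive t 1 (cst (1 : R) - id) (0 - 1 : R).
      exact: is_deriveB.
    by rewrite sub0r in h; exact: h.
  have h0 : 0 < 1 - t by rewrite subr_gt0.
  have h2 : is_derive (1 - t) 1 (@ln R) (1 - t)^-1 by exact: is_derive1_ln.
  have h3 := @is_derive1_comp _ (@ln R) (fun t => 1 - t) t _ _ h2 h1.
  have h4 := is_derive_poly (logpoly n) t.
  have h5 := is_deriveB (is_deriveN h3) h4.
  by rewrite mulrN1 opprK in h5; exact: h5.
have fc : {within `[0, y], continuous f}.
  apply: derivable_within_continuous => t; rewrite in_itv /= => /andP[_ ty].
  by apply: ex_derive; apply: fd; exact: le_lt_trans y1.
have fd' t : t \in `]0, y[%R -> is_derive t 1 f (df t).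
  by rewrite in_itv /= => /andP[_ ty]; apply: fd; exact: lt_trans y1.
have [c cI] := MVT_segment y0 fd' fc.
move: cI; rewrite in_itv /= => /andP[c0 cy].
have c1 : c < 1 by exact: le_lt_trans y1.
have f0 : f 0 = 0.
  by rewrite /f subr0 ln1 logpoly_at0 oppr0 addr0.
rewrite (dfE c c1) f0 !subr0 => fy.
have c10 : 0 < 1 - c by rewrite subr_gt0.
have y10 : 0 < 1 - y by rewrite subr_gt0.
rewrite -subr_ge0 -/(f y) fy; split.
  by rewrite mulr_ge0// divr_ge0 ?exprn_ge0 ?(ltW c10).
apply: (@le_trans _ _ (c ^+ n / (1 - c))).
  rewrite ler_piMr ?(ltW y1)// divr_ge0 ?exprn_ge0 ?(ltW c10)//.
apply: ler_pM; rewrite ?exprn_ge0 ?invr_ge0 ?(ltW c10)//.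
  by rewrite lerXn2r ?nnegrE.
by rewrite lef_pV2 ?posrE//; lra.
Qed.

(** Uniformity on a segment survives the limit of the means over the
    fibres. *)
Lemma log_series_uniform y0 (e : R) : 0 <= y0 -> y0 < 1 -> 0 < e ->
  exists n0, forall n y, (n0 <= n)%N -> 0 <= y -> y <= y0 ->
    - ln (1 - y) - (logpoly n).[y] <= e.
Proof.
move=> h0 h1 e0; have y10 : 0 < 1 - y0 by rewrite subr_gt0.
have c : (fun n => y0 ^+ n) @ \oo --> (0 : R).
  by apply: cvg_expr; rewrite ger0_norm.
have := cvgr_le 0 c (e * (1 - y0)).
rewrite mulr_gt0// => /(_ _ isT) [n0 _ hn]; exists n0 => n y nn hy yy0.
have y1 : y < 1 by exact: le_lt_trans h1.
apply: (le_trans (log_series_bounds n hy y1).2).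
apply: (@le_trans _ _ (y0 ^+ n / (1 - y0))).
  apply: ler_pM; rewrite ?exprn_ge0 ?invr_ge0//; last 2 first.
  - by rewrite lerXn2r ?nnegrE.
  - by rewrite lef_pV2 ?posrE//; lra.
  by rewrite subr_ge0 ltW.
by rewrite ler_pdivrMr//; exact: hn.
Qed.

End LogSeries.

(** * Chordal distance and finite rank kernels *)

Section Kernel.
Variable R : realType.
Local Notation C := (cplx R).
Local Notation N := (@Normc.normc R).
Implicit Types (z w : C) (fs gs : seq (C -> R)).

Definition conf z : R := 1 + N z ^+ 2.
Definition lconf z : R := ln (conf z).

Lemma conf_ge1 z : 1 <= conf z.
Proof. by rewrite lerDl exprn_ge0// mod_ge0. Qed.
Lemma conf_gt0 z : 0 < conf z.
Proof. by apply: lt_le_trans (conf_ge1 z). Qed.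
Lemma lipb_conf : lipb conf.
Proof. by apply: lipbD; [exact: lipb_cst|apply: lipbX; exact: lipb_mod]. Qed.
Lemma lipb_lconf : lipb lconf.
Proof. by apply: lipb_ln; [exact: lipb_conf|exact: conf_ge1]. Qed.

(** Finite rank kernels [sum f z * f w] are positive semidefinite by
    construction; they are closed under sums, products and nonnegative
    scalars. *)
Fixpoint all_lipb fs : Prop :=
  if fs is f :: fs' then lipb f /\ all_lipb fs' else True.
Definition ksum fs z w : R := \sum_(f <- fs) f z * f w.
Definition kscale (r : R) fs : seq (C -> R) :=
  [seq (fun z => Num.sqrt r * f z) | f <- fs].
Definition kprod fs gs : seq (C -> R) :=
  flatten [seq [seq (fun z => f z * g z) | g <- gs] | f <- fs].

Lemma all_lipb_cat fs gs : all_lipb fs -> all_lipb gs -> all_lipb (fs ++ gs).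
Proof. by elim: fs => //= f fs IH [hf hfs] hgs; split=> //; exact: IH. Qed.
Lemma all_lipb_kscale r fs : all_lipb fs -> all_lipb (kscale r fs).
Proof. by elim: fs => //= f fs IH [hf hfs]; split; [exact: lipbZ|exact: IH]. Qed.
Lemma all_lipb_kprod fs gs : all_lipb fs -> all_lipb gs ->
  all_lipb (kprod fs gs).
Proof.
move=> + hgs; elim: fs => //= f fs IH [hf hfs]; rewrite /kprod /=.
apply: all_lipb_cat; last exact: IH.
by elim: gs hgs {IH} => //= g gs IH [hg hgs]; split; [exact: lipbM|exact: IH].
Qed.

Lemma ksum_cat fs gs z w : ksum (fs ++ gs) z w = ksum fs z w + ksum gs z w.
Proof. by rewrite /ksum big_cat. Qed.
Lemma ksum_kscale r fs z w : 0 <= r -> ksum (kscale r fs) z w = r * ksum fs z w.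
Proof.
move=> r0; rewrite /ksum big_map mulr_sumr; apply: eq_bigr => f _.
by rewrite mulrACA -expr2 sqr_sqrtr.
Qed.
Lemma ksum_kprod fs gs z w :
  ksum (kprod fs gs) z w = ksum fs z w * ksum gs z w.
Proof.
rewrite /ksum /kprod big_flatten big_map mulr_suml; apply: eq_bigr => f _.
by rewrite big_map mulr_sumr; apply: eq_bigr => g _; rewrite mulrACA.
Qed.

(** Coordinates of the stereographic image of [z] on the unit sphere, together
    with the constant 1. *)
Definition sphere_coords : seq (C -> R) :=
  [:: (fun=> 1); (fun z => 2 * complex.Re z * (conf z)^-1);
      (fun z => 2 * complex.Im z * (conf z)^-1);
      (fun z => (N z ^+ 2 - 1) * (conf z)^-1)].

(** The cosine squared of half the angle between the stereographic images. *)
Definition sker z w : R := ksum (kscale (1 / 2) sphere_coords) z w.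

Fixpoint sker_pow (n : nat) : seq (C -> R) := if n is n'.+1
  then kprod (kscale (1 / 2) sphere_coords) (sker_pow n') else [:: (fun=> 1)].

(** The kernel [logpoly n] of [sker]: the coefficients of the logarithmic
    series are nonnegative, so it is again of finite rank and positive
    semidefinite, and [logker n] is an initial part of [logker n.+1]. *)
Fixpoint logker (n : nat) : seq (C -> R) := if n is n'.+1
  then logker n' ++ kscale (n'.+1%:R^-1) (sker_pow n'.+1) else [::].

Lemma all_lipb_sphere : all_lipb sphere_coords.
Proof.
have hv := lipbV lipb_conf conf_ge1.
split; first exact: lipb_cst.
split; first by apply: lipbM => //; apply: lipbZ; exact: lipb_Re.
split; first by apply: lipbM => //; apply: lipbZ; exact: lipb_Im.
split=> //; apply: lipbM => //; apply: lipbD; last exact: lipb_cst.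
by apply: lipbX; exact: lipb_mod.
Qed.

Lemma all_lipb_sker_pow n : all_lipb (sker_pow n).
Proof.
elim: n => [|n IH]; first by split=> //; exact: lipb_cst.
exact: all_lipb_kprod (all_lipb_kscale _ all_lipb_sphere) IH.
Qed.

Lemma all_lipb_logker n : all_lipb (logker n).
Proof.
elim: n => [//|n IH].
exact: all_lipb_cat IH (all_lipb_kscale _ (all_lipb_sker_pow n.+1)).
Qed.

Lemma ksum_sker_pow n z w : ksum (sker_pow n) z w = sker z w ^+ n.
Proof.
elim: n => [|n IH]; first by rewrite /ksum big_seq1 mulr1 expr0.
by rewrite /= ksum_kprod IH exprS.
Qed.

Lemma ksum_logker n z w : ksum (logker n) z w = (logpoly R n).[sker z w].
Proof.
elim: n => [|n IH]; first by rewrite /ksum big_nil logpoly0.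
rewrite (ksum_cat (logker n) (kscale n.+1%:R^-1 (sker_pow n.+1))) IH logpolyS.
by rewrite ksum_kscale ?invr_ge0// (ksum_sker_pow n.+1) mulrC.
Qed.

(** The square of half the chordal distance of the stereographic images. *)
Lemma sker_chordal z w : 1 - sker z w = N (z - w) ^+ 2 / (conf z * conf w).
Proof.
have cz := conf_gt0 z; have cw := conf_gt0 w.
rewrite /sker ksum_kscale ?divr_ge0// /ksum /sphere_coords !big_cons big_nil.
have hz : conf z = 1 + (complex.Re z ^+ 2 + complex.Im z ^+ 2).
  by rewrite /conf modsq.
have hw : conf w = 1 + (complex.Re w ^+ 2 + complex.Im w ^+ 2).
  by rewrite /conf modsq.
rewrite !modsq; move: hz hw cz cw; move: (conf z) (conf w) => c c'.
case: z w => [x y] [u v] /= -> -> cz cw; field.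
by rewrite !gt_eqF.
Qed.

Lemma sker_ge0 z w : 0 <= sker z w.
Proof.
have cz := conf_gt0 z; have cw := conf_gt0 w.
have -> : sker z w = 1 - (1 - sker z w) by ring.
rewrite sker_chordal subr_ge0 ler_pdivrMr ?mulr_gt0// mul1r /conf !modsq.
case: z w {cz cw} => [x y] [u v] /=; rewrite -subr_ge0.
have -> : (1 + (x ^+ 2 + y ^+ 2)) * (1 + (u ^+ 2 + v ^+ 2)) -
    ((x - u) ^+ 2 + (y - v) ^+ 2) =
    (1 + x * u + y * v) ^+ 2 + (x * v - y * u) ^+ 2 by ring.
by rewrite addr_ge0// sqr_ge0.
Qed.

Lemma sker_lt1 z w : z != w -> sker z w < 1.
Proof.
move=> zw; rewrite -subr_gt0 sker_chordal; apply: divr_gt0.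
  by rewrite exprn_gt0// mod_gt0 subr_eq0.
by apply: mulr_gt0; exact: conf_gt0.
Qed.

Lemma sker_diag z : sker z z = 1.
Proof.
apply/eqP; rewrite -subr_eq0 -oppr_eq0 opprB sker_chordal subrr mod0.
by rewrite expr0n mul0r.
Qed.

Lemma ln_sker z w : z != w ->
  - ln (1 - sker z w) = lconf z + lconf w - 2 * ln (N (z - w)).
Proof.
move=> zw; have n0 : 0 < N (z - w) by rewrite mod_gt0 subr_eq0.
have cz := conf_gt0 z; have cw := conf_gt0 w.
rewrite sker_chordal ln_div ?posrE ?exprn_gt0 ?mulr_gt0//.
rewrite lnM ?posrE// lnXn// -mulr_natl /lconf; lra.
Qed.

End Kernel.

(** * Integrals without measurability *)

Section CrudeIntegral.
Local Open Scope ereal_scope.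
Context d (T : measurableType d) (R : realType).
Variable mu : {measure set T -> \bar R}.
Implicit Types f g : T -> \bar R.

Import HBNNSimple.

(** The integral of a nonnegative function is a supremum over the simple
    functions below it, whatever its measurability. The potential of an unknown
    measure is bounded in this way without a study of its measurability. *)
Lemma le_integral_any f g : (forall x, f x <= g x) ->
  \int[mu]_x f x <= \int[mu]_x g x.
Proof.
have pos u v : (forall x, 0 <= u x) -> (forall x, u x <= v x) ->
    \int[mu]_x u x <= \int[mu]_x v x.
  move=> u0 uv; have v0 x : 0 <= v x by exact: le_trans (uv x).
  rewrite !ge0_integralTE//; apply: ereal_sup_le => _ [h hu <-].
  exists h => // x.
  by apply: (le_trans (hu x)).
move=> fg; rewrite (integralE mu _ f) (integralE mu _ g); apply: leeB.
  by apply: pos => // x; rewrite !funeposE ge_max !le_max fg lexx orbT.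
by apply: pos => // x; rewrite !funenegE ge_max !le_max leeN2 fg lexx orbT.
Qed.

Lemma integral_zero_on (K : set T) f : measurable K -> mu (~` K) = 0 ->
  (forall x, K x -> f x = 0) -> \int[mu]_x f x = 0.
Proof.
move=> mK K0 fK.
have pos u : (forall x, 0 <= u x) -> (forall x, K x -> u x = 0) ->
    \int[mu]_x u x = 0.
  move=> u0 uK; apply/eqP; rewrite eq_le; apply/andP; split; last first.
    exact: integral_ge0.
  rewrite ge0_integralTE//; apply: ge_ereal_sup => _ [h hu <-].
  rewrite -integralT_nnsfun.
  rewrite (ge0_negligible_integral (measurableC mK) measurableT _ _ K0)//.
  - rewrite setTD setCK (eq_integral (cst 0)) ?integral0// => x /set_mem Kx.
    apply/eqP; rewrite eq_le; apply/andP; split; first by rewrite /= -(uK x Kx).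
    by rewrite /= lee_fin.
  - exact/measurable_EFinP.
  - by move=> x _; rewrite lee_fin.
rewrite integralE !pos ?sube0// => x Kx.
  by rewrite funenegE fK// oppe0 maxxx.
by rewrite funeposE fK// maxxx.
Qed.

End CrudeIntegral.

(** * Expectations *)

Section Expectation.
Variable R : realType.
Local Notation C := (cplx R).
Local Notation N := (@Normc.normc R).
Implicit Types (mu nu : probability (borel_cplx R) R) (f g : C -> R) (z w : C).

Definition expect mu f : R := (\int[mu]_z f z)%R.

Definition in_ball mu (M : R) : Prop := mu [set z | N z <= M] = 1%E.

Lemma measurable_le f (M : R) : lipb f ->
  measurable ([set z | f z <= M] : set (borel_cplx R)).
Proof.
move=> /lipb_measurable mf.
rewrite (_ : [set z | _] = f @^-1` `]-oo, M]%classic).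
  by rewrite -[_ @^-1` _]setTI; apply: mf => //; exact: measurable_itv.
by apply/seteqP; split=> z /=; rewrite in_itv.
Qed.

Lemma measurable_ball M : measurable ([set z | N z <= M] : set (borel_cplx R)).
Proof. by apply: measurable_le; exact: lipb_mod. Qed.

Lemma full_measure0 mu (K : set (borel_cplx R)) : measurable K -> mu K = 1%E ->
  mu (~` K) = 0%E.
Proof. by move=> mK K1; rewrite probability_setC// K1 subee. Qed.

Lemma lipb_integrable mu M f : in_ball mu M -> lipb f ->
  mu.-integrable setT (EFin \o f).
Proof.
move=> hM hf; have mf := lipb_measurable hf; have mB := measurable_ball M.
apply/(negligible_integrable (measurableC mB) measurableT _
  (full_measure0 mB hM)); first exact/measurable_EFinP.
rewrite setTD setCK; apply: measurable_bounded_integrable => //.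
- by apply: (le_lt_trans (probability_le1 mu mB)); rewrite ltry.
- exact: measurable_funS mf.
have [K K0 hK] := lipb_bounded M hf.
exists K; split; first exact: num_real.
by move=> x Kx z zM /=; apply: (le_trans (hK z zM)); exact: ltW.
Qed.

Lemma expectE mu M f : in_ball mu M -> lipb f ->
  (\int[mu]_z (f z)%:E)%E = (expect mu f)%:E.
Proof.
move=> hM hf; rewrite /expect /Rintegral fineK//.
by apply: integrable_fin_num => //; exact: lipb_integrable hM hf.
Qed.

Lemma expectD mu M f g : in_ball mu M -> lipb f -> lipb g ->
  expect mu (fun z => f z + g z) = expect mu f + expect mu g.
Proof. by move=> hM *; apply: RintegralD => //; exact: lipb_integrable hM _. Qed.

Lemma expectZ mu M (c : R) f : in_ball mu M -> lipb f ->
  expect mu (fun z => c * f z) = c * expect mu f.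
Proof. by move=> hM *; apply: RintegralZl => //; exact: lipb_integrable hM _. Qed.

Lemma expect_cst mu (c : R) : expect mu (fun=> c) = c.
Proof.
rewrite /expect Rintegral_cst// [X in fine X](_ : _ = 1%E) ?mulr1//.
exact: (probability_setT mu).
Qed.

Lemma expect_le mu M f g : in_ball mu M -> lipb f -> lipb g ->
  (forall z, f z <= g z) -> expect mu f <= expect mu g.
Proof.
by move=> hM *; apply: le_Rintegral => //; exact: lipb_integrable hM _.
Qed.

(** The limit is prescribed on [K] only because the potentials of interest have
    another limit outside the filled Julia set. *)
Lemma expect_mct mu M (K : set (borel_cplx R)) (f : nat -> C -> R) g :
  in_ball mu M -> measurable K -> mu K = 1%E ->
  (forall n, lipb (f n)) -> lipb g -> (forall n z, 0 <= f n z) ->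
  (forall m n z, (m <= n)%N -> f m z <= f n z) ->
  (forall z, K z -> (fun n => f n z) @ \oo --> g z) ->
  (fun n => expect mu (f n)) @ \oo --> expect mu g.
Proof.
move=> hM mK K1 hf hg f0 fnd fg.
have mf n : measurable_fun [set: borel_cplx R] (fun z => (f n z)%:E).
  by apply/measurable_EFinP; exact: lipb_measurable.
have := @cvg_monotone_convergence _ _ _ mu setT measurableT
  (fun n z => (f n z)%:E) mf.
have f0' n (x : borel_cplx R) : [set: borel_cplx R] x -> (0 <= (f n x)%:E)%E.
  by rewrite lee_fin.
have fnd' (x : borel_cplx R) : [set: borel_cplx R] x ->
    nondecreasing_seq (fun n => (f n x)%:E).
  by move=> _ m n mn; rewrite lee_fin fnd.
move=> /(_ f0' fnd').
under eq_fun do rewrite (expectE hM (hf _)).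
have -> : (\int[mu]_x limn (fun n => (f n x)%:E))%E = (expect mu g)%:E.
  rewrite -(expectE hM hg); apply: ae_eq_integral => //.
  - apply: emeasurable_fun_cvg mf _ => x _.
    by apply: ereal_nondecreasing_is_cvgn => m n mn; rewrite lee_fin fnd.
  - by apply/measurable_EFinP; exact: lipb_measurable.
  exists (~` K); split; [exact: measurableC|exact: full_measure0|].
  move=> z /= h Kz; apply: h => _; apply: cvg_lim => //.
  by apply: cvg_EFin; [exact: nearW|exact: fg].
by move/fine_cvg.
Qed.

End Expectation.

(** * Energy and the equilibrium potential *)

Section Energy.
Variable R : realType.
Local Notation C := (cplx R).
Local Notation N := (@Normc.normc R).
Implicit Types (mu nu : probability (borel_cplx R) R) (f g : C -> R) (z w : C).
Implicit Types (fs : seq (C -> R)).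

(** The potential of [mu] for the kernel [ksum fs]. *)
Definition moment mu fs z : R := \sum_(f <- fs) f z * expect mu f.
Definition mutual mu nu fs : R := \sum_(f <- fs) expect mu f * expect nu f.
(** The squared distance of two measures for the kernel [ksum fs]. *)
Definition gap mu nu fs : R := \sum_(f <- fs) (expect mu f - expect nu f) ^+ 2.

Lemma lipb_ksum fs z : all_lipb fs -> lipb (ksum fs z).
Proof.
rewrite /ksum; elim: fs => [_|f fs IH [hf hfs]].
  by under eq_fun do rewrite big_nil; exact: lipb_cst.
under eq_fun do rewrite big_cons.
by apply: lipbD; [exact: lipbZ|exact: IH].
Qed.

Lemma lipb_moment mu fs : all_lipb fs -> lipb (moment mu fs).
Proof.
rewrite /moment; elim: fs => [_|f fs IH [hf hfs]].
  by under eq_fun do rewrite big_nil; exact: lipb_cst.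
under eq_fun do rewrite big_cons.
by apply: lipbD; [apply: lipbM => //; exact: lipb_cst|exact: IH].
Qed.

Lemma expect_ksum mu M fs z : in_ball mu M -> all_lipb fs ->
  expect mu (ksum fs z) = moment mu fs z.
Proof.
move=> hM; rewrite /ksum /moment; elim: fs => [_|f fs IH [hf hfs]].
  by under eq_fun do rewrite big_nil; rewrite big_nil expect_cst.
under eq_fun do rewrite big_cons.
rewrite big_cons (expectD hM) ?(expectZ _ hM) ?IH//; first exact: lipbZ.
exact: lipb_ksum.
Qed.

Lemma expect_moment mu nu M fs : in_ball nu M -> all_lipb fs ->
  expect nu (moment mu fs) = mutual nu mu fs.
Proof.
move=> hM; rewrite /moment /mutual; elim: fs => [_|f fs IH [hf hfs]].
  by under eq_fun do rewrite big_nil; rewrite big_nil expect_cst.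
under eq_fun do rewrite big_cons.
have e : (fun z => f z * expect mu f) = (fun z => expect mu f * f z).
  by apply/funext => z; rewrite mulrC.
rewrite big_cons (expectD hM) ?IH//.
- by rewrite e (expectZ _ hM)// mulrC.
- by rewrite e; exact: lipbZ.
- exact: lipb_moment.
Qed.

Lemma mutualC mu nu fs : mutual mu nu fs = mutual nu mu fs.
Proof. by apply: eq_bigr => f _; rewrite mulrC. Qed.

Lemma gapE mu nu fs :
  gap mu nu fs = mutual mu mu fs + mutual nu nu fs - 2 * mutual mu nu fs.
Proof.
rewrite /gap /mutual mulr_sumr -big_split -sumrB /=.
by apply: eq_bigr => f _; ring.
Qed.

Lemma gap_ge0 mu nu fs : 0 <= gap mu nu fs.
Proof. by apply: sumr_ge0 => f _; exact: sqr_ge0. Qed.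

Lemma gap0_moment mu nu fs z : gap mu nu fs = 0 ->
  moment mu fs z = moment nu fs z.
Proof.
rewrite /gap /moment; elim: fs => [|f fs IH]; first by rewrite !big_nil.
rewrite !big_cons => /eqP; rewrite paddr_eq0 ?sqr_ge0 ?gap_ge0//.
by rewrite sqrf_eq0 subr_eq0 => /andP[/eqP -> /eqP /IH ->].
Qed.

Local Notation U mu n z := (moment mu (logker R n) z).

Lemma moment_logker mu M n z : in_ball mu M ->
  U mu n z = expect mu (fun w => (logpoly R n).[sker z w]).
Proof.
move=> hM; rewrite -(expect_ksum _ hM); last exact: all_lipb_logker.
by congr expect; apply/funext => w; rewrite ksum_logker.
Qed.

Lemma lipb_logpoly n z : lipb (fun w => (logpoly R n).[sker z w]).
Proof.
rewrite (_ : (fun w => _) = ksum (logker R n) z).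
  by apply: lipb_ksum; exact: all_lipb_logker.
by apply/funext => w; rewrite ksum_logker.
Qed.

Lemma moment_logker_nd mu M m n z : in_ball mu M -> (m <= n)%N ->
  U mu m z <= U mu n z.
Proof.
move=> hM mn; rewrite !(moment_logker _ _ hM).
apply: (expect_le hM); [exact: lipb_logpoly|exact: lipb_logpoly|move=> w].
by apply: logpoly_nd => //; exact: sker_ge0.
Qed.

Lemma moment_logker_ge0 mu M n z : in_ball mu M -> 0 <= U mu n z.
Proof.
move=> hM; rewrite (moment_logker _ _ hM) -(expect_cst mu 0).
apply: (expect_le hM); [exact: lipb_cst|exact: lipb_logpoly|move=> w].
by apply: logpoly_ge0; exact: sker_ge0.
Qed.

(** Partial sums of the logarithmic series are below its sum. *)
Lemma log_dist_le n z w :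
  (log_dist z w <= ((lconf z + lconf w - (logpoly R n).[sker z w]) / 2)%:E)%E.
Proof.
rewrite /log_dist; have [->|zw] := eqVneq z w.
  by rewrite subrr mod0 le0_lneNy// leNye.
rewrite lne_EFin ?mod_gt0 ?subr_eq0// lee_fin ler_pdivlMr//.
have := (log_series_bounds n (sker_ge0 z w) (sker_lt1 zw)).1.
by rewrite ln_sker//; lra.
Qed.

(** Twice the logarithm of [N (z - w)] is [lconf z + lconf w] minus the sum of
    the logarithmic series at [sker z w], also on the diagonal, where both are
    infinite; the integral of the series is a monotone limit. *)
Lemma log_potential_lim mu M z (x : R) : in_ball mu M ->
  (fun n => U mu n z) @ \oo --> x ->
  log_potential mu z = ((lconf z + expect mu (@lconf R) - x) / 2)%:E.
Proof.
move=> hM hx.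
pose f n (w : C) := (logpoly R n).[sker z w].
pose D (w : C) : \bar R := limn (fun n => (f n w)%:E).
have nd w : nondecreasing_seq (fun n => (f n w)%:E).
  by move=> m n mn; rewrite lee_fin logpoly_nd// sker_ge0.
have mf n : measurable_fun [set: borel_cplx R] (fun w => (f n w)%:E).
  by apply/measurable_EFinP; apply: lipb_measurable; exact: lipb_logpoly.
have mD : measurable_fun [set: borel_cplx R] (D : borel_cplx R -> \bar R).
  apply: emeasurable_fun_cvg mf _ => w _.
  exact: ereal_nondecreasing_is_cvgn.
have D0 w : (0 <= D w)%E.
  apply: lime_ge; first exact: ereal_nondecreasing_is_cvgn.
  by apply: nearW => n; rewrite lee_fin logpoly_ge0// sker_ge0.
have f0 n (w : borel_cplx R) : [set: borel_cplx R] w -> (0 <= (f n w)%:E)%E.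
  by move=> _; rewrite lee_fin logpoly_ge0// sker_ge0.
have ID : (\int[mu]_w D w)%E = x%:E.
  rewrite (monotone_convergence mu measurableT mf f0 (fun w _ => nd w)).
  apply: cvg_lim => //.
  under eq_fun do rewrite (expectE hM (lipb_logpoly _ z)) -(moment_logker _ _ hM).
  by apply: cvg_EFin => //; exact: nearW.
have iD : mu.-integrable setT (D : borel_cplx R -> \bar R).
  apply/integrableP; split=> //.
  under eq_integral do rewrite gee0_abs//.
  by rewrite ID ltry.
have dE w : log_dist z w =
    (((lconf z + lconf w) / 2)%R%:E - (2^-1)%R%:E * D w)%E.
  rewrite /log_dist; have [e|zw] := eqVneq z w.
    rewrite -e subrr mod0 le0_lneNy//.
    (* on the diagonal [sker] is 1 and the series diverges *)
    have -> : D z = +oo%E.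
      apply/eqyP => A A0; have hA : 0 <= 1 - expR (- (A + 1)) < 1.
        have e1 : expR (- (A + 1)) <= 1 by rewrite -[leRHS]expR0 ler_expR; lra.
        by have := expR_gt0 (- (A + 1)); move=> ?; apply/andP; split; lra.
      case/andP: hA => h0 h1.
      have [n hn] := log_series_uniform h0 h1 ltr01.
      have := hn n _ (leqnn n) h0 (lexx _); rewrite opprB addrCA subrr addr0.
      rewrite expRK opprK => h2.
      apply: (@le_trans _ _ (f n z)%:E).
        rewrite lee_fin /f sker_diag.
        have := logpoly_mono n h0 (ltW h1); lra.
      apply: lime_ge; first exact: ereal_nondecreasing_is_cvgn.
      by exists n => // m /= nm; exact: nd.
    by rewrite mulry gtr0_sg ?invr_gt0// mul1e.
  rewrite lne_EFin ?mod_gt0 ?subr_eq0//.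
  have -> : D w = (- ln (1 - sker z w))%:E.
    apply: cvg_lim => //; apply: cvg_EFin; first exact: nearW.
    have s0 := sker_ge0 z w; have s1 := sker_lt1 zw.
    apply/cvgrPdist_le => e e0.
    have [n0 hn] := log_series_uniform s0 s1 e0.
    exists n0 => // n /= nn; have := hn n _ nn s0 (lexx _).
    have := (log_series_bounds n s0 s1).1.
    by rewrite /f /= ler_norml; lra.
  by rewrite ln_sker// -EFinM -EFinB; congr EFin; field.
rewrite /log_potential; under eq_integral do rewrite dE.
have hl : lipb (fun w => (lconf z + lconf w) / 2).
  rewrite (_ : (fun w => _) = (fun w => 2^-1 * (lconf z + lconf w))).
    by apply: lipbZ; apply: lipbD; [exact: lipb_cst|exact: lipb_lconf].
  by apply/funext => w; rewrite mulrC.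
have il := lipb_integrable hM hl.
have iD2 : mu.-integrable setT
    (fun w : borel_cplx R => (2^-1)%:E * D w)%E.
  exact: integrableZl.
rewrite integralB// integralZl// ID (expectE hM hl) -EFinM -EFinB; congr EFin.
rewrite (_ : (fun w => (lconf z + lconf w) / 2) =
    (fun w => 2^-1 * (lconf z + lconf w))); last first.
  by apply/funext => w; rewrite mulrC.
rewrite (expectZ _ hM); last by apply: lipbD; [exact: lipb_cst|exact: lipb_lconf].
rewrite (expectD hM) ?expect_cst; [by field|exact: lipb_cst|exact: lipb_lconf].
Qed.

(** Truncation of the series bounds the energy from above by expectations of
    locally Lipschitz functions, whatever the measure. *)
Lemma log_energy_le mu M n : in_ball mu M ->
  (log_energy mu <=
    (expect mu (@lconf R) - mutual mu mu (logker R n) / 2)%:E)%E.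
Proof.
move=> hM; have ll := @lipb_lconf R.
have hU := lipb_moment mu (@all_lipb_logker R n).
have h1 z : (log_potential mu z <=
    (2^-1 * (lconf z + (expect mu (@lconf R) + -1 * U mu n z)))%:E)%E.
  apply: (le_trans (le_integral_any mu (fun w => log_dist_le n z w))).
  have hl := lipb_logpoly n z.
  have h2 := lipbZ (-1) hl; have h3 := lipbD ll h2.
  have h4 := lipbD (lipb_cst (lconf z)) h3.
  have -> : (\int[mu]_w
      ((lconf z + lconf w - (logpoly R n).[sker z w]) / 2)%:E)%E =
    (expect mu (fun w => 2^-1 *
      (lconf z + (lconf w + -1 * (logpoly R n).[sker z w]))))%:E.
    rewrite -(expectE hM (lipbZ _ h4)); apply: eq_integral => w _.
    by congr EFin; field.
  rewrite lee_fin (expectZ _ hM h4).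
  rewrite (expectD hM (lipb_cst _) h3) expect_cst (expectD hM ll h2).
  by rewrite (expectZ _ hM hl) -(moment_logker _ _ hM).
apply: (le_trans (le_integral_any mu h1)).
have h2 := lipbZ (-1) hU; have h3 := lipbD (lipb_cst (expect mu (@lconf R))) h2.
have h4 := lipbD ll h3.
rewrite (expectE hM (lipbZ _ h4)) lee_fin (expectZ _ hM h4).
rewrite (expectD hM ll h3) (expectD hM (lipb_cst _) h2) expect_cst.
rewrite (expectZ _ hM hU) (expect_moment _ hM); last exact: all_lipb_logker.
by rewrite le_eqVlt; apply/orP; left; apply/eqP; field.
Qed.

(** The potential of [nu] vanishes on [K], so the energy of [nu] is 0 and that
    of [mu] at least 0; hence the limit of the gaps between [mu] and [nu] is
    nonpositive. But the gap is a sum of squares that increases with the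
    kernel, so it vanishes, [mu] has all the moments of [nu], and the two
    potentials agree. *)
Lemma equilibrium_potential mu nu (M : R) (K : set C) :
  measurable (K : set (borel_cplx R)) -> K `<=` [set z | N z <= M] ->
  equilibrium_measure K mu -> nu K = 1%E ->
  (forall z, K z ->
     (fun n => U nu n z) @ \oo --> lconf z + expect nu (@lconf R)) ->
  forall z (x : R), (fun n => U nu n z) @ \oo -->
      lconf z + expect nu (@lconf R) - 2 * x -> green_function mu z = x.
Proof.
move=> mK KM [mu1 mumax] nu1 hnu.
have ball (m : probability (borel_cplx R) R) : m K = 1%E -> in_ball m M.
  move=> m1; apply/eqP; rewrite eq_le; apply/andP; split.
    exact: probability_le1 (measurable_ball M).
  apply: (@le_trans _ _ (m K)); first by rewrite m1.
  by apply: le_measure; rewrite ?inE//; exact: measurable_ball.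
have hM := ball mu mu1; have hM' := ball nu nu1.
set a := expect mu (@lconf R); set b := expect nu (@lconf R).
have K0 (m : probability (borel_cplx R) R) : m K = 1%E -> m (~` K) = 0%E.
  exact: full_measure0.
have pot0 z : K z -> log_potential nu z = 0%E.
  by move=> Kz; rewrite (log_potential_lim hM' (hnu z Kz)) subrr mul0r.
have Inu : log_energy nu = 0%E.
  exact: integral_zero_on mK (K0 _ nu1) pot0.
have Emu n : mutual mu mu (logker R n) <= 2 * a.
  have := le_trans (mumax nu nu1) (log_energy_le n hM).
  by rewrite Inu lee_fin -/a; lra.
have ll := @lipb_lconf R.
have lim_mut (m : probability (borel_cplx R) R) : m K = 1%E ->
   (fun n => mutual m nu (logker R n)) @ \oo --> expect m (@lconf R) + b.
  move=> m1; have hm := ball m m1.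
  have h := @expect_mct R m M K (fun n => moment nu (logker R n))
    (fun z => lconf z + b) hm mK m1.
  have e : expect m (fun z => lconf z + b) = expect m (@lconf R) + b.
    by rewrite (expectD hm ll (lipb_cst _)) expect_cst.
  rewrite e in h; under eq_fun do
    rewrite -(expect_moment nu hm (@all_lipb_logker R _)).
  apply: h => //.
  - by move=> n; apply: lipb_moment; exact: all_lipb_logker.
  - exact: lipbD ll (lipb_cst _).
  - by move=> n z; exact: moment_logker_ge0 hM'.
  - by move=> i j z; exact: moment_logker_nd hM'.
have lim_mu := lim_mut mu mu1; have lim_nu := lim_mut nu nu1.
rewrite -/a in lim_mu; rewrite -/b in lim_nu.
have mut_nd n : mutual nu nu (logker R n) <= b + b.
  have nd : nondecreasing_seq (fun n => mutual nu nu (logker R n)).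
    apply/nondecreasing_seqP => k; rewrite /mutual big_cat /= lerDl.
    by apply: sumr_ge0 => f _; rewrite -expr2 sqr_ge0.
  have := nondecreasing_cvgn_le nd (cvgP _ lim_nu) n.
  by rewrite (cvg_lim _ lim_nu).
(* the gap at [n] is at most the gap at a late index, which is at most [e] *)
have gap0 n : gap mu nu (logker R n) = 0.
  apply/eqP; rewrite eq_le gap_ge0 andbT.
  have gnd m k : (m <= k)%N -> gap mu nu (logker R m) <= gap mu nu (logker R k).
    move=> /subnK <-; elim: (k - m)%N => [|j IH]; first by rewrite add0n.
    apply: (le_trans IH); rewrite addSn /gap big_cat /= lerDl.
    by apply: sumr_ge0 => f _; exact: sqr_ge0.
  apply/ler_addgt0Pr => e e0; rewrite add0r.
  have e20 : 0 < e / 2 by rewrite divr_gt0.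
  have /cvgrPdist_le /(_ _ e20) [n1 _ hn1] := lim_mu.
  have := hn1 (maxn n n1) (leq_maxr _ _); rewrite /= ler_norml => /andP[_ h].
  apply: (le_trans (gnd n (maxn n n1) (leq_maxl _ _))); rewrite gapE.
  by have := Emu (maxn n n1); have := mut_nd (maxn n n1); lra.
have momE n z : U mu n z = U nu n z by exact: gap0_moment.
have ab : a = b.
  have : (fun n => mutual mu nu (logker R n)) @ \oo --> b + b.
    under eq_fun do rewrite mutualC
      -(expect_moment mu hM' (@all_lipb_logker R _)).
    rewrite (_ : (fun n => _) = (fun n => mutual nu nu (logker R n)))//.
    apply/funext => n; rewrite -(expect_moment nu hM' (@all_lipb_logker R _)).
    by congr expect; apply/funext => z; exact: momE.
  by move=> /(cvg_unique (@Rhausdorff R) lim_mu) /addIr.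
have potE z x : (fun n => U nu n z) @ \oo --> lconf z + b - 2 * x ->
    log_potential mu z = x%:E.
  move=> h; rewrite (log_potential_lim hM (x := lconf z + b - 2 * x)).
    by rewrite -/a ab; congr EFin; field.
  by under eq_fun do rewrite momE.
have Imu : log_energy mu = 0%E.
  apply: (integral_zero_on mK (K0 _ mu1)) => z Kz.
  by apply: potE; rewrite mulr0 subr0; exact: hnu.
by move=> z x hx; rewrite /green_function (potE z x hx) Imu sube0.
Qed.

End Energy.

(** * The balanced measure of a polynomial *)

Section Brolin.
Variable R : realType.
Local Notation C := (cplx R).
Local Notation N := (@Normc.normc R).
Implicit Types (z w a : C).

(** The circles of Jensen's formula have to avoid finitely many roots. *)
Lemma avoid_list (l : seq R) (x y : R) : x < y ->
  exists2 t, x < t < y & t \notin l.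
Proof.
elim: l x y => [|u l IH] x y xy.
  by exists ((x + y) / 2) => //; apply/andP; split; lra.
have [/andP[xu uy]|h] := boolP (x < u < y).
  have [t /andP[xt tu] tl] := IH x u xu; exists t.
    by apply/andP; split; [|exact: lt_trans uy].
  by rewrite inE negb_or tl andbT lt_eqF.
have [t txy tl] := IH x y xy; exists t => //.
rewrite inE negb_or tl andbT; apply/eqP => tu; by rewrite -tu txy in h.
Qed.

Lemma ln_prod (s : seq C) (f : C -> R) : (forall a, a \in s -> 0 < f a) ->
  ln (\prod_(a <- s) f a) = \sum_(a <- s) ln (f a).
Proof.
elim: s => [|a s IH] h; first by rewrite !big_nil ln1.
have ha := h a (mem_head _ _).
have hs b : b \in s -> 0 < f b by move=> bs; rewrite h// inE bs orbT.
rewrite !big_cons lnM ?posrE// ?IH//.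
by rewrite big_seq; apply: prodr_gt0.
Qed.

(** Cutting off the logarithm at distance [rho] makes the convergence of the
    finite rank kernels uniform. *)
Lemma logpoly_ge_cutoff z (B rho e : R) : 0 < rho -> rho <= 1 -> 0 < e ->
  exists n0, forall n w, (n0 <= n)%N -> N w <= B ->
    lconf z + lconf w - 2 * ln (Num.max rho (N (w - z))) - e
      <= (logpoly R n).[sker z w].
Proof.
move=> rho0 rho1 e0; pose A := conf z * (1 + B ^+ 2).
have cz := conf_ge1 z.
have B2 : 0 <= B ^+ 2 by exact: sqr_ge0.
have A1 : 1 <= A by rewrite mulr_ege1// lerDl.
have A0 : 0 < A by lra.
have r2 : 0 < rho ^+ 2 by rewrite exprn_gt0.
have r21 : rho ^+ 2 <= 1 by rewrite exprn_ile1// ltW.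
pose y0 := 1 - rho ^+ 2 / A.
have h0 : 0 <= y0 by rewrite subr_ge0 ler_pdivrMr// mul1r (le_trans r21).
have h1 : y0 < 1 by rewrite ltrBlDr ltrDl divr_gt0.
have [n0 hn] := log_series_uniform h0 h1 e0.
exists n0 => n w nn wB; set s := sker z w.
have s0 : 0 <= s by exact: sker_ge0.
pose m := Num.min s y0.
have m0 : 0 <= m by rewrite le_min s0.
have my : m <= y0 by rewrite ge_min lexx orbT.
have ms : m <= s by rewrite ge_min lexx.
apply: le_trans (logpoly_mono n m0 ms).
have := hn n m nn m0 my.
suff : lconf z + lconf w - 2 * ln (Num.max rho (N (w - z))) <= - ln (1 - m).
  by lra.
have cw := conf_gt0 w; have cz0 := conf_gt0 z.
set x := Num.max _ _; have x0 : 0 < x by rewrite lt_max rho0.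
have xw : N (w - z) <= x by rewrite /x le_max lexx orbT.
have xrho : rho <= x by rewrite /x le_max lexx.
have m1 : 0 < 1 - m by rewrite subr_gt0; exact: le_lt_trans h1.
have key : (1 - m) * (conf z * conf w) <= x ^+ 2.
  have [sy|ys] := leP s y0.
    rewrite /m min_l// sker_chordal divfK ?gt_eqF ?mulr_gt0//.
    by rewrite modC lerXn2r ?nnegrE ?mod_ge0 ?(ltW x0).
  rewrite /m min_r ?(ltW ys)// /y0 opprB addrCA subrr addr0.
  apply: (@le_trans _ _ (rho ^+ 2)).
    rewrite mulrAC ler_pdivrMr// ler_wpM2l ?(ltW r2)//.
    rewrite /A ler_wpM2l ?(ltW cz0)// lerD2l lerXn2r ?nnegrE ?mod_ge0//.
    exact: le_trans (mod_ge0 w) wB.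
  by rewrite lerXn2r ?nnegrE ?(ltW x0) ?(ltW rho0).
have : ln ((1 - m) * (conf z * conf w)) <= ln (x ^+ 2).
  by rewrite ler_ln ?posrE ?exprn_gt0// !mulr_gt0.
rewrite lnXn// !lnM ?posrE ?mulr_gt0// -mulr_natl /lconf; lra.
Qed.

Section Fibres.
Variables (P : {poly C}) (d : nat) (r : R) (fib : nat -> seq C).
Hypotheses (Pm : P \is monic) (sP : size P = d.+1) (d1 : (1 < d)%N).
Hypothesis er : escape_radius P r.
Let c : R := r + 1.
Hypothesis fibE : forall k, poly_iter P k - (c%:C%C)%:P = rootpoly (fib k).
Hypothesis fib_size : forall k, size (fib k) = (d ^ k)%N.
Hypothesis fibP : forall k a, a \in fib k ->
  (poly_iter P k).[a] = c%:C%C /\ N a <= c.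

Let c0 : 0 < c. Proof. by have := er.1; rewrite /c; lra. Qed.
Let fib_gt0 k : (0 < size (fib k))%N.
Proof. by rewrite fib_size expn_gt0 (ltnW d1). Qed.

Lemma fib_iter_le j k a : (j <= k)%N -> a \in fib k ->
  N (poly_iter P j).[a] <= c.
Proof.
move=> jk /fibP [qa _]; rewrite leNgt; apply/negP => h.
have rc : r < N (poly_iter P j).[a] by apply: lt_trans h; rewrite ltrDl.
have := escape_ge (k - j) er rc; rewrite -poly_iterD_horner subnK// qa.
by rewrite mod_real gtr0_norm// leNgt h.
Qed.

(** Around [z] the iterates exceed [c] from some index on, and a point of a
    fibre is sent to [c]. *)
Lemma fib_away z : basin_infty P z -> exists2 e, 0 < e &
  exists k0, forall k w a, (k0 <= k)%N -> N (w - z) < e -> a \in fib k ->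
    e <= N (w - a).
Proof.
move=> Oz; have [e e0 [k0 h]] := basin_local c er Oz.
exists (e / 2); first by rewrite divr_gt0.
exists k0 => k w a kk hw ak; rewrite leNgt; apply/negP => ha.
have : N (a - z) < e.
  have := modD (a - w) (w - z); rewrite addrA subrK (modC a w); lra.
by move=> /(h k a kk); rewrite (fibP ak).1 mod_real gtr0_norm// ltxx.
Qed.

Lemma avg_ln_fib k z : (forall a, a \in fib k -> z != a) ->
  avg (fib k) (fun a => ln (N (z - a))) =
  ln (N ((poly_iter P k).[z] - c%:C%C)) / (d ^ k)%:R.
Proof.
move=> h; rewrite /avg fib_size -ln_prod => [|a /h za].
  rewrite -mod_prod -horner_rootpoly -fibE hornerD hornerN hornerC//.
by rewrite mod_gt0 subr_eq0.
Qed.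

Let K := filled_julia P.

(** On the filled Julia set the iterates have modulus at most [r], hence lie at
    distance at least 1 from [c = r + 1]. *)
Lemma julia_avg_ln_ge0 k z : K z ->
  (forall a, a \in fib k -> z != a) /\
  0 <= avg (fib k) (fun a => ln (N (z - a))).
Proof.
move=> Kz; have hq := (filled_juliaP z er).1 Kz k.
have h1 : 1 <= N ((poly_iter P k).[z] - c%:C%C).
  have := mod_tri (c%:C%C) (poly_iter P k).[z].
  by rewrite mod_real gtr0_norm// modC /c; lra.
have za a : a \in fib k -> z != a.
  move=> /fibP [qa _]; apply/eqP => e; move: h1.
  by rewrite e qa subrr mod0; lra.
by split=> //; rewrite avg_ln_fib// divr_ge0// ln_ge0.
Qed.

(** By Jensen's formula the cut-off means are at most the normalized logarithm
    of the supremum of [poly_iter P k - c] over a small circle. If [j] steps do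
    not take the circle out of the disc of radius [c], then [poly_growth] for
    the last [k - j] steps bounds this by a constant over [d ^ j]. *)
Lemma julia_avg_cutoff z (eta : R) : K z -> 0 < eta ->
  exists2 rho, 0 < rho <= 1 & exists k0, forall k, (k0 <= k)%N ->
    avg (fib k) (fun a => ln (Num.max rho (N (a - z)))) <= eta.
Proof.
move=> Kz eta0; have r1 := er.1.
have [A A1 hA] := poly_growth Pm sP d1.
have c1 : 1 <= c by rewrite /c; lra.
pose X := ln 2 + ln (A * c).
have X0 : 0 <= X by rewrite addr_ge0// ln_ge0 ?mulr_ege1// ler1n.
(* [j] is chosen first, then a circle that [j] steps keep in the disc *)
have [j hj] := nat_unbounded (X / eta) d1.
have {hj} := hj j (leqnn j); rewrite ler_pdivrMr// => hj.
have [L L0 hL] := poly_lipschitz (poly_iter P j) (N z + 2).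
have L1 : 0 < L + 1 by lra.
pose rho := Num.min 1 ((2 * (L + 1))^-1).
have rho0 : 0 < rho by rewrite lt_min ltr01 invr_gt0 mulr_gt0.
have rho1 : rho <= 1 by rewrite ge_min lexx.
have rhoL : 2 * rho * (L + 1) <= 1.
  have : rho <= (2 * (L + 1))^-1 by rewrite ge_min lexx orbT.
  rewrite -(ler_pM2r (_ : 0 < 2 * (L + 1))) ?mulr_gt0// mulVf ?gt_eqF ?mulr_gt0//.
  lra.
have small w : N (w - z) <= 2 * rho -> N (poly_iter P j).[w] <= c.
  move=> hw; have wB : N w <= N z + 2.
    by rewrite -{1}(subrK z w); have := modD (w - z) z; lra.
  have zB : N z <= N z + 2 by rewrite lerDl.
  have h1 := hL w z wB zB; have h2 := mod_tri (poly_iter P j).[w] (poly_iter P j).[z].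
  have h3 := (filled_juliaP z er).1 Kz j.
  have h4 := mod_ge0 (w - z).
  have h5 : L * N (w - z) <= (L + 1) * (2 * rho).
    by apply: ler_pM => //; lra.
  rewrite /c; lra.
exists rho; first by rewrite rho0.
exists j => k jk.
have rho2 : rho < 2 * rho by lra.
have [t /andP[rt t2] tl] := avoid_list [seq N (a - z) | a <- fib k] rho2.
have t0 : 0 < t by exact: lt_trans rt.
pose S := 2 * (A * c) ^+ (d ^ (k - j)).
have Ac1 : 1 <= A * c by exact: mulr_ege1.
have p1 : 1 <= (A * c) ^+ (d ^ (k - j)) by exact: exprn_ege1.
have S0 : 0 < S by rewrite mulr_gt0//; lra.
have sup w : N (w - z) = t -> N (rootpoly (fib k)).[w] <= S.
  move=> hw; rewrite -fibE hornerD hornerN hornerC.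
  have hj' : N (poly_iter P j).[w] <= c by apply: small; lra.
  have := hA c _ (k - j)%N c1 hj'; rewrite -poly_iterD_horner subnK// => h1.
  have := modB (poly_iter P k).[w] c%:C%C; rewrite mod_real gtr0_norm//.
  have : c <= (A * c) ^+ (d ^ (k - j)).
    apply: (@le_trans _ _ (A * c)); first by rewrite ler_peMl// ltW.
    by rewrite ler_eXnr// expn_gt0 (ltnW d1).
  rewrite /S; lra.
have tne a : a \in fib k -> N (a - z) != t.
  by move=> ak; apply: contraNneq tl => <-; apply: map_f.
have hM := mahler_le_sup t0 (ltW S0) tne sup.
have dk0 : 0 < (d ^ k)%:R :> R by rewrite ltr0n expn_gt0 (ltnW d1).
rewrite /avg fib_size ler_pdivrMr//.
apply: (@le_trans _ _ (ln (mahler (fib k) z t))).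
  rewrite /mahler ln_prod; last by move=> a _; rewrite lt_max t0.
  apply: ler_sum => a _; rewrite ler_ln ?posrE ?lt_max ?rho0 ?t0//.
  by rewrite ge_max !le_max lexx orbT (ltW rt).
apply: (@le_trans _ _ (ln S)).
  by rewrite ler_ln ?posrE ?mahler_gt0.
rewrite /S lnM ?posrE ?exprn_gt0//; last by lra.
rewrite lnXn; last by lra.
have lnAc : 0 <= ln (A * c) by exact: ln_ge0.
have ln2 : 0 <= ln 2 :> R by rewrite ln_ge0// ler1n.
have kj : (d ^ k)%:R = (d ^ (k - j))%:R * (d ^ j)%:R :> R.
  by rewrite -natrM -expnD subnK.
have d' : 1 <= (d ^ (k - j))%:R :> R by rewrite ler1n expn_gt0 (ltnW d1).
rewrite -(mulr_natl (ln (A * c))) kj [leRHS]mulrCA.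
apply: (@le_trans _ _ ((d ^ (k - j))%:R * X)).
  by rewrite /X [leRHS]mulrDr lerD2r ler_peMl.
by rewrite ler_wpM2l//; lra.
Qed.

Lemma ev_bounded_lnfib z : basin_infty P z ->
  ev_bounded (fun k => avg (fib k) (fun a => ln (N (z - a)))).
Proof.
move=> Oz; have [e e0 [k0 h]] := fib_away Oz.
pose B := N z + c + 1.
have B0 : 1 <= B by rewrite /B; have := mod_ge0 z; have := c0; lra.
apply: (@ev_bounded_avg _ _ _ _ (`|ln e| + ln B) k0).
  by rewrite addr_ge0// ln_ge0.
move=> k a kk ak; have zz : N (z - z) < e by rewrite subrr mod0.
have ea := h k z a kk zz ak; have x0 : 0 < N (z - a) by exact: lt_le_trans ea.
have hB : N (z - a) <= B by have := modB z a; have := (fibP ak).2; rewrite /B; lra.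
have l1 : ln e <= ln (N (z - a)) by rewrite ler_ln ?posrE.
have l2 : ln (N (z - a)) <= ln B by rewrite ler_ln ?posrE//; lra.
have l3 : 0 <= ln B by exact: ln_ge0.
rewrite ler_norml; apply/andP; split.
  have := ler_norm (- ln e); rewrite normrN; lra.
have := normr_ge0 (ln e); lra.
Qed.

Lemma ev_bounded_fib (f : C -> R) : lipb f ->
  ev_bounded (fun k => avg (fib k) f).
Proof.
move=> hf; have [M M0 hM] := lipb_bounded c hf.
by apply: (@ev_bounded_avg _ _ _ _ M 0) => // k a _ ak; exact: hM (fibP ak).2.
Qed.

Lemma measurable_julia : measurable (K : set (borel_cplx R)).
Proof.
rewrite (_ : K = \bigcap_k [set z | N (poly_iter P k).[z] <= r]).
  apply: (@bigcapT_measurable _ (borel_cplx R)) => k.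
  by apply: measurable_le; exact: lipb_modpoly.
apply/seteqP; split=> z.
  by move=> /(filled_juliaP z er) h k _; exact: h.
by move=> h; apply/(filled_juliaP z er) => k; exact: h.
Qed.

(** The balanced measure is the weak limit of the fibres. The truncated kernels
    are continuous, so their potentials are limits of means over the fibres.
    Partial sums of the series give the upper bounds, the cut-off logarithm the
    lower ones. In the basin the fibres keep away from [z] and the cut-off has
    no effect; on the filled Julia set the means of the logarithm are
    nonnegative and the cut-off ones small. *)
Lemma balanced_measure : exists nu : probability (borel_cplx R) R,
  [/\ nu K = 1%E,
      forall f, lipb f -> expect nu f = glim (fun k => avg (fib k) f),
      forall z, K z -> (fun n => moment nu (logker R n) z) @ \oo -->
        lconf z + expect nu (@lconf R) &
      forall z, basin_infty P z ->
        (fun n => moment nu (logker R n) z) @ \oo -->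
        lconf z + expect nu (@lconf R)
          - 2 * glim (fun k => avg (fib k) (fun a => ln (N (z - a))))].
Proof.
have [nu [ball weak]] := weak_limit c0 fib_gt0 (fun k a ak => (fibP ak).2).
have hE f : lipb f -> expect nu f = glim (fun k => avg (fib k) f).
  by move=> hf; rewrite /expect /Rintegral weak.
have ll := @lipb_lconf R.
have hU n z : moment nu (logker R n) z =
    glim (fun k => avg (fib k) (fun w => (logpoly R n).[sker z w])).
  by rewrite (moment_logker _ _ ball) hE//; exact: lipb_logpoly.
have bU n z : ev_bounded (fun k =>
    avg (fib k) (fun w => (logpoly R n).[sker z w])).
  by apply: ev_bounded_fib; exact: lipb_logpoly.
have bl := ev_bounded_fib ll.
(* the limit of lconf z + avg lconf - 2 u k *)
have glimL z (x : R) u : ev_bounded u ->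
    ev_bounded (fun k => (lconf z + x) + (avg (fib k) (@lconf R) + - 2 * u k)) /\
    glim (fun k => (lconf z + x) + (avg (fib k) (@lconf R) + - 2 * u k)) =
    lconf z + x + (expect nu (@lconf R) - 2 * glim u).
  move=> bu; have b2 := ev_boundedZ (- 2) bu.
  have b1 := ev_boundedD bl b2; have b0 := ev_bounded_cst (lconf z + x).
  split; first exact: ev_boundedD.
  by rewrite (glimD b0 b1) glim_cst (glimD bl b2) glimZ// hE// mulNr.
have avgL k z (x : R) (g : C -> R) :
   avg (fib k) (fun a => (lconf z + x) + (lconf a + - 2 * g a)) =
   (lconf z + x) + (avg (fib k) (@lconf R) + - 2 * avg (fib k) g).
  by rewrite avgD avg_cst// avgD avgZ.
(* each [f j] vanishes on all late fibres, so almost no orbit exceeds [c] *)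
have Kfull : nu K = 1%E.
  pose f j z := Num.max 0 (N (poly_iter P j).[z] - c).
  have fl j : lipb (f j).
    have hq : lipb (fun z => N (poly_iter P j).[z] - c).
      by apply: lipbD; [exact: lipb_modpoly|exact: lipb_cst].
    apply: (@lipb_comp _ (fun x => Num.max 0 x) 1 setT _ hq) => // x y _ _.
    rewrite mul1r /Num.max; case: ifPn => x0; case: ifPn => y0.
    - by [].
    - by rewrite subr0; move: x0 y0; rewrite -leNgt => ? ?;
        rewrite ler_norml; apply/andP; split; have := ler_norm (x - y);
        have := normr_ge0 (x - y); lra.
    - rewrite -leNgt in x0; rewrite sub0r normrN distrC.
      rewrite ger0_norm ?(ltW y0)//; have := ler_norm (y - x); lra.
    - by rewrite subrr normr0.
  have f0 j z : 0 <= f j z by rewrite /f le_max lexx.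
  have Ef j : (\int[nu]_z (f j z)%:E)%E = 0%E.
    rewrite weak//; congr EFin; rewrite -(glim_cst (0 : R)).
    apply: (glim_eq (k0 := j)); first exact: ev_bounded_fib.
    move=> k jk; rewrite -(@avg_cst _ _ (fib k) 0)//; apply: avg_eq => a ak.
    by rewrite /f max_l// subr_le0; exact: fib_iter_le ak.
  have neg j : nu.-negligible [set z | c < N (poly_iter P j).[z]].
    have mf : measurable_fun [set: borel_cplx R] (fun z => (f j z)%:E).
      by apply/measurable_EFinP; exact: lipb_measurable.
    have : (\int[nu]_z `|(f j z)%:E|)%E = 0%E.
      by rewrite -(Ef j); apply: eq_integral => z _; rewrite gee0_abs// lee_fin.
    move=> /(ae_eq_integral_abs nu measurableT mf) [B [mB B0 hB]].
    exists B; split=> // z /= hz; apply: hB => /= /(_ I) [] /eqP.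
    by rewrite /f gt_eqF// lt_max subr_gt0 hz orbT.
  have /negligible_bigcup [B [mB B0 hB]] := neg.
  have mK := measurable_julia.
  have KC0 : nu (~` K) = 0%E.
    apply/eqP; rewrite eq_le measure_ge0 andbT -B0; apply: le_measure;
      rewrite ?inE//; first exact: measurableC.
    move=> z nKz; apply: hB => /=.
    have /(basin_inftyP z er) [j hj] : basin_infty P z by [].
    have [i hi] := pow2_unbounded c.
    exists (i + j)%N => //=; rewrite poly_iterD_horner.
    apply: (lt_le_trans hi); apply: le_trans (escape_iter i er hj).
    by rewrite ler_peMr ?exprn_ge0//; have := er.1; lra.
  have := probability_setC nu (measurableC mK); rewrite setCK KC0 sube0.
  by [].
have lower z (u : nat -> R) (rho e : R) : 0 < rho -> rho <= 1 -> 0 < e ->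
    ev_bounded u ->
    (exists k0, forall k, (k0 <= k)%N ->
      avg (fib k) (fun a => ln (Num.max rho (N (a - z)))) <= u k) ->
    exists n0, forall n, (n0 <= n)%N ->
      lconf z + expect nu (@lconf R) - 2 * glim u - e <=
        moment nu (logker R n) z.
  move=> rho0 rho1 e0 bu [k0 hu].
  have [n0 hn] := logpoly_ge_cutoff z c rho0 rho1 e0.
  exists n0 => n nn; rewrite hU.
  have [b1 g1] := glimL z (- e) u bu.
  have -> : lconf z + expect nu (@lconf R) - 2 * glim u - e =
    lconf z - e + (expect nu (@lconf R) - 2 * glim u) by ring.
  rewrite -g1; apply: (glim_le (k0 := k0)) => // k kk.
  apply: (@le_trans _ _ (avg (fib k) (fun a => (lconf z - e) +
     (lconf a + - 2 * ln (Num.max rho (N (a - z))))))).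
    by rewrite avgL; have := hu k kk; lra.
  by apply: avg_le => a ak; have := hn n a nn (fibP ak).2; lra.
have upper z u n : ev_bounded u -> (exists k0, forall k, (k0 <= k)%N ->
    (forall a, a \in fib k -> z != a) /\
    u k <= avg (fib k) (fun a => ln (N (z - a)))) ->
    moment nu (logker R n) z <= lconf z + expect nu (@lconf R) - 2 * glim u.
  move=> bu [k0 hu]; rewrite hU.
  have [b1 g1] := glimL z 0 u bu; rewrite addr0 addrA in g1.
  rewrite -g1; apply: (glim_le (k0 := k0)) => //.
    by move: b1; rewrite addr0.
  move=> k kk; have [za uk] := hu k kk.
  apply: (@le_trans _ _ (avg (fib k) (fun a => (lconf z + 0) +
     (lconf a + - 2 * ln (N (z - a)))))); last by rewrite avgL; lra.
  apply: avg_le => a ak.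
  have := (log_series_bounds n (sker_ge0 z a) (sker_lt1 (za a ak))).1.
  by rewrite ln_sker ?za//; lra.
exists nu; split=> //.
- move=> z Kz; apply/cvgrPdist_le => e e0.
  have e20 : 0 < e / 2 by rewrite divr_gt0.
  have e40 : 0 < e / 4 by rewrite divr_gt0.
  have [rho /andP[rho0 rho1] hk] := julia_avg_cutoff Kz e40.
  have [n0 hn] := lower z (fun=> e / 4) rho (e / 2) rho0 rho1 e20
    (ev_bounded_cst _) hk.
  exists n0 => // n /= nn; have := hn n nn; rewrite glim_cst.
  have := upper z (fun=> 0) n (ev_bounded_cst _).
  rewrite glim_cst => up h1.
  have h2 := up (ex_intro _ 0%N (fun k _ => julia_avg_ln_ge0 k Kz)).
  by rewrite ler_norml; apply/andP; split; lra.
move=> z Oz; have bln := ev_bounded_lnfib Oz.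
have [e1 e10 [k0 hk0]] := fib_away Oz.
have zz : N (z - z) < e1 by rewrite subrr mod0.
apply/cvgrPdist_le => e e0.
pose rho := Num.min 1 e1.
have rho0 : 0 < rho by rewrite lt_min ltr01.
have rho1 : rho <= 1 by rewrite ge_min lexx.
have [] := lower z _ rho e rho0 rho1 e0 bln.
  exists k0 => k kk; apply: avg_le => a ak.
  rewrite max_r 1?modC// (le_trans _ (hk0 k z a kk zz ak))//.
  by rewrite ge_min lexx orbT.
move=> n0 hn; exists n0 => // n /= nn; have := hn n nn.
have := upper z _ n bln => up h1.
have h2 : moment nu (logker R n) z <= lconf z + expect nu (@lconf R) -
   2 * glim (fun k => avg (fib k) (fun a => ln (N (z - a)))).
  apply: up; exists k0 => k kk; split=> // a ak.
  have := hk0 k z a kk zz ak; apply: contraTneq => ->.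
  by rewrite subrr mod0 -ltNge.
by rewrite ler_norml; apply/andP; split; lra.
Qed.

End Fibres.
End Brolin.

(** * Derivatives from quadratic remainders *)

Section QuadraticDerivative.
Variable K : numFieldType.

(** A quadratic remainder estimate is the form in which every derivative
    below is obtained. *)
Lemma quadratic_derivable (f : K -> K) (x D M e : K) : 0 < e -> 0 <= M ->
  (forall h, `|h| < e -> `|f (x + h) - f x - h * D| <= M * `|h| ^+ 2) ->
  is_derive x 1 f D.
Proof.
move=> e0 M0 hf.
have cv : (fun h => h^-1 *: ((f \o shift x) (h *: 1) - f x)) @ 0^' --> D.
  apply/cvgrPdist_le => eps eps0.
  have M1 : 0 < M + 1 by rewrite ltr_wpDl.
  have m0 : 0 < eps / (M + 1) by rewrite divr_gt0.
  near=> h.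
  have h0 : h != 0 by near: h; exact: nbhs_dnbhs_neq.
  have he : `|h| < e by near: h; apply: dnbhs0_lt.
  have hm : `|h| < eps / (M + 1) by near: h; apply: dnbhs0_lt.
  rewrite /= /shift /= [h *: 1]mulr1 [h + x]addrC.
  have n0 : 0 < `|h| by rewrite normr_gt0.
  have -> : D - h^-1 *: (f (x + h) - f x) =
     - (h^-1 * (f (x + h) - f x - h * D)).
    by rewrite mulrBr mulKf// opprB.
  rewrite normrN normrM normfV -ler_pdivlMl ?invr_gt0// invrK.
  apply: (le_trans (hf h he)); rewrite expr2 mulrA mulrC ler_wpM2l ?(ltW n0)//.
  apply: (@le_trans _ _ ((M + 1) * `|h|)).
    by rewrite ler_wpM2r ?(ltW n0)// lerDl.
  by rewrite mulrC -ler_pdivlMr// ltW.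
have dv : derivable f x 1 by apply/cvg_ex; exists D.
by split=> //; apply: cvg_lim.
Unshelve. all: end_near. Qed.

End QuadraticDerivative.

(** * Limits of logarithmic derivatives *)

Section ComplexLimit.
Variable R : realType.
Local Notation C := (cplx R).
Local Notation N := (@Normc.normc R).
Implicit Types (u v : nat -> C) (z w a h : C) (s : seq C).

Definition cev_bounded u : Prop :=
  exists B k0, forall k, (k0 <= k)%N -> N (u k) <= B.

Definition cglim u : C :=
  (glim (fun k => complex.Re (u k)) +i* glim (fun k => complex.Im (u k)))%C.

Lemma ev_bounded_Re u : cev_bounded u -> ev_bounded (fun k => complex.Re (u k)).
Proof.
move=> [B [k0 h]]; exists B, k0 => k kk.
by apply: (le_trans (Re_le_mod _)); exact: h.
Qed.

Lemma ev_bounded_Im u : cev_bounded u -> ev_bounded (fun k => complex.Im (u k)).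
Proof.
move=> [B [k0 h]]; exists B, k0 => k kk.
by apply: (le_trans (Im_le_mod _)); exact: h.
Qed.

Lemma cev_boundedZ (c : C) u : cev_bounded u -> cev_bounded (fun k => c * u k).
Proof.
move=> [B [k0 h]]; exists (N c * B), k0 => k kk.
by rewrite modM ler_wpM2l ?mod_ge0// h.
Qed.

Lemma cev_boundedD u v : cev_bounded u -> cev_bounded v ->
  cev_bounded (fun k => u k + v k).
Proof.
move=> [B [k0 h]] [B' [k1 h']]; exists (B + B'), (maxn k0 k1) => k.
rewrite geq_max => /andP[kk kk']; apply: (le_trans (modD _ _)).
by rewrite lerD ?h ?h'.
Qed.

Lemma cglimD u v : cev_bounded u -> cev_bounded v ->
  cglim (fun k => u k + v k) = cglim u + cglim v.
Proof.
move=> bu bv.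
have h1 := glimD (ev_bounded_Re bu) (ev_bounded_Re bv).
have h2 := glimD (ev_bounded_Im bu) (ev_bounded_Im bv).
rewrite /cglim; apply/eqP; rewrite eq_complex /= -h1 -h2.
by apply/andP; split; apply/eqP; congr glim; apply/funext => k /=;
  case: (u k) (v k) => [? ?] [? ?].
Qed.

Lemma cglimZ (c : C) u : cev_bounded u -> cglim (fun k => c * u k) = c * cglim u.
Proof.
move=> bu; have b1 := ev_bounded_Re bu; have b2 := ev_bounded_Im bu.
case: c => x y; rewrite /cglim; apply/eqP; rewrite eq_complex /=.
have e (p q : R) : glim (fun k => p * complex.Re (u k) + q * complex.Im (u k)) =
   p * glim (fun k => complex.Re (u k)) + q * glim (fun k => complex.Im (u k)).
  by rewrite -(glimZ p b1) -(glimZ q b2) -glimD//; exact: ev_boundedZ.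
apply/andP; split; apply/eqP.
  rewrite -mulNr -e; congr glim; apply/funext => k.
  by case: (u k) => p q /=; rewrite mulNr.
rewrite addrC -e; congr glim; apply/funext => k.
by case: (u k) => p q /=; rewrite addrC.
Qed.

Lemma cglim_eq u v k0 : cev_bounded u -> (forall k, (k0 <= k)%N -> u k = v k) ->
  cglim u = cglim v.
Proof.
move=> bu h; rewrite /cglim.
rewrite (glim_eq (ev_bounded_Re bu) (fun k kk => congr1 _ (h k kk))).
by rewrite (glim_eq (ev_bounded_Im bu) (fun k kk => congr1 _ (h k kk))).
Qed.

(** The factor 2 comes from bounding real and imaginary parts separately. *)
Lemma cglim_le u (e : R) k0 : (forall k, (k0 <= k)%N -> N (u k) <= e) ->
  N (cglim u) <= 2 * e.
Proof.
move=> h; have bu : cev_bounded u by exists e, k0.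
have b0 := ev_bounded_cst (0 : R).
apply: (le_trans (mod_le_ReIm _)); rewrite /cglim /=.
have h1 : `|glim (fun k => complex.Re (u k)) - glim (fun=> (0 : R))| <= e.
  apply: (glim_dist_le (k0 := k0)) => //; first exact: ev_bounded_Re.
  by move=> k kk; rewrite subr0; apply: (le_trans (Re_le_mod _)); exact: h.
have h2 : `|glim (fun k => complex.Im (u k)) - glim (fun=> (0 : R))| <= e.
  apply: (glim_dist_le (k0 := k0)) => //; first exact: ev_bounded_Im.
  by move=> k kk; rewrite subr0; apply: (le_trans (Im_le_mod _)); exact: h.
by rewrite glim_cst !subr0 in h1 h2; lra.
Qed.

Lemma Re_cglim u : complex.Re (cglim u) = glim (fun k => complex.Re (u k)).
Proof. by []. Qed.

(** With [1 + v] for the square of [N (1 + t)], the logarithm of [1 + v] lies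
    between [v - v ^+ 2 / (1 + v)] and [v]. *)
Lemma ln_mod1D_quadratic (t : C) : N t <= 1 / 2 ->
  `|ln (N (1 + t)) - complex.Re t| <= 13 * N t ^+ 2.
Proof.
move=> ht; set n := N t in ht *; have n0 : 0 <= n by exact: mod_ge0.
set x := complex.Re t; have xn : `|x| <= n by exact: Re_le_mod.
have [xl xu] : - n <= x /\ x <= n by apply/andP; rewrite -ler_norml.
have e2 : N (1 + t) ^+ 2 = 1 + (2 * x + n ^+ 2).
  by rewrite /n !modsq /x; case: t {ht n n0 x xn xl xu} => p q /=; ring.
set v := 2 * x + n ^+ 2 in e2.
have v1 : 1 / 4 <= 1 + v by rewrite /v; nra.
have v0 : 0 < 1 + v by lra.
have p0 : 0 < N (1 + t).
  by rewrite lt_def mod_ge0 andbT -(sqrf_eq0 (N _)) e2 gt_eqF.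
have lnE : ln (1 + v) = 2 * ln (N (1 + t)).
  by rewrite -e2 lnXn// mulr_natl.
have up : ln (1 + v) <= v by apply: le_ln1Dx; lra.
have lo : v - v ^+ 2 / (1 + v) <= ln (1 + v).
  have h : ln ((1 + v)^-1) <= (1 + v)^-1 - 1.
    have -> : ln ((1 + v)^-1) = ln (1 + ((1 + v)^-1 - 1)).
      by congr ln; ring.
    by apply: le_ln1Dx; rewrite ltrBrDl subrr invr_gt0.
  rewrite lnV ?posrE// in h.
  have -> : v - v ^+ 2 / (1 + v) = 1 - (1 + v)^-1 by field; rewrite gt_eqF.
  lra.
have vb : v ^+ 2 / (1 + v) <= 25 * n ^+ 2.
  rewrite ler_pdivrMr//; have : v ^+ 2 <= (25 / 4) * n ^+ 2.
    have nn : n * n <= n * (1 / 2) by rewrite ler_wpM2l.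
    have nn0 : 0 <= n ^+ 2 by exact: sqr_ge0.
    have : `|v| <= (5 / 2) * n.
      rewrite ler_norml /v; apply/andP; split; lra.
    move=> hv; have : `|v| ^+ 2 <= ((5 / 2) * n) ^+ 2.
      by rewrite lerXn2r// nnegrE mulr_ge0// divr_ge0.
    by rewrite real_normK ?num_real// exprMn; lra.
  have : 0 <= n ^+ 2 by exact: sqr_ge0.
  by move: v1; move: (n ^+ 2) (v ^+ 2) => n2 v2; nra.
have n20 : 0 <= n ^+ 2 by exact: sqr_ge0.
have lo2 : v - 25 * n ^+ 2 <= ln (1 + v) by lra.
rewrite lnE in up lo2; have vE : v = 2 * x + n ^+ 2 by [].
by rewrite ler_norml; apply/andP; split; lra.
Qed.

Lemma ln_mod_quadratic (u h : C) (rho : R) : 0 < rho -> rho <= N u ->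
  N h <= rho / 2 ->
  `|ln (N (u + h)) - ln (N u) - complex.Re (h / u)| <= 13 / rho ^+ 2 * N h ^+ 2.
Proof.
move=> rho0 hu hh; have u0 : 0 < N u by exact: lt_le_trans hu.
have un : u != 0 by rewrite -mod_gt0.
have tle : N (h / u) <= N h / rho.
  by rewrite mod_div ler_wpM2l ?mod_ge0// lef_pV2.
have t2 : N (h / u) <= 1 / 2.
  by apply: (le_trans tle); rewrite ler_pdivrMr//; lra.
have h1 := ln_mod1D_quadratic t2.
have p0 : 0 < N (1 + h / u).
  by have := mod_triD (1 : C) (h / u); rewrite mod1; lra.
have -> : u + h = u * (1 + h / u) by rewrite mulrDr mulr1 mulrCA divff ?mulr1.
rewrite modM lnM ?posrE// [ln (N u) + _]addrC addrK.
apply: (le_trans h1); rewrite mulrAC -mulrA ler_wpM2l//.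
rewrite -expr_div_n lerXn2r ?nnegrE ?mod_ge0//.
by rewrite divr_ge0 ?mod_ge0 ?(ltW rho0).
Qed.

(** Complex differentiability with a quadratic remainder, stable under
    products and composition by elementary estimates. *)
Definition quad_at (f : C -> C) z : Prop := exists D M e, [/\ 0 < e, 0 <= M &
  forall h, N h < e -> N (f (z + h) - f z - h * D) <= M * N h ^+ 2].

Definition logder2 s z : C := \sum_(a <- s) ((z - a) ^+ 2)^-1.

Lemma logder_le s z (rho : R) : 0 < rho ->
  (forall a, a \in s -> rho <= N (z - a)) ->
  N (logder s z) <= (size s)%:R / rho.
Proof.
move=> rho0 hs; apply: (le_trans (mod_sum _ _ _)).
apply: (@le_trans _ _ (\sum_(a <- s) rho^-1)).
  rewrite [leLHS]big_seq [leRHS]big_seq; apply: ler_sum => a /hs ha.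
  by rewrite modV lef_pV2// posrE (lt_le_trans rho0).
by rewrite big_const_seq count_predT iter_addr addr0 mulr_natl.
Qed.

Lemma logder2_le s z (rho : R) : 0 < rho ->
  (forall a, a \in s -> rho <= N (z - a)) ->
  N (logder2 s z) <= (size s)%:R / rho ^+ 2.
Proof.
move=> rho0 hs; apply: (le_trans (mod_sum _ _ _)).
apply: (@le_trans _ _ (\sum_(a <- s) (rho ^+ 2)^-1)).
  rewrite [leLHS]big_seq [leRHS]big_seq; apply: ler_sum => a /hs ha.
  have p : 0 < N (z - a) by exact: lt_le_trans ha.
  by rewrite modV modX lef_pV2 ?posrE ?exprn_gt0// lerXn2r ?nnegrE ?(ltW rho0) ?(ltW p).
by rewrite big_const_seq count_predT iter_addr addr0 mulr_natl.
Qed.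

Lemma logder_quadratic s z h (rho : R) : 0 < rho ->
  (forall a, a \in s -> rho <= N (z - a)) -> N h <= rho / 2 ->
  N (logder s (z + h) - logder s z - h * - logder2 s z)
    <= (size s)%:R * (2 / rho ^+ 3 * N h ^+ 2).
Proof.
move=> rho0 hs hh; rewrite mulrN opprK /logder /logder2 mulr_sumr -sumrB -big_split.
apply: (le_trans (mod_sum _ _ _)).
apply: (@le_trans _ _ (\sum_(a <- s) (2 / rho ^+ 3 * N h ^+ 2))); last first.
  by rewrite big_const_seq count_predT iter_addr addr0 -[leLHS]mulr_natl.
rewrite [leLHS]big_seq [leRHS]big_seq; apply: ler_sum => a /hs ha /=.
set u := z - a in ha *; have -> : z + h - a = u + h by rewrite addrAC.
have u0 : 0 < N u by exact: lt_le_trans ha.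
have uh : rho / 2 <= N (u + h) by have := mod_triD u h; lra.
have uh0 : 0 < N (u + h) by apply: lt_le_trans uh; rewrite divr_gt0.
have un : u != 0 by rewrite -mod_gt0.
have uhn : u + h != 0 by rewrite -mod_gt0.
have -> : (u + h)^-1 - u^-1 + h * (u ^+ 2)^-1 = h ^+ 2 / (u ^+ 2 * (u + h)).
  by field; rewrite un uhn.
rewrite mod_div modM !modX mulrC ler_wpM2r ?sqr_ge0//.
have -> : 2 / rho ^+ 3 = (rho ^+ 2 * (rho / 2))^-1.
  by field; rewrite gt_eqF.
rewrite lef_pV2 ?posrE ?mulr_gt0 ?exprn_gt0 ?divr_gt0//.
apply: ler_pM => //; rewrite ?exprn_ge0 ?divr_ge0 ?(ltW rho0)//.
by rewrite lerXn2r ?nnegrE ?(ltW rho0) ?(ltW u0).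
Qed.

(** The Cauchy transform of the weak limit of the uniform measures on the
    lists [s k]. *)
Definition mean_logder (s : nat -> seq C) z : C :=
  cglim (fun k => (size (s k))%:R^-1 * logder (s k) z).

Lemma cev_bounded_logder (s : nat -> seq C) z (rho : R) k0 : 0 < rho ->
  (forall k, (0 < size (s k))%N) ->
  (forall k a, (k0 <= k)%N -> a \in s k -> rho <= N (z - a)) ->
  cev_bounded (fun k => (size (s k))%:R^-1 * logder (s k) z).
Proof.
move=> rho0 s0 hs; exists rho^-1, k0 => k kk.
have sk : 0 < (size (s k))%:R :> R by rewrite ltr0n.
rewrite modM modV mod_nat ler_pdivrMl//.
by apply: logder_le => // a; exact: hs.
Qed.

Lemma mean_logder_quad (s : nat -> seq C) z (rho : R) k0 : 0 < rho ->
  (forall k, (0 < size (s k))%N) ->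
  (forall k a, (k0 <= k)%N -> a \in s k -> rho <= N (z - a)) ->
  quad_at (mean_logder s) z.
Proof.
move=> rho0 s0 hs.
pose D : C := cglim (fun k => (size (s k))%:R^-1 * - logder2 (s k) z).
have sk k : 0 < (size (s k))%:R :> R by rewrite ltr0n.
exists D, (4 / rho ^+ 3), (rho / 2); split.
- by rewrite divr_gt0.
- by rewrite divr_ge0// exprn_ge0// ltW.
move=> h hh.
have b1 : cev_bounded (fun k => (size (s k))%:R^-1 * logder (s k) z).
  exact: cev_bounded_logder s0 hs.
have rho20 : 0 < rho / 2 by rewrite divr_gt0.
have b2 : cev_bounded (fun k => (size (s k))%:R^-1 * logder (s k) (z + h)).
  apply: (cev_bounded_logder (rho := rho / 2) (k0 := k0)) => // k a kk ak.
  have := hs k a kk ak; have := mod_triD (z - a) h.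
  by rewrite (addrAC z h (- a)); lra.
have b3 : cev_bounded (fun k => (size (s k))%:R^-1 * - logder2 (s k) z).
  exists (rho ^+ 2)^-1, k0 => k kk; rewrite modM modV mod_nat modN.
  by rewrite ler_pdivrMl//; apply: logder2_le => // a; exact: hs.
rewrite /mean_logder /D.
rewrite (_ : _ - _ - _ = cglim (fun k => (size (s k))%:R^-1 *
    (logder (s k) (z + h) - logder (s k) z - h * - logder2 (s k) z))).
  have -> : 4 / rho ^+ 3 * N h ^+ 2 = 2 * (2 / rho ^+ 3 * N h ^+ 2) by ring.
  apply: (cglim_le (k0 := k0)) => k kk; rewrite modM modV mod_nat ler_pdivrMl//.
  by apply: logder_quadratic => //; [move=> a; exact: hs|exact: ltW].
have b1' := cev_boundedZ (- 1) b1; have b3' := cev_boundedZ (- h) b3.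
rewrite -mulN1r -(cglimZ (-1) b1) -(cglimD b2 b1') -mulNr -(cglimZ (- h) b3).
rewrite -(cglimD (cev_boundedD b2 b1') b3'); congr cglim; apply/funext => k.
by ring.
Qed.

End ComplexLimit.

(** * The gradient of the Green's function *)

Section Gradient.
Variable R : realType.
Local Notation C := (cplx R).
Local Notation N := (@Normc.normc R).
Implicit Types (z w a h : C) (s : seq C).

Lemma quad_derivable f z : quad_at f z -> derivable f z 1.
Proof.
move=> [D [M [e [e0 M0 hf]]]].
suff : is_derive z (1 : C) f D by move=> h; exact: ex_derive.
apply: (@quadratic_derivable _ _ _ _ M%:C%C e%:C%C); rewrite ?ltcR ?lecR//.
by move=> h; rewrite !modE ltcR -rmorphXn -rmorphM lecR; exact: hf.
Qed.

Lemma quad_poly (p : {poly C}) z : quad_at (fun z => p.[z]) z.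
Proof.
exists p^`().[z]; suff [M M0 hM] : exists2 M, 0 <= M & forall h, N h < 1 ->
    N (p.[z + h] - p.[z] - h * p^`().[z]) <= M * N h ^+ 2.
  by exists M, 1.
elim/poly_ind: p => [|p c [M M0 IH]].
  exists 0 => // h _.
  by rewrite deriv0 !horner0 mulr0 !subr0 mod0 mul0r.
exists (M * (N z + 1) + N p^`().[z]).
  by rewrite addr_ge0 ?mulr_ge0 ?addr_ge0 ?mod_ge0.
move=> h h1; rewrite !hornerMXaddC derivD derivC addr0 derivM derivX mulr1.
rewrite hornerD hornerM hornerX.
have -> : p.[z + h] * (z + h) + c - (p.[z] * z + c) -
    h * (p^`().[z] * z + p.[z]) =
  (p.[z + h] - p.[z] - h * p^`().[z]) * (z + h) + p^`().[z] * h ^+ 2 by ring.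
apply: (le_trans (modD _ _)); rewrite [leRHS]mulrDl; apply: lerD; last first.
  by rewrite modM modX.
rewrite modM mulrAC; apply: ler_pM; rewrite ?mod_ge0 ?IH//.
by apply: (le_trans (modD _ _)); rewrite lerD2l ltW.
Qed.

Lemma quad_mul f g z : quad_at f z -> quad_at g z ->
  quad_at (fun z => f z * g z) z.
Proof.
move=> [D [M [e [e0 M0 hf]]]] [D' [M' [e' [e'0 M'0 hg]]]].
pose B := N (g z) + N D' + M'; pose A := N (f z) + N D.
have A0 : 0 <= A by rewrite addr_ge0 ?mod_ge0.
have B0 : 0 <= B by rewrite !addr_ge0 ?mod_ge0.
exists (D * g z + f z * D'), (M * B + A * M' + N D * N D'),
  (Num.min 1 (Num.min e e')).
split; first by rewrite !lt_min ltr01 e0.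
  by rewrite !addr_ge0 ?mulr_ge0 ?mod_ge0.
move=> h; rewrite !lt_min => /and3P[h1 he he'].
have ef := hf h he; have eg := hg h he'; have h0 := mod_ge0 h.
set E := f (z + h) - f z - h * D in ef; set E' := g (z + h) - g z - h * D' in eg.
have -> : f (z + h) * g (z + h) - f z * g z - h * (D * g z + f z * D') =
  E * g (z + h) + (f z + h * D) * E' + h ^+ 2 * (D * D') by rewrite /E /E'; ring.
have hB : N (g (z + h)) <= B.
  have -> : g (z + h) = g z + h * D' + E' by rewrite /E'; ring.
  apply: (le_trans (modD _ _)); apply: lerD.
    apply: (le_trans (modD _ _)); rewrite lerD2l modM ler_piMl ?mod_ge0//.
    exact: ltW.
  apply: (le_trans eg); by rewrite ler_piMr// exprn_ile1 ?mod_ge0 ?(ltW h1).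
have hA : N (f z + h * D) <= A.
  apply: (le_trans (modD _ _)); rewrite lerD2l modM ler_piMl ?mod_ge0//.
  exact: ltW.
apply: (le_trans (modD _ _)); rewrite [leRHS]mulrDl; apply: lerD; last first.
  by rewrite modM modX (modM D) mulrC.
apply: (le_trans (modD _ _)); rewrite [leRHS]mulrDl; apply: lerD.
  by rewrite modM mulrAC ler_pM ?mod_ge0.
by rewrite modM -mulrA ler_pM ?mod_ge0.
Qed.

Lemma quad_comp f g z : quad_at f z -> quad_at g (f z) ->
  quad_at (fun z => g (f z)) z.
Proof.
move=> [D [M [e [e0 M0 hf]]]] [D' [M' [e' [e'0 M'0 hg]]]].
pose A := N D + M; have A0 : 0 <= A by rewrite addr_ge0 ?mod_ge0.
have A1 : 0 < A + 1 by rewrite ltr_wpDl.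
exists (D * D'), (M' * A ^+ 2 + M * N D'),
  (Num.min 1 (Num.min e (e' / (A + 1)))).
split; first by rewrite !lt_min ltr01 e0 divr_gt0.
  by rewrite addr_ge0 ?mulr_ge0 ?exprn_ge0 ?mod_ge0.
move=> h; rewrite !lt_min => /and3P[h1 he he'].
have ef := hf h he; have h0 := mod_ge0 h.
set E := f (z + h) - f z - h * D in ef; pose k := f (z + h) - f z.
have kA : N k <= A * N h.
  have -> : k = h * D + E by rewrite /k /E; ring.
  apply: (le_trans (modD _ _)); rewrite [leRHS]mulrDl; apply: lerD.
    by rewrite modM mulrC.
  by apply: (le_trans ef); rewrite ler_wpM2l// expr2 ler_piMr// (ltW h1).
have ke : N k < e'.
  apply: (le_lt_trans kA); rewrite ltr_pdivlMr// in he'.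
  by apply: le_lt_trans he'; rewrite mulrC ler_wpM2l// lerDl.
have eg := hg k ke; rewrite (_ : f z + k = f (z + h)) in eg; last by rewrite /k; ring.
have -> : g (f (z + h)) - g (f z) - h * (D * D') =
   (g (f (z + h)) - g (f z) - k * D') + E * D' by rewrite /k /E; ring.
apply: (le_trans (modD _ _)); rewrite [leRHS]mulrDl; apply: lerD.
  apply: (le_trans eg); rewrite -mulrA ler_wpM2l// -exprMn.
  by rewrite lerXn2r ?nnegrE ?mod_ge0// mulr_ge0.
by rewrite modM mulrAC ler_wpM2r ?mod_ge0.
Qed.

Lemma Re_natV (n : nat) z : complex.Re ((n%:R)^-1 * z) = (n%:R)^-1 * complex.Re z.
Proof.
have -> : (n%:R : C)^-1 = ((n%:R : R)^-1)%:C%C by rewrite fmorphV rmorph_nat.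
by case: z => x y; rewrite /= mul0r subr0.
Qed.

Lemma Re_logder_avg s z h :
  complex.Re (h * ((size s)%:R^-1 * logder s z)) =
  avg s (fun a => complex.Re (h / (z - a))).
Proof.
by rewrite mulrCA Re_natV /logder mulr_sumr Re_sum /avg mulrC.
Qed.

Section Fibres.
Variables (P : {poly C}) (d : nat) (r : R) (fib : nat -> seq C).
Hypotheses (Pm : P \is monic) (sP : size P = d.+1) (d1 : (1 < d)%N).
Hypothesis er : escape_radius P r.
Let c : R := r + 1.
Hypothesis fibE : forall k, poly_iter P k - (c%:C%C)%:P = rootpoly (fib k).
Hypothesis fib_size : forall k, size (fib k) = (d ^ k)%N.
Hypothesis fibP : forall k a, a \in fib k ->
  (poly_iter P k).[a] = c%:C%C /\ N a <= c.

Let fib_gt0 k : (0 < size (fib k))%N.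
Proof. by rewrite fib_size expn_gt0 (ltnW d1). Qed.

(** The potential of the balanced measure on the basin. *)
Definition fibre_potential z : R :=
  glim (fun k => avg (fib k) (fun a => ln (N (z - a)))).

Lemma basin_open z : basin_infty P z ->
  exists2 e, 0 < e & forall w, N (w - z) < e -> basin_infty P w.
Proof.
move=> Oz; have [e e0 [k0 h]] := basin_local r er Oz.
exists e => // w hw; apply/(basin_inftyP w er); exists k0.
exact: h (leqnn k0) hw.
Qed.

Lemma fibre_potential_quadratic z : basin_infty P z ->
  exists2 M, 0 <= M & exists2 e, 0 < e & forall h, N h < e ->
    `|fibre_potential (z + h) - fibre_potential z
      - complex.Re (h * mean_logder fib z)| <= M * N h ^+ 2.
Proof.
move=> Oz; have [rho rho0 [k0 hk]] := fib_away er fibP Oz.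
have [e1 e10 he1] := basin_open Oz.
exists (13 / rho ^+ 2); first by rewrite divr_ge0// exprn_ge0// ltW.
exists (Num.min e1 (rho / 2)); first by rewrite lt_min e10 divr_gt0.
move=> h; rewrite lt_min => /andP[h1 h2].
have zz : N (z - z) < rho by rewrite subrr mod0.
have far k a : (k0 <= k)%N -> a \in fib k -> rho <= N (z - a).
  by move=> kk ak; exact: hk kk zz ak.
have Oh : basin_infty P (z + h) by apply: he1; rewrite addrC addKr.
have b1 := ev_bounded_lnfib er fibP Oh.
have b2 := ev_bounded_lnfib er fibP Oz.
have b3 := cev_bounded_logder rho0 fib_gt0 far.
have b4 := ev_bounded_Re (cev_boundedZ h b3).
have -> : complex.Re (h * mean_logder fib z) =
    glim (fun k => avg (fib k) (fun a => complex.Re (h / (z - a)))).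
  rewrite /mean_logder -(cglimZ h b3) Re_cglim.
  by congr glim; apply/funext => k; exact: Re_logder_avg.
have b5 : ev_bounded (fun k => avg (fib k) (fun a => complex.Re (h / (z - a)))).
  by under eq_fun do rewrite -Re_logder_avg.
rewrite -addrA -opprD -(glimD b2 b5).
apply: (glim_dist_le (k0 := k0)) => //; first exact: ev_boundedD.
move=> k kk /=; rewrite -avgD -mulN1r -avgZ -avgD.
apply: avg_norm_le.
  by rewrite mulr_ge0 ?sqr_ge0// divr_ge0// exprn_ge0// ltW.
move=> a ak; have := ln_mod_quadratic rho0 (far k a kk ak) (ltW h2).
by rewrite mulN1r opprD addrA (addrAC z h (- a)).
Qed.

(** The first order term of the potential is the real part of
    [h * mean_logder fib z]; the two partial derivatives are read off real and
    imaginary [h]. *)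
Lemma gradient_fibre_potential (g : C -> R) z :
  (forall w, basin_infty P w -> g w = fibre_potential w) ->
  basin_infty P z -> complex_gradient g z = mean_logder fib z.
Proof.
move=> gE Oz; have [M M0 [e e0 he]] := fibre_potential_quadratic Oz.
have [e1 e10 he1] := basin_open Oz.
set H := mean_logder fib z in he *.
have key (emb : R -> C) (D : R) : emb 0 = 0 -> (forall t, N (emb t) = `|t|) ->
    (forall t, complex.Re (emb t * H) = t * D) ->
    derive1 (fun t : R => g (z + emb t)) 0 = D.
  move=> emb0 embN embD; rewrite derive1E.
  suff h : is_derive (0 : R) 1 (fun t : R => g (z + emb t)) D by rewrite derive_val.
  apply: (@quadratic_derivable _ _ _ _ M (Num.min e e1)) => //.
    by rewrite lt_min e0.
  move=> t; rewrite lt_min add0r => /andP[te te1].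
  have Ot : basin_infty P (z + emb t) by apply: he1; rewrite addrC addKr embN.
  by rewrite emb0 addr0 !gE// -embD -(embN t); apply: he; rewrite embN.
rewrite /complex_gradient /partial_x /partial_y.
rewrite (key (fun t => (t +i* 0)%C) (complex.Re H))//; last 2 first.
- by move=> t; exact: (mod_real t).
- by move=> t; case: (H) => x y /=; rewrite mul0r subr0.
rewrite (key (fun t => (0 +i* t)%C) (- complex.Im H))//.
- by rewrite opprK; case: (H).
- by move=> t; rewrite /Normc.normc expr0n add0r sqrtr_sqr.
- by move=> t; case: (H) => x y /=; rewrite mul0r sub0r mulrN.
Qed.

Section Outer.
Variable n : nat.

(** The map [poly_iter P n] sends [fib k] to [fib (k - n)]; the factor
    accounts for the different sizes of these fibres. *)
Definition outer_factor w : C :=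
  ((d ^ n)%:R)^-1 * mean_logder (fun k => fib (k - n)) w.

Let outer_far w k a : (0 <= k)%N -> a \in fib (k - n) -> N w - c <= N (w - a).
Proof. by move=> _ /fibP [_ ac]; have := mod_tri w a; lra. Qed.

Lemma outer_factor_quad w : c < N w -> quad_at outer_factor w.
Proof.
move=> cw; have w0 : 0 < N w - c by rewrite subr_gt0.
have h := quad_poly (((d ^ n)%:R^-1 : C)%:P) w.
have h1 : quad_at (fun=> ((d ^ n)%:R^-1 : C)) w.
  by move: h; under eq_fun do rewrite hornerC.
apply: quad_mul h1 _.
exact: mean_logder_quad w0 (fun k => fib_gt0 (k - n)) (@outer_far w).
Qed.

(** No cancellation outside the disc that contains the fibres, by
    [Re_inv_ge]. *)
Lemma outer_factor_neq0 w : c < N w -> outer_factor w != 0.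
Proof.
move=> cw; have w0 : 0 < N w - c by rewrite subr_gt0.
have b := cev_bounded_logder w0 (fun k => fib_gt0 (k - n)) (@outer_far w).
rewrite /outer_factor mulf_neq0 ?invr_eq0 ?pnatr_eq0 -?lt0n ?expn_gt0 ?(ltnW d1)//.
apply/eqP => m0.
have : 1 / 2 <= complex.Re (w * mean_logder (fun k => fib (k - n)) w).
  rewrite /mean_logder -(cglimZ w b) Re_cglim -[leLHS]glim_cst.
  apply: (glim_le (k0 := 0%N)); first exact: ev_bounded_cst.
    exact: ev_bounded_Re (cev_boundedZ w b).
  move=> k _; rewrite mulrCA Re_natV.
  have sk : 0 < (size (fib (k - n)))%:R :> R by rewrite ltr0n.
  rewrite ler_pdivlMl// mulrA mulr1.
  exact: logder_Re_ge (fun a ak => (fibP ak).2) cw.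
by rewrite m0 mulr0 /=; lra.
Qed.

(** The limit of the chain rule for logarithmic derivatives. It separates the
    critical points from a factor without zeros. *)
Lemma mean_logder_factor z : c < N (poly_iter P n).[z] ->
  mean_logder fib z =
  (poly_iter P n)^`().[z] * outer_factor (poly_iter P n).[z].
Proof.
move=> cw; set w := (poly_iter P n).[z]; set q' := _.[z].
have w0 : 0 < N w - c by rewrite subr_gt0.
have b := cev_bounded_logder w0 (fun k => fib_gt0 (k - n)) (@outer_far w).
rewrite /outer_factor mulrA -(cglimZ _ b).
apply/esym; apply: (cglim_eq (k0 := n)); first exact: cev_boundedZ.
move=> k nk; have zs : z \notin fib k.
  apply/negP => zk; have := fib_iter_le er fibP nk zk.
  by rewrite leNgt cw.
have ws : w \notin fib (k - n) by apply/negP => /fibP [_]; rewrite leNgt cw.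
have fE := fibE k; rewrite -{1}(subnK nk) in fE.
rewrite (logder_chain fE (fibE (k - n)) zs ws) -/w -/q' !fib_size.
have dn j : ((d ^ j)%:R : C) != 0 by rewrite pnatr_eq0 -lt0n expn_gt0 (ltnW d1).
have -> : (d ^ k)%:R = (d ^ n)%:R * (d ^ (k - n))%:R :> C.
  by rewrite -natrM -expnD subnKC.
by rewrite invfM; ring.
Qed.

End Outer.
End Fibres.

Lemma mup_factor (p : {poly C}) z : p != 0 ->
  exists2 q, p = q * ('X - z%:P) ^+ mup z p & q.[z] != 0.
Proof.
move=> p0; have [m [q]] := multiplicity_XsubC p z; rewrite p0 /= => qz pE.
exists q; last by rewrite -/(root q z).
have q0 : q != 0 by apply: contraNneq qz => ->; rewrite root0.
suff -> : mup z p = m by [].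
by rewrite pE mupMr// mup_XsubCX eqxx.
Qed.

End Gradient.

(** * Critical points as roots *)

Section Assembly.
Variable R : realType.
Local Notation C := (cplx R).
Local Notation N := (@Normc.normc R).

Lemma zero_order_factor (f : C -> C) (p q : {poly C}) (g : C -> C) z0 (e : R) :
  p != 0 -> 0 < e ->
  (forall z, N (z - z0) < e -> f z = p.[z] * g q.[z] /\ quad_at g q.[z]) ->
  g q.[z0] != 0 -> zero_order f z0 (mup z0 p).
Proof.
move=> p0 e0 fE gz; have [rr pE rz] := mup_factor z0 p0.
exists (fun z => rr.[z] * g q.[z]); split; last 1 first.
- apply/nbhs_mod; exists e => // z /fE [-> _].
  by rewrite {1}pE hornerM horner_exp hornerXsubC /= mulrA [_ * rr.[z]]mulrC.
- apply/nbhs_mod; exists e => // z /fE [_ gq].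
  apply: quad_derivable; apply: quad_mul; first exact: quad_poly.
  exact: quad_comp (quad_poly q z) gq.
by rewrite mulf_neq0.
Qed.

Lemma nbhs_notin_boundary (A : set C) z : A z -> ~ boundary A z -> nbhs z A.
Proof.
move=> Az nb; apply: contrapT => nA; apply: nb; split => //.
exact: subset_closure.
Qed.

End Assembly.

Theorem proposition1 (R : realType) (P : {poly cplx R}) (d : nat)
    (omega : probability (borel_cplx R) R) (C : set (cplx R)) :
  P \is monic -> size P = d.+1 -> (1 < d)%N ->
  equilibrium_measure (filled_julia P) omega ->
  compact C -> C `<=` basin_infty P ->
  (forall z, boundary C z ->
     ~ critical_points (basin_infty P) (green_function omega) z) ->
  exists s : nat,
    nb_critical_points (basin_infty P) (green_function omega) C s /\
    forall m : nat, exists k0 : nat, forall k : nat, (k0 <= k)%N ->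
      nb_roots (derivn m (poly_iter P k)) C (s * m)%N.
Proof.
move=> Pm sP d1 eqm cC CO bdry.
have [r er] := escape_radius_exists Pm sP d1.
have rc : r < r + 1 by rewrite ltrDl.
have [fib fibs] := choice (fun k => fibre_exists k Pm sP d1 er rc).
have fibE k : poly_iter P k - ((r + 1)%:C%C)%:P = rootpoly (fib k).
  by have [] := fibs k.
have fib_size k : size (fib k) = (d ^ k)%N by have [] := fibs k.
have fibP k a : a \in fib k ->
    (poly_iter P k).[a] = (r + 1)%:C%C /\ Normc.normc a <= r + 1.
  by have [_ _] := fibs k; exact.
have [e e0 [n esc]] := basin_compact (r + 1) er cC CO.
have greenE z : basin_infty P z ->
    green_function omega z = fibre_potential fib z.
  move=> Oz.
  have [nu [nuK _ onK offK]] := balanced_measure Pm sP d1 er fibE fib_size fibP.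
  apply: (equilibrium_potential (M := r) (measurable_julia er) _ eqm nuK onK).
    move=> w /(filled_juliaP w er) /(_ 0%N).
    by rewrite poly_iter0 hornerX.
  exact: offK.
have gradE z : basin_infty P z ->
    complex_gradient (green_function omega) z = mean_logder fib z.
  exact: (gradient_fibre_potential d1 er fib_size fibP greenE).
set q := poly_iter P n in esc; set q' := q^`().
have q'0 : q' != 0.
  apply: deriv_neq0; have [_ ->] := size_poly_iter n Pm sP (ltnW d1).
  by rewrite ltnS expn_gt0 (ltnW d1).
have factor z : basin_infty P z -> r + 1 < Normc.normc q.[z] ->
    complex_gradient (green_function omega) z =
    q'.[z] * outer_factor d fib n q.[z].
  move=> Oz qz; rewrite gradE//.
  exact: (mean_logder_factor d1 er fibE fib_size fibP qz).
have escC z : C z -> r + 1 < Normc.normc q.[z].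
  by move=> Cz; apply: esc Cz _ => //; rewrite subrr mod0.
have critE z : C z ->
    critical_points (basin_infty P) (green_function omega) z <-> root q' z.
  move=> Cz; rewrite /critical_points /= factor; [|exact: CO|exact: escC].
  have oz := outer_factor_neq0 d1 fib_size fibP n (escC z Cz).
  split => [[_ /eqP]|qz]; first by rewrite mulf_eq0 (negbTE oz) orbF.
  by split; [exact: CO|rewrite (eqP qz) mul0r].
have [t tE] := closed_factor q'0.
have l0 : lead_coef q' != 0 by rewrite lead_coef_eq0.
(* a root on the boundary would be a critical point on it *)
have interior_root b : root q' b -> C b -> nbhs b C.
  move=> qb Cb; apply: nbhs_notin_boundary => // /bdry; apply.
  exact/(critE b Cb).
exists (count_in C t); split; last first.
  move=> m; apply: (derivative_root_count Pm sP d1 er cC (e := e) _ l0 tE) => //.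
  move=> b bt; apply: interior_root; rewrite tE rootZ//.
  by rewrite /rootpoly root_prod_XsubC.
have critC : C `&` critical_points (basin_infty P) (green_function omega) =
    C `&` [set z | root q' z].
  by apply/seteqP; split => z [Cz /(critE z Cz) h].
rewrite /nb_critical_points critC; split; first exact: finite_roots_in.
exists (fun z => mup z q'); split; last first.
  exact: (nb_roots_count l0 tE (erefl _)).2.
move=> z [Cz _]; have [e1 e10 he1] := basin_open er (CO z Cz).
apply: (@zero_order_factor _ _ q' q (outer_factor d fib n) z (Num.min e e1)) => //.
- by rewrite lt_min e0.
- move=> w; rewrite lt_min => /andP[we we1].
  have qw : r + 1 < Normc.normc q.[w] by exact: esc (leqnn n) Cz we.
  split; first by apply: factor => //; exact: he1.
  exact: outer_factor_quad d1 fib_size fibP n _ qw.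
- exact: (outer_factor_neq0 d1 fib_size fibP n (escC z Cz)).
Qed.
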